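(* Let $D\subset\mathbb Z^d$ ($d\ge1$) be a finite non-empty set, let $\Gamma$ be a discrete Gaussian free field in $D$ with Dirichlet boundary conditions, and let $(\mathcal W_{1/2}(x))_{x\in D}$ be the occupation-time field of the continuous-time (oriented) loop-soup in $D$ with intensity $\alpha=1/2$. Then the field $(\mathcal W_{1/2}(x))_{x\in D}$ has the same law as $(\Gamma(x)^2/2)_{x\in D}$.
   Context: Discrete GFF: for finite $D\subset\mathbb Z^d$ let $\partial D$ be the set of points of $\mathbb Z^d$ at distance $1$ from $D$. The discrete GFF in $D$ with Dirichlet boundary conditions is the centred Gaussian vector $(\Gamma(x))_{x\in D}$ whose density at $(\gamma_x)_{x\in D}$ is proportional to $\exp\big(-\frac12\cdot\frac1{2d}\sum_e|\nabla\gamma(e)|^2\big)$, where the sum is over all unoriented edges $e=\{x,y\}$ of $\mathbb Z^d$ with at least one endpoint in $D$, $|\nabla\gamma(e)|=|\gamma_x-\gamma_y|$, and $\gamma=0$ on $\partial D$. Loops: a rooted loop in $D$ is a nearest-neighbour sequence $l=(l_0,\dots,l_m)$ in $D$ with $m>1$ and $l_0=l_m$; its length is $|l|=m$. An unrooted loop $L$ is an equivalence class of rooted loops under cyclic relabelling; $|L|$ is its length. Its multiplicity $J(L)$ is the maximal integer $J$ such that a representative can be written as the concatenation of $J$ identical rooted loops. The unrooted loop measure $\mu_D$ gives mass $(2d)^{-|L|}/J(L)$ to each unrooted loop $L$ in $D$. A discrete loop-soup with intensity $\alpha>0$ in $D$ is a Poisson point process of unrooted loops with intensity $\alpha\mu_D$.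 Continuous-time loop-soup with intensity $\alpha$: sample a discrete loop-soup with intensity $\alpha$ and, independently for each loop and each of its $|L|$ steps, an exponential waiting time of mean $1$ (the time spent at the site visited at that step). In addition, independently for each $x\in D$, add an independent Poisson point process of loops that visit only the point $x$, described by their positive time-lengths, with intensity $\alpha\,e^{-t}\,dt/t$ on $(0,\infty)$. The occupation-time field $\mathcal W_\alpha(x)$ is the total time spent at $x$ by all these loops. *)

(* Defs.v *)
From HB Require Import structures.
From mathcomp Require Import all_boot all_order all_algebra.
From mathcomp Require Import finmap generic_quotient.
From mathcomp Require Import all_classical all_reals all_analysis measurable_realfun.

Set Implicit Arguments.
Unset Strict Implicit.
Unset Printing Implicit Defensive.

Import Order.TTheory GRing.Theory Num.Theory.
Import numFieldNormedType.Exports.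

Local Open Scope classical_set_scope.
Local Open Scope ring_scope.
Local Open Scope quotient_scope.

Definition cylinders (I : Type) d (T : measurableType d) : set (set (I -> T)) :=
  \bigcup_i preimage_set_system setT (fun f : I -> T => f i) measurable.

Definition fields (I : Type) d (T : measurableType d) :=
  g_sigma_algebraType (@cylinders I d T).

(* [P1] and [P2] are only meaningful on measurable sets, hence the first two
   conditions. *)
Definition same_law (I : Type) d (T : measurableType d)
    d1 (Omega1 : measurableType d1) d2 (Omega2 : measurableType d2)
    (R : realType) (P1 : probability Omega1 R) (P2 : probability Omega2 R)
    (X : I -> Omega1 -> T) (Y : I -> Omega2 -> T) : Prop :=
  [/\ forall i, measurable_fun setT (X i),
      forall i, measurable_fun setT (Y i) &
      forall B : set (fields I T), measurable B ->
        P1 [set w | B (X ^~ w)] = P2 [set w | B (Y ^~ w)]].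

Section lebesgue_cons.
Context (R : realType) (n : nat).
Variable mu : {sigma_finite_measure set (n.-tuple (measurableTypeR R)) -> \bar R}.

Let cons (p : measurableTypeR R * n.-tuple (measurableTypeR R)) :
  n.+1.-tuple (measurableTypeR R) := [tuple of p.1 :: p.2].

Let uncons (t : n.+1.-tuple (measurableTypeR R)) :
  measurableTypeR R * n.-tuple (measurableTypeR R) :=
  (tnth t ord0, [tuple of behead t]).

Let measurable_fun_cons : measurable_fun setT cons.
Proof. exact: measurable_cons. Qed.

Let measurable_fun_uncons : measurable_fun setT uncons.
Proof.
apply/measurable_fun_pair.
  exact: measurable_tnth.
exact: measurable_behead.
Qed.

Let consK : cancel cons uncons.
Proof. by case=> x t; congr pair; exact: val_inj. Qed.

Definition lebesgue_cons : set (n.+1.-tuple (measurableTypeR R)) -> \bar R :=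
  pushforward (@lebesgue_measure R \x mu)%E cons.

Let lebesgue_cons0 : lebesgue_cons set0 = 0%E.
Proof. by rewrite /lebesgue_cons /pushforward preimage_set0 measure0. Qed.

Let lebesgue_cons_ge0 A : (0 <= lebesgue_cons A)%E.
Proof. exact: measure_ge0. Qed.

Let lebesgue_cons_sigma_additive : semi_sigma_additive lebesgue_cons.
Proof.
move=> F mF tF mUF; rewrite /lebesgue_cons /pushforward preimage_bigcup.
apply: measure_semi_sigma_additive.
- by move=> i; rewrite -[X in measurable X]setTI; exact: measurable_fun_cons.
- apply/trivIsetP => /= i j _ _ ij; rewrite -preimage_setI.
  by move/trivIsetP : tF => /(_ _ _ _ _ ij) ->//; rewrite preimage_set0.
- rewrite -preimage_bigcup -[X in measurable X]setTI.
  exact: measurable_fun_cons.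
Qed.

HB.instance Definition _ := isMeasure.Build _ _ _ lebesgue_cons
  lebesgue_cons0 lebesgue_cons_ge0 lebesgue_cons_sigma_additive.

Let lebesgue_cons_sigma_finite : sigma_finite setT lebesgue_cons.
Proof.
have [F TF mF] : sigma_finite setT (@lebesgue_measure R \x mu)%E.
  have /sigma_finiteP[F [TF ndF Foo]] := sigma_finiteT (@lebesgue_measure R).
  have /sigma_finiteP[G [TG ndG Goo]] := sigma_finiteT mu.
  exists (fun n => F n `*` G n) => [|k].
    rewrite -setXTT TF TG predeqE => -[x y]; split.
      move=> [/= [i _ Fix] [k _ Gky]]; exists (maxn i k) => //; split.
      - by move: x Fix; exact/subsetPset/ndF/leq_maxl.
      - by move: y Gky; exact/subsetPset/ndG/leq_maxr.
    by move=> [i _ []/= ? ?]; split; exists i.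
  have [? ?] := Foo k; have [? ?] := Goo k.
  split; first exact: measurableX.
  by rewrite product_measure1E// lte_mul_pinfty// ge0_fin_numE.
exists (fun k => uncons @^-1` F k) => [|k].
  by rewrite -preimage_bigcup -TF preimage_setT.
split.
  rewrite -[X in measurable X]setTI; apply: measurable_fun_uncons => //.
  exact: (mF k).1.
rewrite /lebesgue_cons /pushforward -comp_preimage.
have -> : uncons \o cons = id by apply/funext => p /=; exact: consK.
exact: (mF k).2.
Qed.

HB.instance Definition _ := @Measure_isSigmaFinite.Build _ _ _ lebesgue_cons
  lebesgue_cons_sigma_finite.

End lebesgue_cons.

Fixpoint lebesgue_tuple (R : realType) (n : nat) :
    {sigma_finite_measure set (n.-tuple (measurableTypeR R)) -> \bar R} :=
  match n with
  | 0 => \d_([tuple] : 0.-tuple (measurableTypeR R))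
  | n'.+1 => lebesgue_cons (lebesgue_tuple R n')
  end.

Definition lattice (d : nat) := 'rV[int]_d.

HB.instance Definition _ d := GRing.Zmodule.on (lattice d).

Definition adj (d : nat) : rel (lattice d) :=
  fun x y => \sum_(i < d) `|x ord0 i - y ord0 i| == 1.

Definition edges (d : nat) (D : {fset lattice d}) : set {fset lattice d} :=
  [set e | exists x y, [/\ e = [fset x; y]%fset, adj x y &
                           (x \in D) || (y \in D)]].

Section gff.
Context (R : realType) (d : nat) (D : {fset lattice d}).

(* The value 0 outside [D] is the Dirichlet boundary condition. *)
Definition extend0 (gamma : D -> R) (x : lattice d) : R :=
  oapp gamma 0 (insub x).

(* [|gamma_x - gamma_y|] for [e = {x, y}]; it does not depend on the order in
   which the two elements of [e] are enumerated. *)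
Definition grad (gamma : D -> R) (e : {fset lattice d}) : R :=
  `|extend0 gamma (nth 0 e 0%N) - extend0 gamma (nth 0 e 1%N)|.

Definition gff_density (gamma : D -> R) : R :=
  expR (- (2^-1 * (2 * d%:R)^-1 * \sum_(e \in edges D) grad gamma e ^+ 2)).

Definition field_of_tuple (t : #|{: D}|.-tuple (measurableTypeR R)) : D -> R :=
  fun x => tnth t (enum_rank x).

Definition is_dirichlet_gff d' (Omega : measurableType d')
    (P : probability Omega R) (Gamma : D -> {RV P >-> R}) : Prop :=
  exists2 c : R, 0 < c &
    forall B : set (fields D R), measurable B ->
      P [set w | B (fun x => Gamma x w)] =
      (\int[lebesgue_tuple R #|{: D}|]_(t in field_of_tuple @^-1` B)
         (c * gff_density (field_of_tuple t))%:E)%E.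

End gff.

Section cyclic_words.
Context (T : choiceType).

Definition cyc_equiv : rel (seq T) :=
  fun l l' => `[< exists k, l' = rot k l >].

Let cyc_equivP : equiv_class_of cyc_equiv.
Proof.
have cyc_sym l l' : cyc_equiv l l' -> cyc_equiv l' l.
  by move=> /asboolP[k ->]; apply/asboolP; exists (size (rot k l) - k)%N;
    rewrite -/(rotr k _) rotK.
split=> [l|l l'|l2 l1 l3].
- by apply/asboolP; exists 0%N; rewrite rot0.
- by apply/idP/idP; exact: cyc_sym.
- move=> /asboolP[k ->] /asboolP[k' ->]; apply/asboolP.
  by exists (rot_add l1 k k'); rewrite rot_rot_add.
Qed.

Canonical cyc_equiv_rel := EquivRelPack cyc_equivP.

(* The empty word is kept so that the type is pointed, as required of a
   [measurableType]. *)
Definition cyclic_word := {eq_quot cyc_equiv_rel}.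

HB.instance Definition _ := Choice.on cyclic_word.
HB.instance Definition _ := EqQuotient.on cyclic_word.
HB.instance Definition _ := isPointed.Build cyclic_word (\pi_cyclic_word [::]).
HB.instance Definition _ := @isMeasurable.Build default_measure_display
  cyclic_word discrete_measurable discrete_measurable0
  discrete_measurableC discrete_measurableU.

End cyclic_words.

Section loops.
Context (d : nat).

(* The rooted loop (l_0, ..., l_m), l_m = l_0, is encoded by the word
   [:: l_0; ...; l_(m-1)], of size m; concatenation of loops is then
   concatenation of words, and cyclic relabelling is [rot]. *)
Definition rooted_loop (l : seq (lattice d)) : bool :=
  (1 < size l)%N && cycle (@adj d) l.

Definition unrooted_loops (D : {fset lattice d}) : set (cyclic_word (lattice d)) :=
  [set \pi_(cyclic_word (lattice d)) l |
     l in [set l | rooted_loop l /\ {subset l <= D}]].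

Definition loop_length (L : cyclic_word (lattice d)) : nat := size (repr L).

(* The bound on [J] loses nothing: a concatenation of [J] loops has length at
   least [J]. *)
Definition multiplicity (L : cyclic_word (lattice d)) : nat :=
  \max_(J < (loop_length L).+1 |
     `[< exists l, rooted_loop l /\
           L = \pi_(cyclic_word (lattice d)) (flatten (nseq J l)) >]) J.

Definition loop_measure (R : realType) (D : {fset lattice d})
    (A : set (cyclic_word (lattice d))) : \bar R :=
  \esum_(L in A `&` unrooted_loops D)
    ((2 * d)%:R ^- loop_length L / (multiplicity L)%:R)%:E.

End loops.

Section probability.
Context (R : realType) d (Omega : measurableType d) (P : probability Omega R).

Definition mutually_independent (I : eqType) (F : I -> set (set Omega)) : Prop :=
  forall (s : seq I) (A : I -> set Omega), uniq s ->
    (forall i, i \in s -> F i (A i)) ->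
    P (\big[setI/setT]_(i <- s) A i) = (\prod_(i <- s) P (A i))%E.

Definition sigma_rv d' (T : measurableType d') (X : Omega -> T) :
  set (set Omega) := preimage_set_system setT X measurable.

Definition sigma_kernel d' (T : measurableType d') (N : R.-ker Omega ~> T) :
    set (set Omega) :=
  <<s \bigcup_(A in measurable) sigma_rv (N ^~ A) >>.

(* A point process is a kernel [N] from the probability space: [N w A] is the
   number of points in [A].  The law is given by [poisson_prob], whose second
   argument is unused, and not by [poisson_pmf], which is wrong at rate 0. *)
Definition is_poisson_process d' (T : measurableType d')
    (nu : set T -> \bar R) (N : R.-ker Omega ~> T) : Prop :=
  [/\ forall w A, measurable A ->
        N w A = +oo%E \/ exists k : nat, N w A = k%:R%:E,
      forall A (r : R), measurable A -> nu A = r%:E -> forall k : nat,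
        P [set w | N w A = k%:R%:E] = poisson_prob r 0 [set k],
      forall A, measurable A -> nu A = +oo%E ->
        P [set w | N w A = +oo%E] = 1%E &
      forall (n : nat) (A : 'I_n -> set T), (forall i, measurable (A i)) ->
        trivIset setT A ->
        mutually_independent (fun i => sigma_rv (N ^~ (A i)))].

End probability.

Section loop_soup.
Context (R : realType) (d : nat) (D : {fset lattice d}).
Context d' (Omega : measurableType d') (P : probability Omega R).

Definition point_loop_intensity (alpha : R) (A : set (measurableTypeR R)) :
    \bar R :=
  (\int[lebesgue_measure]_(t in A `&` `]0%R, +oo[)
     (alpha * (expR (- t) / t))%:E)%E.

(* [N] is the discrete loop-soup; [tau L k j] is the waiting time at the [j]-th
   step of the [k]-th copy of the unrooted loop [L] in [N], the steps being
   numbered along [repr L]; [M x] is the process of the time-lengths of the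
   loops that visit only [x].  The waiting times attached to a [k] beyond the
   multiplicity of [L] in [N], or to an [L] that is not a loop in [D], are never
   used. *)
Variables (N : R.-ker Omega ~> cyclic_word (lattice d))
  (tau : cyclic_word (lattice d) -> nat -> nat -> {RV P >-> R})
  (M : D -> R.-ker Omega ~> measurableTypeR R).

Definition soup_sigma
    (i : unit + (cyclic_word (lattice d) * nat * nat) + D) : set (set Omega) :=
  match i with
  | inl (inl _) => sigma_kernel N
  | inl (inr (L, k, j)) => sigma_rv (tau L k j)
  | inr x => sigma_kernel (M x)
  end.

Definition is_loop_soup (alpha : R) : Prop :=
  [/\ is_poisson_process P (fun A => alpha%:E * loop_measure R D A)%E N,
      forall L k j (B : set (measurableTypeR R)), measurable B ->
        distribution P (tau L k j) B = exponential_prob 1 B,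
      forall x, is_poisson_process P (point_loop_intensity alpha) (M x) &
      mutually_independent P soup_sigma].

Definition occupation_time (x : D) (w : Omega) : \bar R :=
  ((\esum_(L in unrooted_loops D)
     \esum_(k in [set k : nat | k%:R%:E < N w [set L]])
       (\sum_(j < loop_length L | nth 0%R (repr L) j == val x) tau L k j w)%:E)
   + \int[M x w]_(t in `]0%R, +oo[) t%:E)%E.

End loop_soup.

(* Main.v *)
(** The two fields are nonnegative, so their laws are determined by the numbers
   E prod_x exp (- k_x X_x) for integers k_x >= 0. Let S be the transition matrix
   of the simple random walk killed outside D and K the diagonal matrix of the
   k_x. For X = Gamma^2 / 2 the number is a quotient of Gaussian integrals, equal
   to sqrt (det (1 - S) / det (1 - S + K)).

   For the loop soup, a loop L with mass mu(L) contributes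
   exp (- 1/2 mu(L) (1 - prod_j (1 + k_(l_j))^-1)), since each step costs the
   Laplace transform of an exponential variable. Summing mu(L) prod_j c(l_j) over
   the loops of length m gives tr ((S c)^m) / m, and sum_m tr (Q^m) / m is
   - log det (1 - Q), so that with Q = S (1 + K)^-1 the loops contribute
   sqrt (det (1 - S) / det (1 - Q)). By Frullani's integral the one-point loops
   contribute prod_x (1 + k_x)^(-1/2), and (1 - Q) (1 + K) = 1 - S + K. *)

Require Import Defs.
From HB Require Import structures.
From mathcomp Require Import all_boot all_order all_algebra.
From mathcomp Require Import finmap generic_quotient.
From mathcomp Require Import all_classical all_reals all_analysis measurable_realfun.
From mathcomp Require Import ring lra zify.

Set Implicit Arguments.
Unset Strict Implicit.
Unset Printing Implicit Defensive.

Import Order.TTheory GRing.Theory Num.Theory.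
Import numFieldNormedType.Exports.

Local Open Scope classical_set_scope.
Local Open Scope ring_scope.
Local Open Scope quotient_scope.

(** * Weighted laws and independence *)

(** Three obstacles shape the argument. The occupation time takes values in [\bar R], and
    exponential variables are nonnegative only almost surely; laws are therefore compared on
    [0, +oo] through [exp_opp], which is 0 at +oo, and the integer moments of the resulting
    [0, 1]-valued variables determine the law by an explicit polynomial approximation of indicators.
    The identity between - log det (1 - Q) and the series of traces is obtained without eigenvalues:
    Jacobi's formula gives an explicit error for the truncated series, which decays geometrically as
    soon as some positive g satisfies Q g <= rho g with rho < 1. Such a g exists for S because D is
    bounded; it still works for Q, whose entries are no larger, and it also yields the positive
    definiteness of 1 - S. Finally, the number of waiting times spent on copies of a loop is random,
    whereas independence is about fixed finite families. The soup is thus cut down to finitely many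
    loops and to prescribed numbers of copies, and both cuts are removed by dominated convergence,
    all factors lying almost surely in [0, 1]. *)

Lemma integral_mulindic d (T : measurableType d) (R : realType)
    (mu : {measure set T -> \bar R}) (D : set T) (f : T -> \bar R) :
  (\int[mu]_(x in D) f x = \int[mu]_x ((\1_D x)%:E * f x))%E.
Proof.
by rewrite integral_mkcond epatch_indic; apply: eq_integral => x _; rewrite muleC.
Qed.

Section change_of_variables.
Local Open Scope ereal_scope.
Context d d' (Om : measurableType d) (T : measurableType d') (R : realType).
Variables (mu : {measure set Om -> \bar R}) (X : Om -> T) (G : Om -> R).
Hypotheses (mX : measurable_fun setT X) (mG : measurable_fun setT G).
Hypothesis G0 : forall x, (0 <= G x)%R.
Import HBNNSimple.

Let mXB B : measurable B -> measurable (X @^-1` B).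
Proof. by move=> mB; rewrite -[_ @^-1` _]setTI; exact: mX. Qed.

Let f_ (f : T -> \bar R) (mf : measurable_fun setT f) := nnsfun_approx measurableT mf.

(** The right-hand side sees [X] and [G] only through the weighted law B |-> \int_(X^-1 B) G, which
    is how integrals on two different spaces can be compared. *)
Lemma integral_comp_weight (f : T -> \bar R) (mf : measurable_fun setT f) :
  (forall y, 0 <= f y) ->
  \int[mu]_x (f (X x) * (G x)%:E) =
  limn (fun n => \sum_(k \in range (f_ mf n))
     k%:E * \int[mu]_(x in X @^-1` (f_ mf n @^-1` [set k])) (G x)%:E).
Proof.
move=> f0.
have mEG : measurable_fun setT (EFin \o G) by exact/measurable_EFinP.
transitivity (limn (fun n => \int[mu]_x ((f_ mf n (X x))%:E * (G x)%:E))).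
  rewrite -monotone_convergence//.
  - apply: eq_integral => x _; apply/esym/cvg_lim => //.
    by apply: cvgeZr => //; exact: cvg_nnsfun_approx.
  - move=> n; apply: emeasurable_funM => //; apply/measurable_EFinP.
    exact: measurableT_comp.
  - by move=> n x _; rewrite -EFinM lee_fin mulr_ge0.
  - move=> x _ m n mn; rewrite -!EFinM lee_fin ler_wpM2r//.
    exact/lefP/nd_nnsfun_approx.
apply/congr_lim/funext => n.
transitivity (\int[mu]_x \sum_(k \in range (f_ mf n))
   (k%:E * ((\1_(X @^-1` (f_ mf n @^-1` [set k])) x)%:E * (G x)%:E))).
  apply: eq_integral => x _; rewrite fimfunE -fsumEFin//.
  rewrite ge0_mule_fsuml; last by move=> k; rewrite nnfun_muleindic_ge0.
  by apply: eq_fsbigr => k _; rewrite EFinM muleA.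
have mk k : measurable_fun setT (fun x => (\1_(X @^-1` (f_ mf n @^-1` [set k])) x)%:E * (G x)%:E).
  apply: emeasurable_funM => //; apply/measurable_EFinP.
  apply: measurable_indic; exact: mXB.
rewrite ge0_integral_fsum//.
- apply: eq_fsbigr => k /set_mem[y _ <-].
  rewrite ge0_integralZl//=.
  + by rewrite [in RHS]integral_mulindic.
  + by move=> x _; rewrite mule_ge0 ?lee_fin.
  + by rewrite lee_fin.
- by move=> k; exact: measurable_funeM.
- move=> k x _; rewrite muleA; apply: mule_ge0; last by rewrite lee_fin.
  (* Nonnegativity is asked for every real [k]; a [k] that is not a value of the simple function may
     be negative, but its level set is empty. *)
  have [[y fy]|nk] := pselect (exists y, f_ mf n y = k).
    by rewrite mule_ge0// lee_fin -?fy.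
  rewrite indicE memNset ?mule0// => /= fx; apply: nk; by exists (X x).
Qed.

End change_of_variables.

Section eq_law.
Import HBNNSimple.

(** Equal weighted laws give equal integrals. With one weight equal to 1 it passes from a law to its
    density (free field, exponential times); with both integrals under [P] it drives the induction
    on independence. *)
Lemma eq_weighted_law_integral d1 d2 d' (T1 : measurableType d1)
    (T2 : measurableType d2) (T : measurableType d') (R : realType)
    (mu1 : {measure set T1 -> \bar R}) (mu2 : {measure set T2 -> \bar R})
    (X1 : T1 -> T) (X2 : T2 -> T) (G1 : T1 -> R) (G2 : T2 -> R) :
  measurable_fun setT X1 -> measurable_fun setT X2 ->
  measurable_fun setT G1 -> measurable_fun setT G2 ->
  (forall x, 0 <= G1 x) -> (forall x, 0 <= G2 x) ->
  (forall B, measurable B -> (\int[mu1]_(x in X1 @^-1` B) (G1 x)%:E =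
                              \int[mu2]_(x in X2 @^-1` B) (G2 x)%:E)%E) ->
  forall f : T -> \bar R, measurable_fun setT f -> (forall y, 0 <= f y)%E ->
  (\int[mu1]_x (f (X1 x) * (G1 x)%:E) = \int[mu2]_x (f (X2 x) * (G2 x)%:E))%E.
Proof.
move=> mX1 mX2 mG1 mG2 G10 G20 eq12 f mf f0.
rewrite !(integral_comp_weight _ _ _ _ mf)//.
congr (limn (_ : nat -> \bar R)); apply/funext => n; apply: eq_fsbigr => k _.
rewrite eq12//; exact: measurable_funPTI.
Qed.

End eq_law.

Section independence.
Context (R : realType) d (Omega : measurableType d) (P : probability Omega R).

Lemma integral01_fin_num (f : Omega -> R) : measurable_fun setT f ->
  (forall x, 0 <= f x <= 1) -> (\int[P]_x (f x)%:E \is a fin_num)%E.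
Proof.
move=> mf f01; rewrite ge0_fin_numE; last first.
  by apply: integral_ge0 => x _; rewrite lee_fin; case/andP: (f01 x).
apply: (@le_lt_trans _ _ (\int[P]_x (cst 1) x)%E).
  apply: ge0_le_integral => //.
  - by move=> x _; rewrite lee_fin; case/andP: (f01 x).
  - exact/measurable_EFinP.
  - by move=> x _ /=; rewrite lee_fin; case/andP: (f01 x).
by rewrite integral_cst// mul1e [X in (X < _)%E](probability_setT P) ltry.
Qed.

(** Independence is given for events only. The induction removes one function at a time: under the
    weight made of all other factors, the law of [f i] is a constant times its law under [P]. This
    is tested on the events f_i^-1(B), that is, on the induction hypothesis with [i] moved from the
    list [s] of functions to the list [t] of events. *)
Lemma independent_integral_prod_indic (I : eqType) (F : I -> set (set Omega))
    (f : I -> Omega -> R) (A : I -> set Omega) (s t : seq I) :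
  mutually_independent P F -> (forall i B, F i B -> measurable B) ->
  uniq (s ++ t) ->
  (forall i B, i \in s -> measurable B -> F i (f i @^-1` B)) ->
  (forall i x, 0 <= f i x <= 1) ->
  (forall i, i \in t -> F i (A i)) ->
  (\int[P]_x ((\prod_(i <- s) f i x) * \1_(\big[setI/setT]_(i <- t) A i) x)%:E =
  (\prod_(i <- s) \int[P]_x (f i x)%:E) * \prod_(i <- t) P (A i))%E.
Proof.
move=> hF mF; elim: s t A => [|i s IH] t A.
  move=> /= ut _ _ FA; rewrite big_nil mul1e -hF//.
  under eq_integral do rewrite big_nil mul1r.
  rewrite integral_indic ?setIT//.
  rewrite big_seq_cond; elim/big_ind: _ => //= [? ? ? ?|j /andP[jt _]].
    exact: measurableI.
  exact: mF (FA j jt).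
move=> /= /andP[ist ust] Ff f01 FA.
have mA B : (forall j, j \in t -> F j (B j)) ->
    measurable (\big[setI/setT]_(j <- t) B j).
  move=> FB; rewrite big_seq_cond; elim/big_ind: _ => //= [? ? ? ?|j /andP[jt _]].
    exact: measurableI.
  exact: mF (FB j jt).
have mf j : j \in i :: s -> measurable_fun setT (f j).
  by move=> js _ B mB; rewrite setTI; apply: mF (Ff _ _ js mB).
pose G1 x := \prod_(j <- s) f j x * \1_(\big[setI/setT]_(j <- t) A j) x.
have mG1 : measurable_fun setT G1.
  apply: measurable_funM; last exact/measurable_indic/mA.
  apply: measurable_prod => j js; apply: mf; by rewrite inE js orbT.
have G101 x : 0 <= G1 x <= 1.
  have p01 : 0 <= \prod_(j <- s) f j x <= 1.
    by rewrite prodr_ile1// prodr_ge0//= => j _; case/andP: (f01 j x).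
  by rewrite /G1 indicE; case: (x \in _); rewrite ?mulr1 ?mulr0 ?lexx ?ler01.
have mfi : measurable_fun setT (f i) by apply: mf; rewrite inE eqxx.
have IHt := IH t A ust _ f01 FA.
set c := (_ * _)%E in IHt.
have cE : c = (fine c)%:E.
  rewrite fineK// -IHt; last by move=> j B js mB; apply: Ff => //; rewrite inE js orbT.
  exact: integral01_fin_num.
have c0 : 0 <= fine c.
  rewrite -lee_fin -cE -IHt; last by move=> j B js mB; apply: Ff => //; rewrite inE js orbT.
  by apply: integral_ge0 => x _; rewrite lee_fin; case/andP: (G101 x).
rewrite !big_cons.
(* The transported integrand must be nonnegative on all of R; the absolute value ensures it and
   changes nothing on [0, 1]. *)
transitivity (\int[P]_x (`|f i x|%:E * (G1 x)%:E))%E.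
  apply: eq_integral => x _; rewrite -EFinM /G1 big_cons mulrA ger0_norm//.
  by case/andP: (f01 i x).
rewrite (@eq_weighted_law_integral _ _ _ _ _ R _ P P (f i) (f i) G1
   (cst (fine c)) mfi mfi mG1 _ _ _ _ (fun y => `|y|%:E))//.
- under eq_integral do rewrite /= muleC.
  rewrite ge0_integralZl//=; last first.
    by apply/measurable_EFinP; exact: measurableT_comp.
  rewrite muleC -cE -/c -muleA; congr (_ * _)%E.
  by apply: eq_integral => x _; rewrite ger0_norm//; case/andP: (f01 i x).
- by move=> x; case/andP: (G101 x).
- move=> B mB.
  have mfB : F i (f i @^-1` B) by apply: Ff => //; rewrite inE eqxx.
  pose A' j := if j == i then f i @^-1` B else A j.
  have A't j : j \in t -> A' j = A j.
    move=> jt; rewrite /A'; case: eqP => // ji.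
    by move: ist; rewrite mem_cat -ji jt orbT.
  have uit : uniq (s ++ i :: t) by rewrite -cat1s uniq_catCA cat1s/= ist.
  rewrite [RHS](integral_cst P (mF _ _ mfB) (fine c)%:E).
  transitivity ((\prod_(j <- s) \int[P]_x (f j x)%:E) * \prod_(j <- i :: t) P (A' j))%E.
    rewrite -IH//; last 2 first.
    + by move=> j C js mC; apply: Ff => //; rewrite inE js orbT.
    + move=> j; rewrite inE => /predU1P[->|jt]; first by rewrite /A' eqxx.
      by rewrite A't//; exact: FA.
    rewrite integral_mulindic; apply: eq_integral => x _; rewrite -EFinM; congr _%:E.
    rewrite /G1 big_cons mulrCA; congr *%R.
    rewrite [A' i]/A' eqxx (_ : \big[setI/setT]_(j <- t) A' j = \big[setI/setT]_(j <- t) A j).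
      by rewrite indicI.
    by rewrite !big_seq; apply: eq_bigr => j /A't ->.
  rewrite big_cons [A' i]/A' eqxx -cE /c.
  rewrite (_ : \prod_(j <- t) P (A' j) = \prod_(j <- t) P (A j))%E.
    by rewrite muleCA muleC.
  by rewrite !big_seq; apply: eq_bigr => j /A't ->.
- by apply/measurable_EFinP; exact: normr_measurable.
Qed.

Lemma independent_integral_prod (I : eqType) (F : I -> set (set Omega))
    (f : I -> Omega -> R) (s : seq I) :
  mutually_independent P F -> (forall i B, F i B -> measurable B) ->
  uniq s ->
  (forall i B, i \in s -> measurable B -> F i (f i @^-1` B)) ->
  (forall i x, 0 <= f i x <= 1) ->
  (\int[P]_x (\prod_(i <- s) f i x)%:E = \prod_(i <- s) \int[P]_x (f i x)%:E)%E.
Proof.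
move=> hF mF us Ff f01.
have := @independent_integral_prod_indic I F f (fun=> setT) s [::] hF mF.
rewrite cats0 !big_nil mule1 => /(_ us Ff f01) <-//.
by apply: eq_integral => x _; rewrite indicT/= mulr1.
Qed.

End independence.

(** * Laws determined by their Laplace transform at integers *)

Section moments.
Context (R : realType).

(** With e = 1 - r, r^n <= exp (- n e) <= 2 / (n e)^2. The constant 4 pays for comparing 1/n with
    the harmonic sequence 1/(n+1). *)
Lemma cvg_natr_mul_expr (r : R) : 0 <= r < 1 -> n%:R * r ^+ n @[n --> \oo] --> (0 : R).
Proof.
move=> /andP[r0 r1].
pose e := 1 - r.
have e0 : 0 < e by rewrite subr_gt0.
apply/(squeeze_cvgr (f := fun=> 0) (h := fun n => (4 / e ^+ 2) * n.+1%:R^-1)).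
- near=> n.
  have n0 : (0 < n)%N by near: n; exact: nbhs_infty_gt.
  have n0' : 0 < n%:R :> R by rewrite ltr0n.
  rewrite mulr_ge0 ?exprn_ge0//=.
  have re : r <= expR (- e) by rewrite (le_trans _ (expR_ge1Dx _))// /e; lra.
  have rne : r ^+ n <= expR (- (n%:R * e)).
    by rewrite -mulrN expRM_natl lerXn2r// ?nnegrE// expR_ge0.
  have ne0 : 0 < n%:R * e by rewrite mulr_gt0.
  have h : (n%:R * e) ^+ 2 / 2 <= expR (n%:R * e).
    by rewrite (le_trans _ (expR_ge1Dxn 1 (ltW ne0)))// ler_wpDl.
  have h2 : expR (- (n%:R * e)) <= 2 / (n%:R * e) ^+ 2.
    rewrite expRN -[X in _ <= X]invrK invf_div lef_pV2// ?posrE ?expR_gt0//.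
    by rewrite divr_gt0// exprn_gt0.
  apply: (@le_trans _ _ (n%:R * (2 / (n%:R * e) ^+ 2))).
    by rewrite ler_wpM2l// (le_trans rne).
  rewrite [X in X <= _](_ : _ = 2 / e ^+ 2 / n%:R); last by field; rewrite !gt_eqF.
  rewrite ler_pdivrMr// (_ : 4 / e ^+ 2 / n.+1%:R * n%:R = 2 / e ^+ 2 * (2 * n%:R / n.+1%:R)); last first.
    by field; rewrite gt_eqF//= gt_eqF// ltr0n.
  rewrite ler_peMr ?divr_ge0 ?exprn_ge0 ?(ltW e0)//.
  rewrite ler_pdivlMr ?ltr0n// mul1r -natrM ler_nat; lia.
- exact: cvg_cst.
- rewrite -[X in _ --> X](mulr0 (4 / e ^+ 2)); apply: cvgM; first exact: cvg_cst.
  exact: cvg_harmonic.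
Unshelve. all: by end_near. Qed.

Lemma bernoulli_ineq (x : R) n : 0 <= x <= 1 -> 1 - n%:R * x <= (1 - x) ^+ n.
Proof.
move=> /andP[x0 x1]; elim: n => [|n IH]; first by rewrite mul0r subr0 expr0.
rewrite exprS (@le_trans _ _ ((1 - x) * (1 - n%:R * x)))//; last first.
  by rewrite ler_wpM2l// subr_ge0.
have : 0 <= n%:R * (x * x) by rewrite mulr_ge0// mulr_ge0.
rewrite -natr1; nra.
Qed.

(* With this exponent q, u^n q tends to 0 if u < a and to +oo if u >= a, so that
   (1 - u^n)^q is a polynomial approximation of the indicator of [0, a[. *)
Definition step_exponent (a : R) n := (Num.trunc (n%:R / a ^+ n)).+1.

Lemma step_poly_cvg (a u : R) : 0 < a <= 1 -> 0 <= u <= 1 ->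
  (1 - u ^+ n) ^+ step_exponent a n @[n --> \oo] --> ((u < a)%R%:R : R).
Proof.
move=> /andP[a0 a1] /andP[u0 u1].
have un01 n : 0 <= u ^+ n <= 1 by rewrite exprn_ge0//= exprn_ile1.
have an0 n : 0 < a ^+ n by rewrite exprn_gt0.
have [ua|au] := ltP u a.
  have r01 : 0 <= u / a < 1 by rewrite divr_ge0 ?(ltW a0)//= ltr_pdivrMr// mul1r.
  (* Bernoulli's inequality bounds the power below by 1 - q u^n, and the exponent q is at most n /
     a^n + 1. *)
  apply/(squeeze_cvgr (f := fun n => 1 - (n%:R * (u / a) ^+ n + u ^+ n)) (h := fun=> 1)).
  - near=> n.
    rewrite (le_trans _ (bernoulli_ineq _ (un01 n)))/=; last first.
      rewrite lerB// /step_exponent -natr1 mulrDl mul1r lerD2r expr_div_n mulrA mulrAC.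
      by rewrite ler_wpM2r ?exprn_ge0// truncn_le// divr_ge0// ltW.
    rewrite exprn_ile1// ?subr_ge0; first by case/andP: (un01 n).
    by rewrite lerBlDr lerDl; case/andP: (un01 n).
  - rewrite -[X in _ --> X]subr0; apply: cvgB; first exact: cvg_cst.
    rewrite -[X in _ --> X]addr0; apply: cvgD; first exact: cvg_natr_mul_expr.
    by apply: cvg_expr; rewrite ger0_norm// (lt_le_trans ua).
  - exact: cvg_cst.
(* Here (1 - u^n)^q <= exp (- q u^n), and q u^n >= (n / a^n) a^n = n. The point u = a is included,
   so the convergence has no exceptional point. *)
apply/(squeeze_cvgr (f := fun=> 0) (h := fun n => expR (- n%:R))).
- near=> n.
  have /andP[v0 v1] := un01 n.
  rewrite exprn_ge0 ?subr_ge0//=.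
  apply: (@le_trans _ _ (expR (- u ^+ n) ^+ step_exponent a n)).
    by rewrite lerXn2r ?nnegrE ?subr_ge0 ?expR_ge0//; exact: expR_ge1Dx.
  rewrite -expRM_natl ler_expR mulrN lerN2.
  apply: (@le_trans _ _ ((n%:R / a ^+ n) * a ^+ n)).
    by rewrite divfK// gt_eqF.
  rewrite ler_pM// ?divr_ge0 ?(ltW (an0 n))//; last by rewrite lerXn2r// nnegrE ltW.
  exact/ltW/truncnS_gt.
- exact: cvg_cst.
- exact: cvgn_expR.
Unshelve. all: by end_near. Qed.

End moments.

Section moment_problem.
Context (R : realType) (I : finType) d (Om : measurableType d).
Context (P : probability Om R) (U : I -> Om -> R).
Hypothesis mU : forall i, measurable_fun setT (U i).
Hypothesis U01 : forall i w, 0 <= U i w <= 1.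

Lemma integrable01 (f : Om -> R) : measurable_fun setT f ->
  (forall x, 0 <= f x <= 1) -> P.-integrable setT (EFin \o f).
Proof.
move=> mf f01; apply: (@le_integrable _ _ _ P _ _ _ (cst 1%E)) => //.
- exact/measurable_EFinP.
- move=> x _ /=; rewrite normr1 lee_fin ger0_norm; by case/andP: (f01 x).
- by apply: finite_measure_integrable_cst.
Qed.

(** Distributing the product chooses one monomial per index, the function [f]; only mixed moments
    with natural exponents remain. *)
Lemma integral_prod_poly (p : I -> {poly R}) N : (forall i, size (p i) <= N.+1)%N ->
  (\int[P]_w (\prod_i (p i).[U i w])%:E =
   \sum_(f : {ffun I -> 'I_N.+1})
     (\prod_i (p i)`_(f i))%:E * \int[P]_w (\prod_i U i w ^+ f i)%:E)%E.
Proof.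
move=> pN.
have mon (f : {ffun I -> 'I_N.+1}) :
    P.-integrable setT (EFin \o (fun w => \prod_i U i w ^+ f i)).
  apply: integrable01.
    by apply: measurable_prod => i _; exact: measurable_funX.
  move=> w; have Ui01 i : 0 <= U i w ^+ f i <= 1.
    by have /andP[u0 u1] := U01 i w; rewrite exprn_ge0//= exprn_ile1.
  rewrite prodr_ile1// prodr_ge0//= => i _; by case/andP: (Ui01 i).
transitivity (\int[P]_w \sum_(f : {ffun I -> 'I_N.+1})
     ((\prod_i (p i)`_(f i))%:E * (\prod_i U i w ^+ f i)%:E))%E.
  apply: eq_integral => w _.
  under eq_bigr do rewrite (horner_coef_wide _ (pN _)).
  rewrite bigA_distr_bigA -sumEFin; apply: eq_bigr => f _.
  by rewrite -EFinM -big_split.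
rewrite integral_sum//=.
  by apply: eq_bigr => f _; rewrite integralZl//; exact: mon.
move=> f; apply: integrableZl => //; exact: mon.
Qed.

(** The coordinates outside [J] carry the polynomial 1. The set [J] cannot be absorbed in [a]: as
    [a i <= 1], the strict inequality always excludes the value 1. *)
Lemma cvg_box (J : pred I) (a : I -> R) : (forall i, 0 < a i <= 1) ->
  (\int[P]_w (\prod_i
     ((if J i then (1 - 'X^n) ^+ step_exponent (a i) n else 1) : {poly R}).[U i w])%:E)%E
     @[n --> \oo] -->
  P [set w | forall i, J i -> U i w < a i].
Proof.
move=> a01.
pose B := [set w | forall i, J i -> U i w < a i].
have BE w : \1_B w = \prod_i (if J i then (U i w < a i)%R%:R else 1) :> R.
  rewrite indicE; have [/set_mem Bw|/negP nBw] := boolP (w \in B).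
    by rewrite big1// => i _; case: ifPn => // /(Bw _) ->.
  have [/forallP Bw|] := boolP [forall i, J i ==> (U i w < a i)].
    by exfalso; apply: nBw; rewrite inE => i Ji; have /implyP := Bw i; exact.
  rewrite negb_forall => /existsP[i]; rewrite negb_imply => /andP[Ji /negbTE Ui].
  by rewrite (bigD1 i)//= Ji Ui mul0r.
have mB : measurable B.
  rewrite [B](_ : _ = \bigcap_(i in [set` J]) [set w | U i w < a i]).
    apply: fin_bigcap_measurable => // i _.
    rewrite [X in measurable X](_ : _ = setT `&` U i @^-1` `]-oo, a i[%classic).
      exact: mU.
    by apply/seteqP; split => x /=; rewrite in_itv/=; [|case].
  by apply/seteqP; split.
have hE n w i : ((if J i then (1 - 'X^n) ^+ step_exponent (a i) n else 1) : {poly R}).[U i w]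
   = if J i then (1 - U i w ^+ n) ^+ step_exponent (a i) n else 1.
  by case: ifP; rewrite !hornerE.
under eq_fun do under eq_integral do under eq_bigr do rewrite hE.
have e01 n w i : 0 <= (if J i then (1 - U i w ^+ n) ^+ step_exponent (a i) n else 1) <= 1.
  case: ifP; rewrite ?ler01 ?lexx//.
  have /andP[u0 u1] := U01 i w => _.
  have v0 : 0 <= U i w ^+ n by rewrite exprn_ge0.
  have v1 : U i w ^+ n <= 1 by rewrite exprn_ile1.
  by rewrite exprn_ge0 ?subr_ge0//= exprn_ile1 ?subr_ge0// lerBlDr lerDl.
rewrite -[P _](_ : \int[P]_w (\1_B w)%:E = _)%E; last first.
  by rewrite integral_indic// setIT.
have [|||||_ _] := @dominated_convergence _ _ _ P _ measurableT
  (fun n w => (\prod_i (if J i then (1 - U i w ^+ n) ^+ step_exponent (a i) n else 1))%:E)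
  (fun w => (\1_B w)%:E) (cst 1%E); last exact.
- move=> n; apply/measurable_EFinP; apply: measurable_prod => i _.
  case: (J i) => //; apply: measurable_funX; apply: measurable_funB => //.
  exact: measurable_funX.
- exact/measurable_EFinP/measurable_indic.
- apply: aeW => w _; rewrite BE; apply: cvg_EFin; first exact: nearW.
  apply: cvg_big => [|i _]; first exact: mul_continuous.
  case: (J i); last exact: cvg_cst.
  exact: step_poly_cvg.
- exact: finite_measure_integrable_cst.
- apply: aeW => w n _ /=; rewrite lee_fin ger0_norm.
    by rewrite prodr_ile1.
  by rewrite prodr_ge0// => i _; case/andP: (e01 n w i).
Qed.

End moment_problem.

Lemma eq_moments_box (R : realType) (I : finType)
    d1 (O1 : measurableType d1) (P1 : probability O1 R) (U : I -> O1 -> R)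
    d2 (O2 : measurableType d2) (P2 : probability O2 R) (V : I -> O2 -> R) :
  (forall i, measurable_fun setT (U i)) -> (forall i, measurable_fun setT (V i)) ->
  (forall i w, 0 <= U i w <= 1) -> (forall i w, 0 <= V i w <= 1) ->
  (forall k : I -> nat, (\int[P1]_w (\prod_i U i w ^+ k i)%:E =
                         \int[P2]_w (\prod_i V i w ^+ k i)%:E)%E) ->
  forall (J : pred I) (a : I -> R), (forall i, 0 < a i <= 1) ->
  P1 [set w | forall i, J i -> U i w < a i] = P2 [set w | forall i, J i -> V i w < a i].
Proof.
move=> mU mV U01 V01 UV J a a01.
have /cvg_lim <- // := @cvg_box _ _ _ _ P1 _ mU U01 J _ a01.
have /cvg_lim <- // := @cvg_box _ _ _ _ P2 _ mV V01 J _ a01.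
congr (limn (_ : nat -> \bar R)).
apply/funext => n.
set p := fun i : I => (if J i then (1 - 'X^n) ^+ step_exponent (a i) n else 1) : {poly R}.
have pN i : (size (p i) <= (\max_i size (p i)).+1)%N by rewrite ltnW// ltnS leq_bigmax.
rewrite (integral_prod_poly P1 mU U01 pN) (integral_prod_poly P2 mV V01 pN).
by apply: eq_bigr => f _; rewrite UV.
Qed.

Section fields_measurability.
Context (I : Type) d (T : measurableType d) dO (Om : measurableType dO).

Lemma measurable_fun_fields (X : I -> Om -> T) :
  (forall i, measurable_fun setT (X i)) ->
  measurable_fun setT ((fun w i => X i w) : Om -> fields I T).
Proof.
move=> mX; apply: (@measurability _ _ Om (fields I T) setT _ (@cylinders I d T)) => //.
move=> _ [_ [i _ [A mA <-]] <-].
rewrite setTI [X in measurable X](_ : _ = setT `&` X i @^-1` A); first exact: mX.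
by rewrite !setTI.
Qed.

Lemma measurable_fun_coord (i : I) :
  measurable_fun setT ((fun x => x i) : fields I T -> T).
Proof.
move=> _ A mA; apply: sub_sigma_algebra; exists i => //.
by exists A.
Qed.

End fields_measurability.

(** * The exponential coordinate on [0, +oo] *)

Section exp_opp.
Context (R : realType).

(** Nothing excludes beforehand an infinite occupation time. With the value 0 at +oo this map stays
    multiplicative and continuous on [0, +oo], and it identifies [0, +oo] with [0, 1]. *)
Definition exp_opp (y : \bar R) : R := if y is r%:E then expR (- r) else 0.

Lemma exp_opp_ge0 y : 0 <= exp_opp y.
Proof. by case: y => //= r; exact: expR_ge0. Qed.

Lemma exp_opp_le1 y : (0 <= y)%E -> exp_opp y <= 1.
Proof. by case: y => //= r; rewrite lee_fin expR_le1 oppr_le0. Qed.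

Lemma exp_opp01 y : (0 <= y)%E -> 0 <= exp_opp y <= 1.
Proof. by move=> y0; rewrite exp_opp_ge0 exp_opp_le1. Qed.

Lemma exp_oppD (x y : \bar R) : (0 <= x)%E -> (0 <= y)%E ->
  exp_opp (x + y) = exp_opp x * exp_opp y.
Proof.
by case: x => [x| |] //; case: y => [y| |] //= _ _; rewrite ?mulr0 ?mul0r// opprD expRD.
Qed.

Lemma lt_exp_opp (s : R) y : (0 <= y)%E -> (exp_opp y < expR (- s)) = (s%:E < y)%E.
Proof.
by case: y => [r| |] //= _; rewrite ?expR_gt0 ?ltry// ltr_expR ltrN2 lte_fin.
Qed.

Lemma measurable_exp_opp : measurable_fun setT exp_opp.
Proof.
have -> : exp_opp = fun y : \bar R => if `|y|%E == +oo%E then 0 else expR (- fine y).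
  by apply/funext => -[r| |].
apply: measurable_fun_ifT => //.
- apply: (@measurable_fun_eqe _ _ _ _ abse (cst +oo%E)) => //.
- apply: measurableT_comp => //; apply: measurableT_comp => //.
Qed.

Lemma cvg_exp_opp (u : nat -> \bar R) (l : \bar R) : (0 <= l)%E -> u @ \oo --> l ->
  exp_opp (u n) @[n --> \oo] --> exp_opp l.
Proof.
case: l => [l| |] // l0 ul.
- have fu : \forall n \near \oo, u n \is a fin_num.
    by move/fine_cvgP : ul => [].
  have cu : fine (u n) @[n --> \oo] --> l by move/fine_cvgP : ul => [].
  apply: (@cvg_trans _ (expR (- fine (u n)) @[n --> \oo])).
    apply: near_eq_cvg; near=> n.
    have : u n \is a fin_num by near: n.
    by case: (u n).
  apply: (@cvg_comp _ _ _ (fun n => - fine (u n)) expR _ (nbhs (- l))); first exact: cvgN.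
  exact: continuous_expR.
- apply/cvgrPdist_lt => e e0 /=; near=> n.
  rewrite sub0r normrN ger0_norm ?exp_opp_ge0//.
  have : ((- ln e)%:E < u n)%E by near: n; move/cvgeyPgt : ul; exact.
  case: (u n) => [r| |]//=; rewrite lte_fin => er.
  by rewrite -[ltRHS]lnK ?posrE// ltr_expR ltrNl.
Unshelve. all: by end_near. Qed.

End exp_opp.

Section law_from_moments.
Context (R : realType) (I : finType).
Context d1 (O1 : measurableType d1) (P1 : probability O1 R).
Context d2 (O2 : measurableType d2) (P2 : probability O2 R).
Variables (X : I -> O1 -> \bar R) (Y : I -> O2 -> \bar R).
Hypothesis mX : forall i, measurable_fun setT (X i).
Hypothesis mY : forall i, measurable_fun setT (Y i).
Hypothesis X0 : forall i w, (0 <= X i w)%E.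
Hypothesis Y0 : forall i w, (0 <= Y i w)%E.
Hypothesis eq_moments : forall k : I -> nat,
  (\int[P1]_w (\prod_i exp_opp (X i w) ^+ k i)%:E =
   \int[P2]_w (\prod_i exp_opp (Y i w) ^+ k i)%:E)%E.

Let FX : O1 -> fields I (\bar R) := fun w i => X i w.
Let FY : O2 -> fields I (\bar R) := fun w i => Y i w.
Let mFX : measurable_fun setT FX. Proof. exact: measurable_fun_fields. Qed.
Let mFY : measurable_fun setT FY. Proof. exact: measurable_fun_fields. Qed.
HB.instance Definition _ := isMeasurableFun.Build _ _ _ _ FX mFX.
HB.instance Definition _ := isMeasurableFun.Build _ _ _ _ FY mFY.

Let box (J : pred I) (s : I -> R) : set (fields I (\bar R)) :=
  [set x | forall i, J i -> ((s i)%:E < x i)%E].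

Let boxes : set (set (fields I (\bar R))) := [set B | exists (J : pred I) (s : I -> R), B = box J s].

Let measurable_box J s : measurable (box J s).
Proof.
rewrite [box _ _](_ : _ = \bigcap_(i in [set` J])
   (setT `&` (fun x : fields I (\bar R) => x i) @^-1` `](s i)%:E, +oo[%classic)).
  apply: fin_bigcap_measurable => // i _.
  by apply: measurable_fun_coord => //; exact: emeasurable_itv.
apply/seteqP; split => x xB i Ji.
  by split => //=; rewrite in_itv/= andbT; exact: xB.
by have [_] := xB i Ji; rewrite /= in_itv/= andbT.
Qed.

Let boxesI : setI_closed boxes.
Proof.
move=> _ _ [J [s ->]] [K [t ->]].
exists [pred i | J i || K i].
exists (fun i => if J i then if K i then Num.max (s i) (t i) else s i else t i).
apply/seteqP; split => x /=.
- move=> [xJ xK] i /=; case Ji: (J i) => /=.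
    by case Ki: (K i); rewrite ?EFin_max ?gt_max ?xJ ?xK.
  by move=> Ki; exact: xK.
- move=> xB; split => i; have /= := xB i.
    move=> + Ji; rewrite Ji/= => /(_ isT); case: ifP => // _.
    by rewrite EFin_max gt_max => /andP[].
  move=> + Ki; rewrite Ki orbT/= => /(_ isT); case: ifP => // _.
  by rewrite EFin_max gt_max => /andP[].
Qed.

(** Good-sets argument: the [B] whose preimage under the coordinate [i] is generated by boxes form a
    sigma-algebra, and it contains the rays ]r, +oo], which generate the Borel sets of [\bar R]. *)
Let measurable_boxes : @measurable _ (fields I (\bar R)) `<=` <<s boxes>>.
Proof.
apply: smallest_sub; first exact: smallest_sigma_algebra.
move=> _ [i _ [A mA <-]].
rewrite setTI.
have mE : @measurable _ (\bar R) = <<s @ErealGenOInfty.G R >> := ErealGenOInfty.measurableE R.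
pose G := [set B : set (\bar R) | <<s boxes>> ((fun x : fields I (\bar R) => x i) @^-1` B)].
suff: <<s @ErealGenOInfty.G R >> `<=` G by apply; rewrite -mE.
apply: smallest_sub => /=; last first.
  move=> _ [r ->]; apply: sub_sigma_algebra.
  exists (pred1 i), (fun=> r).
  apply/seteqP; split => x /=; rewrite in_itv/= andbT; first by move=> xi j /eqP ->.
  by apply; rewrite /= eqxx.
have [b0 bC bU] := smallest_sigma_algebra setT boxes.
split.
- by rewrite /G/= preimage_set0.
- by move=> B GB; rewrite /G/= setTD preimage_setC -setTD; exact: bC.
- by move=> F GF; rewrite /G/= preimage_bigcup; exact: bU.
Qed.

(** The boxes form a generating pi-system, and [exp_opp] turns each of them into a box of
    [eq_moments_box]. *)
Lemma eq_moments_law (B : set (fields I (\bar R))) : measurable B ->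
  P1 [set w | B (X ^~ w)] = P2 [set w | B (Y ^~ w)].
Proof.
move=> mB.
apply: (@g_sigma_algebra_measure_unique _ R (fields I (\bar R)) boxes _
  (fun=> setT) _ _ (pushforward P1 FX) (pushforward P2 FY) _ _ _ B) => //.
- by move=> _ [J [s ->]]; exact: measurable_box.
- by move=> _; exists pred0, (fun=> 0); apply/seteqP; split.
- by rewrite bigcup_const.
- move=> _ [J [s ->]]; rewrite /pushforward.
  pose a i := expR (- Num.max (s i) 0).
  have a01 i : 0 < a i <= 1 by rewrite /a expR_gt0/= expR_le1 oppr_le0 le_max lexx orbT.
  (* A threshold [s i < 0] holds automatically for a nonnegative field; dropping it keeps the
     transformed threshold [a i] in ]0, 1]. *)
  pose J' := [pred i | J i && (0 <= s i)].
  have EX (O : Type) (Z : I -> O -> \bar R) : (forall i w, (0 <= Z i w)%E) ->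
     [set w | box J s (Z ^~ w)] = [set w | forall i, J' i -> exp_opp (Z i w) < a i].
    move=> Z0; apply/seteqP; split => w /= bw i.
      by move=> /andP[Ji s0]; rewrite lt_exp_opp// max_l//; exact: bw.
    move=> Ji; have [s0|s0] := leP 0 (s i); last first.
      by rewrite (lt_le_trans _ (Z0 i w))// lte_fin.
    by have := bw i; rewrite /J'/= Ji s0/= lt_exp_opp// max_l// => /(_ isT).
  change (P1 [set w | box J s (X ^~ w)] = P2 [set w | box J s (Y ^~ w)]).
  rewrite !EX//; apply: eq_moments_box => //.
  + by move=> i; exact: measurableT_comp (@measurable_exp_opp R) (mX i).
  + by move=> i; exact: measurableT_comp (@measurable_exp_opp R) (mY i).
  + by move=> i w; exact: exp_opp01.
  + by move=> i w; exact: exp_opp01.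
- by move=> _; rewrite (le_lt_trans (probability_le1 P1 measurableT))// ltry.
- exact: measurable_boxes.
Qed.

End law_from_moments.

(** * Gaussian integrals *)

Section gaussian_integral.
Context (R : realType).

Lemma integral_lebesgue_cons n
    (mu : {sigma_finite_measure set (n.-tuple (measurableTypeR R)) -> \bar R})
    (f : n.+1.-tuple (measurableTypeR R) -> \bar R) :
  measurable_fun setT f -> (forall t, 0 <= f t)%E ->
  (\int[lebesgue_cons mu]_t f t =
   \int[mu]_y \int[@lebesgue_measure R]_x f [tuple of x :: y])%E.
Proof.
move=> mf f0.
pose cons (p : measurableTypeR R * n.-tuple (measurableTypeR R)) :
  n.+1.-tuple (measurableTypeR R) := [tuple of p.1 :: p.2].
have mcons : measurable_fun setT cons by exact: measurable_cons.
transitivity (\int[pushforward (@lebesgue_measure R \x mu)%E cons]_t f t)%E.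
  exact: eq_measure_integral.
rewrite ge0_integral_pushforward// preimage_setT fubini_tonelli2//.
  exact: measurableT_comp.
by move=> p /=; exact: f0.
Qed.

Lemma integral_gauss_scaled (a m : R) : 0 < a ->
  (\int[@lebesgue_measure R]_x (expR (- 2^-1 * (a * (x + m) ^+ 2)))%:E =
   (Num.sqrt (2 * pi) / Num.sqrt a)%:E)%E.
Proof.
move=> a0.
(* The exponent is that of the normal law with mean - m and variance 1 / a; [s] is its standard
   deviation. *)
pose s := (Num.sqrt a)^-1.
have s0 : 0 < s by rewrite invr_gt0 sqrtr_gt0.
have sE : s ^+ 2 = a^-1 by rewrite exprVn sqr_sqrtr// ltW.
have peakE : normal_peak s = Num.sqrt a / Num.sqrt (2 * pi).
  rewrite /normal_peak sE -mulr_natr -mulrA [pi * _]mulrC sqrtrM ?invr_ge0 ?ltW//.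
  rewrite sqrtrV ?ltW//. field.
  by rewrite !gt_eqF ?sqrtr_gt0 ?mulr_gt0 ?pi_gt0.
have p0 : 0 < normal_peak s by apply: normal_peak_gt0; rewrite gt_eqF.
have := @integral_normal_pdf R (- m) s.
have -> : normal_pdf (- m) s = fun x => normal_peak s * normal_fun (- m) s x.
  by rewrite normal_pdfE// gt_eqF.
move=> h.
have p1 : (normal_peak s)^-1 = Num.sqrt (2 * pi) / Num.sqrt a by rewrite peakE invf_div.
rewrite -[RHS]mule1 -h -p1 -ge0_integralZl//; last 3 first.
- apply/measurable_EFinP; apply: measurable_funM => //; exact: measurable_normal_fun.
- by move=> x _; rewrite lee_fin mulr_ge0 ?normal_fun_ge0// ltW.
- by rewrite lee_fin invr_ge0 ltW.
apply: eq_integral => x _; rewrite -EFinM [in RHS]mulrA mulVf ?gt_eqF// mul1r.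
rewrite /normal_fun sE; congr (expR _)%:E.
by rewrite opprK -mulr_natr; field; rewrite gt_eqF.
Qed.

Definition qform n (A : 'M[R]_n) (v : 'I_n -> R) := \sum_i \sum_j A i j * v i * v j.

Definition posdef n (A : 'M[R]_n) :=
  A^T = A /\ forall v : 'I_n -> R, (exists i, v i != 0) -> 0 < qform A v.

Definition schur n (A : 'M[R]_n.+1) : 'M[R]_n :=
  \matrix_(i, j) (A (lift ord0 i) (lift ord0 j) -
    A (lift ord0 i) ord0 * A ord0 (lift ord0 j) / A ord0 ord0).

(** Completing the square in coordinate 0: with b the linear form coupling it to the others, the
    leftover - b^2 / a is what the Schur complement subtracts. *)
Lemma qform_schur n (A : 'M[R]_n.+1) v : A^T = A -> A ord0 ord0 != 0 ->
  qform A v = A ord0 ord0 *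
     (v ord0 + (\sum_j A ord0 (lift ord0 j) * v (lift ord0 j)) / A ord0 ord0) ^+ 2 +
   qform (schur A) (v \o lift ord0).
Proof.
move=> AT a0; set a := A _ _ in a0 *; set x := v ord0.
have As i : A (lift ord0 i) ord0 = A ord0 (lift ord0 i) by rewrite -[in RHS]AT mxE.
set b := \sum_j _.
rewrite /qform big_ord_recl big_ord_recl -/a -/x.
rewrite (_ : \sum_i A ord0 (lift ord0 i) * x * v (lift ord0 i) = x * b); last first.
  by rewrite /b mulr_sumr; apply: eq_bigr => i _; ring.
under [X in _ + X = _]eq_bigr do rewrite big_ord_recl -/x As.
rewrite big_split/= (_ : \sum_i A ord0 (lift ord0 i) * v (lift ord0 i) * x = x * b); last first.
  by rewrite /b mulr_sumr; apply: eq_bigr => i _; ring.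
rewrite [in RHS](_ : \sum_i _ = \sum_i \sum_j A (lift ord0 i) (lift ord0 j) *
    v (lift ord0 i) * v (lift ord0 j) - b * b / a); last first.
  rewrite {1 2}/b mulr_suml mulr_suml -sumrB; apply: eq_bigr => i _.
  rewrite mulr_sumr mulr_suml -sumrB; apply: eq_bigr => j _.
  by rewrite mxE As /= -/a; ring.
by field.
Qed.

(** Block LU factorisation: a unit lower triangular factor times an upper one with diagonal blocks
    [A ord0 ord0] and [schur A]. *)
Lemma det_schur n (A : 'M[R]_n.+1) : A ord0 ord0 != 0 ->
  \det A = A ord0 ord0 * \det (schur A).
Proof.
move=> a0; pose A' : 'M[R]_(1 + n) := A.
have AE : A' = block_mx 1%:M 0 ((A ord0 ord0)^-1 *: dlsubmx A') 1%:M *m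
   block_mx (ulsubmx A') (ursubmx A') 0 (schur A).
  rewrite mulmx_block !mul1mx !mul0mx !addr0.
  rewrite -[LHS]submxK; congr block_mx; apply/matrixP => i j; rewrite !mxE ?big_ord1 ?mxE ?ord1.
  - by rewrite lshift0 mulrAC mulVf ?mul1r.
  - by rewrite !lshift0 !rshift1; ring.
rewrite -[A]/A' {1}AE det_mulmx (@det_lblock R 1 n) (@det_ublock R 1 n) !det1 !mul1r det_mx11.
by rewrite !mxE lshift0.
Qed.

Lemma posdef_diag_gt0 n (A : 'M[R]_n.+1) : posdef A -> 0 < A ord0 ord0.
Proof.
move=> [_ pA]; have := pA (fun i => (i == ord0)%:R).
rewrite /qform (bigD1 ord0)//= [X in _ + X]big1 ?addr0; last first.
  by move=> i /negbTE ->; rewrite big1// => j _; rewrite mulr0 mul0r.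
rewrite (bigD1 ord0)//= [X in _ + X]big1 ?addr0; last first.
  by move=> i /negbTE ->; rewrite mulr0.
by rewrite !mulr1; apply; exists ord0; rewrite eqxx oner_neq0.
Qed.

Lemma posdef_schur n (A : 'M[R]_n.+1) : posdef A -> posdef (schur A).
Proof.
move=> hA; have a0 := posdef_diag_gt0 hA; have [AT pA] := hA; split.
  have As i j : A i j = A j i by rewrite -[in LHS]AT mxE.
  apply/matrixP => i j; rewrite !mxE (As (lift ord0 j)) (As (lift ord0 j) ord0).
  by rewrite (As ord0 (lift ord0 i)) [A ord0 _ * _]mulrC.
move=> v [i vi].
pose b := (\sum_j A ord0 (lift ord0 j) * v j) / A ord0 ord0.
(* The coordinate 0 is chosen to annihilate the square in [qform_schur], so that [qform A w] equals
   [qform (schur A) v]. *)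
pose w k := oapp v (- b) (unlift ord0 k).
have wl j : w (lift ord0 j) = v j by rewrite /w liftK.
have : 0 < qform A w by apply: pA; exists (lift ord0 i); rewrite wl.
rewrite qform_schur ?gt_eqF//.
rewrite (eq_bigr (fun j => A ord0 (lift ord0 j) * v j)); last by move=> j _; rewrite wl.
rewrite -/b {1}/w unlift_none/= addNr expr0n mulr0 add0r.
by rewrite (_ : w \o _ = v)//; apply/funext => j /=.
Qed.

Lemma measurable_gauss n (A : 'M[R]_n) : measurable_fun setT
  (fun t : n.-tuple (measurableTypeR R) => expR (- 2^-1 * qform A (tnth t))).
Proof.
apply: measurableT_comp => //; apply: measurable_funM => //.
apply: measurable_sum => i; apply: measurable_sum => j.
by do 2 (apply: measurable_funM => //; try exact: measurable_tnth).
Qed.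

(* Integrating out the first coordinate leaves the Gaussian integral of the
   Schur complement. *)
Lemma gaussian_integral n (A : 'M[R]_n) : posdef A ->
  0 < \det A /\
  (\int[lebesgue_tuple R n]_t (expR (- 2^-1 * qform A (tnth t)))%:E =
   (Num.sqrt (2 * pi) ^+ n / Num.sqrt (\det A))%:E)%E.
Proof.
elim: n A => [|n IH] A hA.
  rewrite det_mx00 ltr01 sqrtr1 expr0 divr1; split=> //.
  rewrite integral_dirac//; last by apply/measurable_EFinP; exact: measurable_gauss.
  by rewrite diracT mul1e /qform big_ord0 mulr0 expR0.
have a0 := posdef_diag_gt0 hA.
have [dS IS] := IH _ (posdef_schur hA).
rewrite det_schur ?gt_eqF// mulr_gt0//; split=> //.
rewrite [LHS]integral_lebesgue_cons; last 2 first.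
- by apply/measurable_EFinP; exact: measurable_gauss.
- by move=> t; rewrite lee_fin expR_ge0.
transitivity (\int[lebesgue_tuple R n]_y ((Num.sqrt (2 * pi) / Num.sqrt (A ord0 ord0))%:E *
   (expR (- 2^-1 * qform (schur A) (tnth y)))%:E))%E.
  apply: eq_integral => y _.
  rewrite -(integral_gauss_scaled
    ((\sum_j A ord0 (lift ord0 j) * tnth y j) / A ord0 ord0) a0) muleC.
  rewrite -ge0_integralZl//; last first.
    apply/measurable_EFinP; apply: measurableT_comp => //.
    by do 2 apply: measurable_funM => //; apply: measurable_funX; apply: measurable_funD.
  apply: eq_integral => x _; rewrite -EFinM -expRD; congr (expR _)%:E.
  rewrite qform_schur ?gt_eqF//; last by case: hA.
  rewrite tnth0 mulrDr addrC; congr (_ * _ + _ * (_ * (_ + _ / _) ^+ 2)).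
  - by congr qform; apply/funext => j /=; rewrite tnthS.
  - by apply: eq_bigr => j _; rewrite tnthS.
have mS : measurable_fun setT (fun y : n.-tuple (measurableTypeR R) =>
    (expR (- 2^-1 * qform (schur A) (tnth y)))%:E).
  by apply/measurable_EFinP; exact: measurable_gauss.
rewrite [LHS](ge0_integralZl _ measurableT mS)//.
rewrite IS -EFinM [Num.sqrt (A _ _ * _)]sqrtrM ?ltW// exprS; congr _%:E; field.
by rewrite !gt_eqF ?sqrtr_gt0.
Qed.

End gaussian_integral.

(** * The determinant as the exponential of a series of traces *)

Section trace_log_det.

Lemma deriv_prod (R : comNzRingType) (I : eqType) (r : seq I) (F : I -> {poly R}) : uniq r ->
  (\prod_(i <- r) F i)^`() = \sum_(i <- r) (F i)^`() * \prod_(k <- r | k != i) F k.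
Proof.
elim: r => [|x r IH] /=; first by rewrite !big_nil -[1]/(1%:P) derivC.
move=> /andP[xr ur]; rewrite !big_cons derivM IH// eqxx/=.
congr (_ * _ + _).
  rewrite [LHS]big_seq [RHS]big_seq_cond; apply: eq_bigl => k.
  by case kr: (k \in r) => //=; apply/esym; apply: contraNneq xr => <-.
rewrite mulr_sumr !big_seq; apply: eq_bigr => i ir.
rewrite big_cons ifT; first by rewrite mulrCA.
by apply: contraNneq xr => ->.
Qed.

(** Jacobi's formula. By multilinearity the derivative is the sum over [i] of the determinants with
    row [i] differentiated, each expanded along that row. *)
Lemma deriv_det (R : comNzRingType) n (M : 'M[{poly R}]_n) :
  (\det M)^`() = \sum_i \sum_j (M i j)^`() * cofactor M i j.
Proof.
pose Mi i := \matrix_(k, l) (if k == i then (M k l)^`() else M k l).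
transitivity (\sum_i \det (Mi i)); last first.
  apply: eq_bigr => i _; rewrite (expand_det_row _ i); apply: eq_bigr => j _.
  rewrite mxE eqxx; congr (_ * (_ * \det _)).
  by apply/matrixP => k l; rewrite !mxE ifN// eq_sym neq_lift.
rewrite /determinant raddf_sum exchange_big; apply: eq_bigr => s _ /=.
have -> (b : bool) (q : {poly R}) : ((-1) ^+ b * q)^`() = (-1) ^+ b * q^`().
  by case: b; rewrite ?expr0 ?mul1r ?expr1 ?mulN1r ?derivN.
rewrite -mulr_sumr; congr (_ * _); rewrite deriv_prod ?index_enum_uniq//.
apply: eq_bigr => i _; rewrite [RHS](bigD1 i)//= mxE eqxx; congr (_ * _).
by apply: eq_bigr => k /negbTE ki; rewrite mxE ki.
Qed.

(** A division-free geometric series for (1 - x B)^-1: since N adj N = det N, each det N tr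
    (B^(m+1)) is the difference of tr (B^(m+1) adj N) and x tr (B^(m+2) adj N). *)
Lemma trace_telescope (S : comPzRingType) n (B : 'M[S]_n) (x : S) M :
  let N := 1%:M - x *: B in
  \det N * \sum_(m < M) \tr (B ^+ m.+1) * x ^+ m =
  \tr (B *m \adj N) - x ^+ M * \tr (B ^+ M.+1 *m \adj N).
Proof.
move=> N.
elim: M => [|M IH]; first by rewrite big_ord0 mulr0 expr0 expr1 mul1r subrr.
rewrite big_ord_recr/= mulrDr IH.
have h : \det N * \tr (B ^+ M.+1) =
    \tr (B ^+ M.+1 *m \adj N) - x * \tr (B ^+ M.+2 *m \adj N).
  transitivity (\tr (B ^+ M.+1 *m (N *m \adj N))).
    by rewrite mul_mx_adj mul_mx_scalar mxtraceZ.
  rewrite mulmxA mulmxBr mulmx1 -scalemxAr mulmxBl raddfB/= -scalemxAl mxtraceZ.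
  by rewrite [B ^+ M.+2]exprSr.
by rewrite mulrA h [x ^+ M.+1]exprS; ring.
Qed.

Context (R : realType) (n : nat) (A : 'M[R]_n).

(* With N = 1 - 'X A, the function det N * exp (logser M) is 1 at 0 and is the
   quantity of interest at 1; by Jacobi's formula its derivative is O(A^(M+1)). *)
Let Ap : 'M[{poly R}]_n := map_mx polyC A.
Let N : 'M[{poly R}]_n := 1%:M - 'X *: Ap.

Let logser M : {poly R} := \sum_(m < M) ((\tr (A ^+ m.+1)) / m.+1%:R) *: 'X^(m.+1).

Let mapX m : map_mx polyC (A ^+ m) = Ap ^+ m.
Proof.
elim: m => [|m IH]; first by rewrite !expr0 map_mx1.
by rewrite !exprS map_mxM IH.
Qed.

Let deriv_logser M : (logser M)^`() = \sum_(m < M) \tr (Ap ^+ m.+1) * 'X^m.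
Proof.
rewrite raddf_sum; apply: eq_bigr => m _ /=.
rewrite derivZ derivXn -mapX trace_map_mx.
by rewrite -scalerMnr scalerMnl -mulr_natr divfK ?pnatr_eq0//= mul_polyC.
Qed.

Let deriv_detN : (\det N)^`() = - \tr (Ap *m \adj N).
Proof.
rewrite deriv_det /mxtrace -sumrN; apply: eq_bigr => i _.
rewrite mxE -sumrN; apply: eq_bigr => j _.
rewrite !mxE derivB derivM derivX derivC mulr0 addr0 mul1r.
have -> : ((i == j)%:R : {poly R})^`() = 0 by rewrite -polyC_natr derivC.
by rewrite sub0r mulNr.
Qed.

Let derivF M : (\det N)^`() + \det N * (logser M)^`() = - ('X^M * \tr (Ap ^+ M.+1 *m \adj N)).
Proof. by rewrite deriv_logser trace_telescope deriv_detN; ring. Qed.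

Let det1 : (\det N).[1] = \det (1%:M - A).
Proof.
rewrite -horner_evalE -det_map_mx; congr (\det _); apply/matrixP => i j.
by rewrite !mxE [LHS]horner_evalE !(hornerE, hornerMn).
Qed.

Let det0 : (\det N).[0] = 1.
Proof.
rewrite -horner_evalE -det_map_mx -[RHS](matrix.det1 R n); congr (\det _).
apply/matrixP => i j.
by rewrite !mxE [LHS]horner_evalE !(hornerE, hornerMn) subr0.
Qed.

Variables (h : 'I_n -> R) (rho : R).
Hypothesis A0 : forall i j, 0 <= A i j.
Hypothesis h0 : forall i, 0 < h i.
Hypothesis rho01 : 0 < rho < 1.
Hypothesis Ah : forall i, \sum_j A i j * h j <= rho * h i.

Let powA0 m i j : 0 <= (A ^+ m) i j.
Proof.
elim: m i j => [|m IH] i j; first by rewrite expr0 mxE ler0n.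
by rewrite exprSr mxE sumr_ge0// => k _; rewrite mulr_ge0.
Qed.

Let rho0 : 0 <= rho. Proof. by case/andP: rho01 => /ltW. Qed.

Let powAh m i : \sum_j (A ^+ m) i j * h j <= rho ^+ m * h i.
Proof.
elim: m i => [|m IH] i.
  rewrite expr0 mul1r (bigD1 i)//= big1 ?addr0; first by rewrite mxE eqxx mul1r.
  by move=> j /negbTE ji; rewrite mxE eq_sym ji mul0r.
under eq_bigr do rewrite exprSr mxE mulr_suml.
rewrite exchange_big/=; under eq_bigr do (under eq_bigr do rewrite -mulrA; rewrite -mulr_sumr).
apply: (@le_trans _ _ (\sum_k (A ^+ m) i k * (rho * h k))).
  by apply: ler_sum => k _; rewrite ler_wpM2l.
under eq_bigr do rewrite mulrCA.
by rewrite -mulr_sumr exprS -mulrA ler_wpM2l.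
Qed.

Let C := \sum_i \sum_j h i / h j.

Let C0 : 0 <= C.
Proof. by do 2 (apply: sumr_ge0 => ? _); rewrite divr_ge0// ltW. Qed.

(** In the sup norm weighted by [h], A^m has norm at most rho^m; the ratio h_i / h_j is then
    absorbed in [C], the sum of all such ratios. *)
Let powA_le m i j : (A ^+ m) i j <= rho ^+ m * C.
Proof.
apply: (@le_trans _ _ (rho ^+ m * (h i / h j))).
  rewrite mulrA ler_pdivlMr// (le_trans _ (powAh m i))//.
  rewrite (bigD1 j)//= lerDl sumr_ge0// => k _.
  by rewrite mulr_ge0// ltW.
rewrite ler_wpM2l ?exprn_ge0// /C (bigD1 i)//= (bigD1 j)//= -addrA lerDl addr_ge0//.
  by apply: sumr_ge0 => k _; rewrite divr_ge0// ltW.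
by do 2 (apply: sumr_ge0 => ? _); rewrite divr_ge0// ltW.
Qed.

Let tr_powA m : 0 <= \tr (A ^+ m) <= n%:R * C * rho ^+ m.
Proof.
rewrite sumr_ge0//=; apply: (@le_trans _ _ (\sum_(i < n) rho ^+ m * C)).
  by apply: ler_sum => i _.
by rewrite sumr_const card_ord -[X in X <= _]mulr_natl mulrCA mulrC.
Qed.

Let logserE M z : (logser M).[z] = \sum_(m < M) \tr (A ^+ m.+1) / m.+1%:R * z ^+ m.+1.
Proof. by rewrite horner_sum; apply: eq_bigr => m _; rewrite !hornerE. Qed.

Let logser_le M z : 0 <= z <= 1 -> (logser M).[z] <= n%:R * C / (1 - rho).
Proof.
move=> /andP[z0 z1]; rewrite logserE.
have nC0 : 0 <= n%:R * C by rewrite mulr_ge0.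
have [/andP[r0 r1]] := rho01.
apply: (@le_trans _ _ (series (geometric (n%:R * C) rho) M)); last first.
  by apply: geometric_le_lim => //; rewrite gtr0_norm.
rewrite /series/= big_mkord; apply: ler_sum => m _.
have /andP[t0 t1] := tr_powA m.+1.
apply: (@le_trans _ _ (\tr (A ^+ m.+1))).
  rewrite -mulrA ler_piMr// mulr_ile1 ?invr_ge0 ?exprn_ge0 ?exprn_ile1//.
  by rewrite invf_le1 ?ltr0n// ler1n.
by rewrite (le_trans t1)// ler_wpM2l// exprS ler_piMl ?exprn_ge0// ltW.
Qed.

(** All absolute values of coefficients of the adjugate, summed: a crude bound for every entry on
    [0, 1]. *)
Let K := \sum_i \sum_j \sum_(k < size (\adj N i j)) `|(\adj N i j)`_k|.

Let adj_le z i j : 0 <= z <= 1 -> `|(\adj N i j).[z]| <= K.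
Proof.
move=> /andP[z0 z1]; rewrite horner_coef.
apply: (@le_trans _ _ (\sum_(k < size (\adj N i j)) `|(\adj N i j)`_k|)).
  rewrite (le_trans (ler_norm_sum _ _ _))//; apply: ler_sum => k _.
  by rewrite normrM ler_piMr// normrX exprn_ile1// ger0_norm.
rewrite /K (bigD1 i)//= (bigD1 j)//= -addrA lerDl addr_ge0//.
  by do 2 (apply: sumr_ge0 => ? _).
by do 3 (apply: sumr_ge0 => ? _).
Qed.

Let f M (z : R) := (\det N).[z] * expR (logser M).[z].

Let is_derive_f M (z : R) : is_derive z 1 (f M)
  (- (z ^+ M * (\tr (Ap ^+ M.+1 *m \adj N)).[z]) * expR (logser M).[z]).
Proof.
have dg : is_derive z 1 (fun z => expR (logser M).[z])
    ((logser M)^`().[z] *: expR (logser M).[z]).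
  rewrite -[X in is_derive _ _ X]/(expR \o horner (logser M)).
  by rewrite -[_ *: _]/(_ * _) mulrC; exact: is_derive1_comp.
have -> : - (z ^+ M * (\tr (Ap ^+ M.+1 *m \adj N)).[z]) * expR (logser M).[z] =
   (\det N).[z] *: ((logser M)^`().[z] *: expR (logser M).[z]) +
   expR (logser M).[z] *: (\det N)^`().[z].
  have /(congr1 (horner^~ z)) := derivF M; rewrite !hornerE => <-.
  by rewrite /GRing.scale/=; ring.
exact: is_deriveM.
Qed.

(** Mean value theorem for [f M] on [0, 1]: it equals 1 at 0, and its derivative is bounded by a
    constant times rho^M because it carries the factor A^(M+1). *)
Lemma cvg_trace_log_det :
  expR (\sum_(m < M) \tr (A ^+ m.+1) / m.+1%:R) * \det (1%:M - A) @[M --> \oo] --> (1 : R).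
Proof.
pose L := n%:R * C / (1 - rho).
(* n^2 terms in the trace of a product, [C] for the power of A, [K] for the adjugate and exp L for
   the exponential factor. *)
pose D := (n ^ 2)%:R * C * K * expR L.
have fE M : expR (\sum_(m < M) \tr (A ^+ m.+1) / m.+1%:R) * \det (1%:M - A) = f M 1.
  rewrite /f det1 mulrC logserE; congr (_ * expR _).
  by apply: eq_bigr => m _; rewrite expr1n mulr1.
have bnd M : `|f M 1 - 1| <= D * rho ^+ M.
  have f0 : f M 0 = 1.
    rewrite /f det0 logserE big1 ?expR0 ?mulr1// => m _.
    by rewrite expr0n mulr0.
  have [|c] := @MVT_segment R (f M) _ 0 1 ler01 (fun z _ => is_derive_f M z).
    apply: continuous_subspaceT => z.
    apply/differentiable_continuous/derivable1_diffP.
    by have [] := is_derive_f M z.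
  rewrite in_itv/= => c01; rewrite f0 subr0 mulr1 => ->.
  rewrite normrM normrN normrM.
  have /andP[c0 c1] := c01.
  rewrite [X in _ * X]ger0_norm ?expR_ge0//.
  have tle : `|(\tr (Ap ^+ M.+1 *m \adj N)).[c]| <= (n ^ 2)%:R * C * K * rho ^+ M.
    rewrite /mxtrace horner_sum (le_trans (ler_norm_sum _ _ _))//.
    apply: (@le_trans _ _ (\sum_(i < n) \sum_(j < n) (rho ^+ M * C) * K)); last first.
      by rewrite !sumr_const !card_ord -mulrnA -[X in X <= _]mulr_natl mulnn [leLHS](_ : _ = (n ^ 2)%:R * C * K * rho ^+ M)//; ring.
    apply: ler_sum => i _; rewrite mxE horner_sum (le_trans (ler_norm_sum _ _ _))//.
    apply: ler_sum => j _; rewrite -mapX mxE hornerM hornerC normrM.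
    rewrite ler_pM// ?adj_le// ger0_norm// (le_trans (powA_le _ _ _))//.
    by rewrite ler_wpM2r// exprS ler_piMl ?exprn_ge0// ltW//; case/andP: rho01.
  rewrite [leRHS](_ : _ = 1 * ((n ^ 2)%:R * C * K * rho ^+ M) * expR L); last by rewrite /D; ring.
  rewrite ler_pM ?mulr_ge0 ?expR_ge0//; last by rewrite ler_expR logser_le.
  by rewrite ler_pM// normrX ger0_norm// exprn_ile1.
rewrite (_ : (fun M => _) = (fun M => 1 + (f M 1 - 1))); last first.
  by apply/funext => M; rewrite fE addrC subrK.
rewrite -[X in _ --> X]addr0; apply: cvgD; first exact: cvg_cst.
apply/norm_cvg0P/(squeeze_cvgr (f := fun=> 0) (h := fun M => D * rho ^+ M)).
- by near=> M; rewrite normr_ge0/=; exact: bnd.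
- exact: cvg_cst.
- rewrite -[X in _ --> X](mulr0 D); apply: cvgM; first exact: cvg_cst.
  by apply: cvg_expr; rewrite ger0_norm//; case/andP: rho01.
Unshelve. all: by end_near. Qed.

End trace_log_det.

(** * The random walk killed outside D *)

Section lattice.
Context (d : nat).

(** The 2d unit steps, indexed by an axis and a sign, [true] standing for the negative direction. *)
Definition nbr (x : lattice d) (k : 'I_d * bool) : lattice d :=
  (x : 'rV[int]_d) + (-1) ^+ k.2 *: delta_mx ord0 k.1.

Lemma nbrE x k i : nbr x k ord0 i = x ord0 i + (-1) ^+ k.2 * (i == k.1)%:R.
Proof. by rewrite !mxE eqxx. Qed.

Lemma adj_sym : symmetric (@adj d).
Proof. by move=> x y; congr (_ == _); apply: eq_bigr => i _; rewrite distrC. Qed.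

Lemma adj_nbr x k : adj x (nbr x k).
Proof.
apply/eqP; rewrite (bigD1 k.1)//= big1 ?addr0; last first.
  by move=> i /negbTE ik; rewrite nbrE ik mulr0 addr0 subrr normr0.
by rewrite nbrE eqxx mulr1 opprD addNKr normrN normrX normrN1 expr1n.
Qed.

(** Over the integers one differing coordinate already uses up the whole l^1 distance 1, so the
    others agree. *)
Lemma adj_ex x y : adj x y -> exists k, y = nbr x k.
Proof.
move=> /eqP xy.
have [i xyi] : exists i, x ord0 i != y ord0 i.
  apply/existsP; apply: contraPT xy => /existsPn h.
  rewrite big1// => i _; have := h i; rewrite negbK => /eqP ->.
  by rewrite subrr normr0.
move: xy; rewrite (bigD1 i)//= => xy.
have r0 : 0 <= \sum_(j < d | j != i) `|x ord0 j - y ord0 j| by exact: sumr_ge0.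
have n1 : 1 <= `|x ord0 i - y ord0 i| by rewrite -gtz0_ge1 normr_gt0 subr_eq0.
have S0 : \sum_(j < d | j != i) `|x ord0 j - y ord0 j| = 0.
  by move: r0 n1 xy; set S := \sum_(_ < _ | _) _; move: `|_| => m; lia.
move: xy; rewrite S0 addr0 => xy1.
move/eqP : S0; rewrite psumr_eq0// => /allP rest0.
exists (i, y ord0 i < x ord0 i); apply/rowP => j; rewrite nbrE/=.
have [->|ji] := eqVneq j i; last first.
  have := rest0 j; rewrite mem_index_enum ji/= normr_eq0 subr_eq0 => /(_ isT) /eqP ->.
  by rewrite mulr0 addr0.
rewrite mulr1; case: ltP => h; rewrite ?expr1 ?expr0;
  by move: xy1 h; move: (x _ _) (y _ _) => a b; lia.
Qed.

Lemma nbr_inj x : injective (nbr x).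
Proof.
move=> [i b] [j c] /rowP h; have /= := h i; rewrite !nbrE/= eqxx.
have [->|ij] := eqVneq i j; last by case: b {h} => /=; lia.
by case: b {h}; case: c => //=; lia.
Qed.

Lemma nbrK x k : nbr (nbr x k) (k.1, ~~ k.2) = x.
Proof.
by apply/rowP => i; rewrite !nbrE/=; case: k => j [] /=; ring.
Qed.

Lemma adj_irrefl (x : lattice d) : adj x x = false.
Proof.
by apply/negP; rewrite /adj big1// => i _; rewrite subrr normr0.
Qed.

End lattice.

Section lattice_sums.
Context (R : realType) (d : nat) (D : {fset lattice d}).

Lemma sum_adj (g : lattice d -> R) (x : lattice d) :
  \sum_(y : D | adj x (val y)) g (val y) =
  \sum_k (if nbr x k \in D then g (nbr x k) else 0).
Proof.
transitivity (\sum_k \sum_(y : D | nbr x k == val y) g (val y)).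
  rewrite (exchange_big_dep xpredT)//= big_mkcond; apply: eq_bigr => y _.
  case: ifPn => [/adj_ex[k yk]|nxy].
    rewrite yk (big_pred1 k)// => k' /=.
    exact: (inj_eq (@nbr_inj d x)).
  rewrite big_pred0// => k; apply: contraNF nxy => /eqP <-; exact: adj_nbr.
apply: eq_bigr => k _; case: ifPn => [kD|kD].
  by rewrite (big_pred1 [` kD]%fset)// => y; rewrite /= eq_sym -val_eqE.
rewrite big_pred0// => y; apply: contraNF kD => /eqP ->; exact: valP.
Qed.

Variable gamma : D -> R.

(* An edge inside D is met from both its endpoints, and an edge leaving D from
   only one; flux is the share of |grad|^2 attributed to an oriented edge. *)
Let edge_of (p : D * ('I_d * bool)) : {fset lattice d} :=
  [fset val p.1; nbr (val p.1) p.2]%fset.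

Let flux (p : D * ('I_d * bool)) : R :=
  gamma p.1 ^+ 2 - gamma p.1 * extend0 gamma (nbr (val p.1) p.2).

Lemma extend0_val (x : D) : extend0 gamma (val x) = gamma x.
Proof. by rewrite /extend0 valK. Qed.

Lemma extend0_out x : x \notin D -> extend0 gamma x = 0.
Proof. by move=> xD; rewrite /extend0 insubN. Qed.

Lemma grad_fset2 (x y : lattice d) : x != y ->
  grad gamma [fset x; y]%fset ^+ 2 = (extend0 gamma x - extend0 gamma y) ^+ 2.
Proof.
move=> xy; rewrite /grad real_normK ?num_real//.
have : perm_eq (enum_fset [fset x; y]%fset) [:: x; y].
  apply: uniq_perm; rewrite ?fset_uniq//= ?inE ?xy// => z.
  by rewrite !inE.
case E : (enum_fset _) => [|a [|b [|]]] h; have //= := perm_size h.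
move=> _.
have : (a \in [:: x; y]) by rewrite -(perm_mem h) mem_head.
have : (b \in [:: x; y]) by rewrite -(perm_mem h) !inE eqxx orbT.
have : a != b by have := perm_uniq h; rewrite /= !inE xy andbT => ->.
rewrite !inE => ab /orP[]/eqP bE /orP[]/eqP aE; subst a b; rewrite ?eqxx// in ab *.
by rewrite -sqrrN opprB.
Qed.

(** Only the oriented edge itself and its reversal have the same underlying edge, and the reversal
    is indexed only if its starting point is in [D]. *)
Let flux_edge p : \sum_(q | edge_of q == edge_of p) flux q = grad gamma (edge_of p) ^+ 2.
Proof.
case: p => x k; set y := nbr (val x) k.
have xy : val x != y.
  by apply/eqP => xy; have := adj_nbr (val x) k; rewrite -/y -xy adj_irrefl.
rewrite grad_fset2// extend0_val -/y.
have edgeE q : (edge_of q == edge_of (x, k)) =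
    (q == (x, k)) || ((val q.1 == y) && (q.2 == (k.1, ~~ k.2))).
  apply/eqP/orP => [|[/eqP ->//|]]; last first.
    case: q => z l /= /andP[/eqP zy /eqP ->].
    by rewrite /edge_of/= zy /y nbrK fsetUC.
  move=> eqe.
  have : val q.1 \in edge_of (x, k) by rewrite -eqe !inE eqxx.
  rewrite !inE => /orP[]/eqP q1.
    left; have : nbr (val q.1) q.2 \in edge_of (x, k) by rewrite -eqe !inE eqxx orbT.
    rewrite q1 !inE => /orP[/eqP qx|/eqP/nbr_inj qk].
      by have := adj_nbr (val x) q.2; rewrite qx adj_irrefl.
    by rewrite [q]surjective_pairing (val_inj q1) qk.
  right; rewrite q1 eqxx/=.
  have : nbr (val q.1) q.2 \in edge_of (x, k) by rewrite -eqe !inE eqxx orbT.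
  rewrite q1 !inE => /orP[/eqP qx|/eqP qx].
    by apply/eqP/(@nbr_inj _ y); rewrite qx /y nbrK.
  by have := adj_nbr y q.2; rewrite /= qx adj_irrefl.
rewrite (eq_bigl _ _ edgeE) (bigD1 (x, k)) ?eqxx//=.
(* For y outside D the field vanishes at y, so the single term gamma_x^2 is already the full
   square. *)
have [yD|yD] := boolP (y \in D); last first.
  rewrite big1 ?addr0; last first.
    move=> q /andP[/orP[-> //|/andP[/eqP qy _]]].
    by move: yD; rewrite -qy (valP q.1).
  by rewrite /flux/= -/y (extend0_out yD) mulr0 !subr0.
pose y' : D := [` yD]%fset.
rewrite (big_pred1 (y', (k.1, ~~ k.2))); last first.
  move=> [z l] /=; rewrite !xpair_eqE -[z == y']val_eqE/=.
  case: (eqVneq z x) => [->|zx] /=; last by rewrite andbT.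
  by rewrite (negbTE xy) orbF/= andbN.
rewrite /flux/= -/y -(extend0_val y')/= /y nbrK extend0_val; ring.
Qed.

(** Discrete integration by parts: the fluxes are summed over oriented edges, grouped by edge on one
    side and by starting point on the other, each point having 2d directions. *)
Lemma sum_grad : \sum_(e \in edges D) grad gamma e ^+ 2 =
  2 * d%:R * \sum_x gamma x ^+ 2 -
  \sum_x \sum_(y : D | adj (val x) (val y)) gamma x * gamma y.
Proof.
pose s := undup [seq edge_of p | p <- enum {: D * ('I_d * bool)}].
have sE e : (e \in s) = `[< edges D e >].
  apply/idP/asboolP.
    rewrite mem_undup => /mapP[[x k] _ ->].
    by exists (val x), (nbr (val x) k); rewrite adj_nbr (valP x).
  rewrite mem_undup => -[x [y [-> xy xyD]]]; apply/mapP.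
  case/orP: xyD => zD.
    have [k ->] := adj_ex xy.
    by exists ([` zD]%fset, k); rewrite ?mem_enum.
  rewrite adj_sym in xy; have [k ->] := adj_ex xy.
  by exists ([` zD]%fset, k); rewrite ?mem_enum// fsetUC.
rewrite (@fsbigE _ _ _ _ _ s) ?undup_uniq//; last 2 first.
- by move=> e /=; rewrite sE => /asboolP.
- by move=> e De; rewrite sE => /asboolPn.
transitivity (\sum_(e <- s) \sum_(q | edge_of q == e) flux q).
  rewrite big_seq_cond [RHS]big_seq; apply: eq_big => [e|e /andP[]].
    by rewrite sE; apply/andP/idP => [[]//|De]; split => //; apply/asboolP/mem_set/asboolP.
  by rewrite mem_undup => /mapP[q _ ->] _; rewrite flux_edge.
transitivity (\sum_q flux q).
  rewrite (exchange_big_dep xpredT)//=; apply: eq_bigr => q _.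
  rewrite big_mkcond (bigD1_seq (edge_of q))/= ?undup_uniq//; last first.
    by rewrite mem_undup map_f// mem_enum.
  rewrite eqxx big1 ?addr0// => e /negbTE eq; by rewrite eq_sym eq.
rewrite -(pair_big xpredT xpredT (fun x k => flux (x, k)))/= mulr_sumr -sumrB.
apply: eq_bigr => x _.
rewrite -[in RHS]mulr_sumr -(eq_bigr _ (fun y _ => extend0_val y)).
rewrite (sum_adj (extend0 gamma)).
rewrite /flux/= sumrB; congr (_ - _).
  rewrite big_const iter_addr_0 card_prod card_ord card_bool -[LHS]mulr_natl natrM.
  by rewrite [_ * 2]mulrC.
rewrite -mulr_sumr; congr (_ * _).
apply: eq_bigr => k _; case: ifPn => // ?; exact: extend0_out.
Qed.

End lattice_sums.

(** * The transition matrix of the killed walk and its contraction *)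

Section step_matrix.
Context (R : realType) (d : nat) (D : {fset lattice d}).
Notation N := #|{: D}|.

Definition site (i : 'I_N) : lattice d := val (enum_val i).

Lemma site_rank (x : D) : site (enum_rank x) = val x.
Proof. by rewrite /site enum_rankK. Qed.

Lemma site_in i : site i \in D. Proof. exact: valP. Qed.

Lemma site_inj : injective site.
Proof. by move=> i j /val_inj/enum_val_inj. Qed.

Lemma sum_rank (V : nmodType) (F : 'I_N -> V) : \sum_i F i = \sum_x F (enum_rank x).
Proof. by rewrite (reindex (@enum_rank {: D}))//; exact/onW_bij/enum_rank_bij. Qed.

Definition step_mx : 'M[R]_N :=
  \matrix_(i, j) ((adj (site i) (site j))%:R / (2 * d%:R)).

Lemma step_mx_sym : step_mx^T = step_mx.
Proof. by apply/matrixP => i j; rewrite !mxE adj_sym. Qed.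

Lemma step_mx_ge0 i j : 0 <= step_mx i j.
Proof. by rewrite mxE divr_ge0// mulr_ge0. Qed.

Lemma qform_1B n (A : 'M[R]_n) v :
  qform (1%:M - A) v = \sum_i v i ^+ 2 - qform A v.
Proof.
rewrite /qform -sumrB; apply: eq_bigr => i _.
rewrite (bigD1 i)//= [in RHS](bigD1 i)//= !mxE eqxx.
rewrite (eq_bigr (fun j => - (A i j * v i * v j))); last first.
  by move=> j /negbTE ji; rewrite !mxE eq_sym ji sub0r !mulNr.
by rewrite sumrN/=; ring.
Qed.

Lemma qform_addD_diag n (A : 'M[R]_n) (k : 'rV[R]_n) v :
  qform (A + diag_mx k) v = qform A v + \sum_j k ord0 j * v j ^+ 2.
Proof.
rewrite /qform -big_split; apply: eq_bigr => j _ /=.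
rewrite (bigD1 j)//= [in RHS](bigD1 j)//= !mxE eqxx.
rewrite (eq_bigr (fun l => A j l * v j * v l)); last first.
  by move=> l /negbTE lj; rewrite !mxE [j == l]eq_sym lj addr0.
rewrite -[k ord0 j]/(k 0 j) mulr1n; ring.
Qed.

Hypothesis d0 : (0 < d)%N.

Let d0R : 0 < d%:R :> R. Proof. by rewrite ltr0n. Qed.

(** The factor 1/(2d) in the density turns 2d minus the adjacency matrix into 1 - S, leaving the
    standard Gaussian exponent. *)
Lemma gff_density_qform (t : N.-tuple (measurableTypeR R)) :
  gff_density (field_of_tuple t) = expR (- 2^-1 * qform (1%:M - step_mx) (tnth t)).
Proof.
rewrite /gff_density sum_grad qform_1B; congr expR.
rewrite sum_rank/= /qform sum_rank.
under [X in _ = - 2^-1 * (_ - X)]eq_bigr do rewrite sum_rank.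
rewrite -[in LHS]mulrA -[LHS]mulNr; congr (_ * _).
rewrite mulrBr mulrA mulVf ?mul1r ?mulf_neq0 ?gt_eqF//; congr (_ - _).
rewrite mulr_sumr; apply: eq_bigr => x _; rewrite mulr_sumr big_mkcond.
apply: eq_bigr => y _; rewrite mxE !site_rank/=.
by case: ifP => _; rewrite ?mul0r// mul1r mulrA.
Qed.

(* h is positive near D, and its mean over the neighbours of x is h x - 1/d. *)
Let x0 (x : lattice d) : int := x ord0 (Ordinal d0).
Let C : R := 2 + (\sum_(x : D) (`|x0 (val x)| + 1) ^+ 2)%:~R.
Let h (x : lattice d) : R := C - (x0 x ^+ 2)%:~R.

(** The sum in [C] contains the term of [x], and a step moves the chosen coordinate by at most 1. *)
Let hD x k : x \in D -> 1 <= h (nbr x k) /\ 1 <= h x.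
Proof.
move=> xD.
have hC : ((`|x0 x| + 1) ^+ 2)%:~R + 2 <= C.
  by rewrite /C addrC lerD2l ler_int (bigD1 [` xD]%fset)//= lerDl sumr_ge0.
have key y : `|x0 y| <= `|x0 x| + 1 -> 1 <= h y.
  move=> yx; rewrite /h lerBrDl (le_trans _ hC)// lerD ?ler1n// ler_int.
  by rewrite -[X in X <= _]real_normK ?num_real// lerXn2r// nnegrE ?addr_ge0.
split; apply: key; last by rewrite lerDl.
rewrite /x0 nbrE (le_trans (ler_normD _ _))// lerD2l normrM normrX normrN1 expr1n mul1r.
by case: (_ == _).
Qed.

(** Killing only helps, since [h] is nonnegative on the neighbours of D. The mean of [h] drops by
    1/d, and h <= C makes this a proportion at least 1/(dC), whence rho = 1 - 1/(dC). *)
Lemma step_mx_superharmonic : exists (g : 'I_N -> R) (rho : R),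
  [/\ forall i, 0 < g i, 0 < rho < 1 &
      forall i, \sum_j step_mx i j * g j <= rho * g i].
Proof.
have C2 : 2 <= C.
  by rewrite lerDl ler0z sumr_ge0// => x _; rewrite exprn_ge0// addr_ge0.
have C0 : 0 < C by rewrite (lt_le_trans _ C2).
pose e := (d%:R * C)^-1.
have e0 : 0 < e by rewrite invr_gt0 mulr_gt0.
have e1 : e < 1.
  rewrite invf_lt1 ?mulr_gt0// (lt_le_trans _ (ler_peMl _ _))//.
  - by rewrite (lt_le_trans _ C2)// ltr1n.
  - exact: ltW.
  - by rewrite ler1n.
exists (h \o site), (1 - e); split.
- move=> i; rewrite /= (lt_le_trans ltr01)//.
  by case: (@hD (site i) (Ordinal d0, true) (site_in i)).
- by rewrite subr_gt0 e1 ltrBlDr ltrDl.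
move=> i; set x := site i.
have xD : x \in D := site_in i.
have -> : \sum_j step_mx i j * (h \o site) j = (2 * d%:R)^-1 *
    \sum_(y : D | adj x (val y)) h (val y).
  rewrite sum_rank mulr_sumr [RHS]big_mkcond; apply: eq_bigr => y _.
  rewrite mxE site_rank /= /x; case: ifP => _; last by rewrite !mul0r.
  by rewrite mul1r site_rank.
rewrite (sum_adj D h).
apply: (@le_trans _ _ ((2 * d%:R)^-1 * \sum_k h (nbr x k))).
  rewrite ler_pM2l ?invr_gt0 ?mulr_gt0//; apply: ler_sum => k _.
  by case: ifP => // _; have [/(le_trans ler01)] := @hD x k xD.
(* Only the two directions along the chosen axis change [x0]; the terms linear in [x0] cancel and
   each square contributes 1. *)
have -> : \sum_k h (nbr x k) = 2 * d%:R * h x - 2.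
  rewrite (eq_bigr (fun k : 'I_d * bool => h x - ((k.1 == Ordinal d0)%:R +
     (-1) ^+ k.2 * (2 * (k.1 == Ordinal d0)%:R * (x0 x)%:~R)))); last first.
    move=> [j b] _; rewrite /h /x0 nbrE/= eq_sym.
    case: (j == _); case: b; rewrite /= ?mulr1 ?mulr0 ?addr0 ?mul0r ?expr1 ?expr0 ?mul1r; 
      rewrite ?rmorphXn/= ?intrD ?rmorphN1; ring.
  rewrite sumrB; congr (_ - _).
    by rewrite big_const iter_addr_0 card_prod card_ord card_bool -[LHS]mulr_natl natrM [_ * 2]mulrC.
  rewrite -(pair_big xpredT xpredT (fun (j : 'I_d) (b : bool) => (j == Ordinal d0)%:R +
     (-1) ^+ b * (2 * (j == Ordinal d0)%:R * (x0 x)%:~R) : R))/=.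
  rewrite (bigD1 (Ordinal d0))//= [X in _ + X]big1; last first.
    by move=> j /negbTE ->; rewrite big_bool/= !(mulr0, mul0r, addr0).
  by rewrite big_bool/= expr1 expr0; ring.
rewrite mulrBr mulrA mulVf ?mul1r ?mulf_neq0 ?gt_eqF//.
rewrite mulrBl mul1r lerB// -/x.
have hC : h x <= C by rewrite /h lerBlDr lerDl ler0z sqr_ge0.
apply: (@le_trans _ _ (e * C)); first by rewrite ler_wpM2l// ltW.
by rewrite /e invfM -mulrA mulVf ?gt_eqF// mulr1 invfM mulrAC mulVf ?mul1r.
Qed.

(* 2 v_i v_j <= v_i^2 g_j / g_i + v_j^2 g_i / g_j *)
Lemma qform_substochastic n (A : 'M[R]_n) (g : 'I_n -> R) (rho : R) :
  A^T = A -> (forall i j, 0 <= A i j) -> (forall i, 0 < g i) ->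
  (forall i, \sum_j A i j * g j <= rho * g i) ->
  forall v, qform A v <= rho * \sum_i v i ^+ 2.
Proof.
move=> AT A0 g0 Ag v.
have As i j : A i j = A j i by rewrite -[in LHS]AT mxE.
pose S := \sum_i \sum_j A i j * (v i ^+ 2 * (g j / g i)).
have S_le : S <= rho * \sum_i v i ^+ 2.
  rewrite mulr_sumr; apply: ler_sum => i _.
  rewrite (_ : \sum_j _ = v i ^+ 2 / g i * \sum_j A i j * g j); last first.
    by rewrite mulr_sumr; apply: eq_bigr => j _; ring.
  apply: (@le_trans _ _ (v i ^+ 2 / g i * (rho * g i))).
    by rewrite ler_wpM2l// divr_ge0 ?sqr_ge0// ltW.
  by rewrite [leLHS](_ : _ = rho * v i ^+ 2)//; field; rewrite gt_eqF.
apply: le_trans S_le.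
have SE : S = \sum_i \sum_j A i j * (v j ^+ 2 * (g i / g j)).
  by rewrite /S exchange_big; apply: eq_bigr => i _; apply: eq_bigr => j _; rewrite As.
suff : qform A v <= 2^-1 * (S + S) by rewrite -mulr2n -[S *+ 2]mulr_natl mulrA mulVf ?mul1r.
rewrite {2}SE -big_split mulr_sumr; apply: ler_sum => i _.
rewrite -big_split mulr_sumr; apply: ler_sum => j _ /=.
rewrite -mulrA -mulrDr [leRHS]mulrCA ler_wpM2l//.
have gi := g0 i; have gj := g0 j.
have : 0 <= (v i * g j - v j * g i) ^+ 2 / (2 * (g i * g j)).
  by rewrite divr_ge0 ?sqr_ge0// mulr_ge0// mulr_ge0// ltW.
suff -> : (v i * g j - v j * g i) ^+ 2 / (2 * (g i * g j)) =
   2^-1 * (v i ^+ 2 * (g j / g i) + v j ^+ 2 * (g i / g j)) - v i * v j.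
  by rewrite subr_ge0.
by field; rewrite !gt_eqF.
Qed.

(** As rho < 1, the form of S is strictly below the sum of squares at any nonzero vector, and a
    nonnegative diagonal can only increase the difference. *)
Lemma posdef_step_mx (k : 'rV[R]_N) : (forall i, 0 <= k ord0 i) ->
  posdef (1%:M - step_mx + diag_mx k).
Proof.
move=> k0; split.
  by rewrite raddfD raddfB/= trmx1 step_mx_sym tr_diag_mx.
move=> v [i vi].
rewrite qform_addD_diag.
rewrite ltr_pwDl//; last by apply: sumr_ge0 => j _; rewrite mulr_ge0 ?sqr_ge0.
have [g [rho [g0 /andP[r0 r1] gP]]] := step_mx_superharmonic.
rewrite qform_1B subr_gt0.
apply: (le_lt_trans (qform_substochastic step_mx_sym step_mx_ge0 g0 gP v)).
rewrite gtr_pMl// (bigD1 i)//= ltr_pwDl ?exprn_even_gt0//.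
by apply: sumr_ge0 => j _; rewrite sqr_ge0.
Qed.

End step_matrix.

(** * Loops and traces of powers *)

Section periodic_words.
Context (T : eqType).
Implicit Types u v w l : seq T.

Lemma cat_flatten_nseq u q : flatten (nseq q u) ++ u = u ++ flatten (nseq q u).
Proof. by elim: q => [|q IH] /=; rewrite ?cats0// -catA IH. Qed.

(** From u v = v u and |u| <= |v|, the word v begins with u; removing this copy keeps the
    commutation. *)
Lemma commuting_flatten u v q : size v = (q * size u)%N -> u ++ v = v ++ u ->
  v = flatten (nseq q u).
Proof.
elim: q v => [|q IH] v /= sv uv; first by apply/nilP; rewrite /nilp sv.
have [v' vE] : exists v', v = u ++ v'.
  exists (drop (size u) v); rewrite -[LHS](cat_take_drop (size u) v); congr (_ ++ _).
  have := congr1 (take (size u)) uv; rewrite take_size_cat// takel_cat//.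
  by rewrite sv mulSn leq_addr.
move: sv uv; rewrite vE size_cat mulSn => /addnI sv.
by rewrite -catA => /eqP; rewrite eqseq_cat// eqxx/= => /eqP /(IH _ sv) {1}->.
Qed.

(** Invariance under rotation by [p] says that the prefix of length [p] commutes with the remaining
    suffix. *)
Lemma rot_fixed_flatten w p : (p %| size w)%N -> (0 < size w)%N -> rot p w = w ->
  w = flatten (nseq (size w %/ p) (take p w)).
Proof.
move=> pw w0 rw.
have p0 : (0 < p)%N by rewrite (dvdn_gt0 w0).
have pw' : (p <= size w)%N by exact: dvdn_leq.
have st : size (take p w) = p by rewrite size_takel.
have q0 : (0 < size w %/ p)%N by rewrite divn_gt0.
rewrite -{1}(cat_take_drop p w) -(prednK q0)/=; congr (_ ++ _).
apply: commuting_flatten; last by rewrite cat_take_drop -[LHS]rw.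
by rewrite size_drop st -subn1 mulnBl mul1n divnK.
Qed.

Lemma rot_flatten_nseq l J : rot (size l) (flatten (nseq J l)) = flatten (nseq J l).
Proof. by case: J => [//|J] /=; rewrite rot_size_cat cat_flatten_nseq. Qed.

(** The edge closing [l] is the one between two successive copies. *)
Lemma cycle_flatten_nseq (e : rel T) l J : (0 < J)%N ->
  cycle e (flatten (nseq J l)) -> cycle e l.
Proof.
case: J l => [//|J] [//|x l] _ /=.
case: J => [|J] /=; first by rewrite cats0.
by rewrite rcons_cat cat_path /= => /and3P[pl el _]; rewrite rcons_path pl el.
Qed.

End periodic_words.

Section cyclic_classes.
Context (T : choiceType).

Lemma cyclic_word_eqP (u v : seq T) :
  reflect (exists k, v = rot k u)
    (\pi_(cyclic_word T) u == \pi_(cyclic_word T) v).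
Proof.
apply: (iffP eqP) => [/eqmodP/asboolP //|uv].
by apply/eqmodP/asboolP.
Qed.

Lemma cyclic_word_repr (u : seq T) : exists k, repr (\pi_(cyclic_word T) u) = rot k u.
Proof. by apply/cyclic_word_eqP; rewrite reprK. Qed.

End cyclic_classes.

Section loop_words.
Context (d : nat) (D : {fset lattice d}).
Notation N := #|{: D}|.
Notation cword := (cyclic_word (lattice d)).

Definition word m (t : m.-tuple 'I_N) : seq (lattice d) := map (@site d D) t.

Lemma size_word m (t : m.-tuple 'I_N) : size (word t) = m.
Proof. by rewrite size_map size_tuple. Qed.

Lemma word_inj m : injective (@word m).
Proof. by move=> s t /(inj_map (@site_inj d D)) /val_inj. Qed.

Lemma wordP (w : seq (lattice d)) : {subset w <= D} ->
  exists t : (size w).-tuple 'I_N, word t = w.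
Proof.
move=> wD.
have [s sE] : exists s : seq 'I_N, map (@site d D) s = w.
  elim: w wD => [|x w IH] xwD; first by exists [::].
  have [y yw|s <-] := IH; first by apply: xwD; rewrite inE yw orbT.
  have xD : x \in D by apply: xwD; rewrite mem_head.
  by exists (enum_rank [` xD]%fset :: s); rewrite /= site_rank.
have sw : size s == size w by rewrite -sE size_map.
by exists (Tuple sw).
Qed.

Lemma word_in m (t : m.-tuple 'I_N) : {subset word t <= D}.
Proof. by move=> _ /mapP[i _ ->]; exact: site_in. Qed.

(** Rotation by one letter as a permutation of the words of length m: its orbits are the unrooted
    loops of that length, so class sizes are values of [order]. *)
Definition rot1 m (t : m.-tuple 'I_N) : m.-tuple 'I_N := [tuple of rot 1 t].

Lemma iter_rot1 m (t : m.-tuple 'I_N) k : (k <= m)%N -> iter k (@rot1 m) t = rot k t :> seq _.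
Proof.
elim: k => [|k IH] km; first by rewrite rot0.
by rewrite iterS /= IH 1?ltnW// -rotS ?size_tuple.
Qed.

Lemma rot1_inj m : injective (@rot1 m).
Proof. by move=> s t /(congr1 val)/= /rot_inj /val_inj. Qed.

Lemma pi_rot1 m (t : m.-tuple 'I_N) : \pi_cword (word (rot1 t)) = \pi_cword (word t).
Proof.
by apply/esym/eqP/cyclic_word_eqP; exists 1%N; rewrite /word/= map_rot.
Qed.

Lemma pi_iter_rot1 m (t : m.-tuple 'I_N) k :
  \pi_cword (word (iter k (@rot1 m) t)) = \pi_cword (word t).
Proof. by elim: k => [//|k IH]; rewrite iterS pi_rot1. Qed.

Lemma fconnect_rot1P m (s t : m.-tuple 'I_N) :
  fconnect (@rot1 m) s t = (\pi_cword (word s) == \pi_cword (word t)).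
Proof.
apply/idP/idP => [/iter_findex <-|/cyclic_word_eqP[k tE]].
  by rewrite pi_iter_rot1.
have [k' km tE'] : exists2 k', (k' <= m)%N & word t = rot k' (word s).
  have [km|mk] := leqP k m; first by exists k.
  (* [rot] by more than the size is the identity, not a rotation modulo the size. *)
  by exists 0%N => //; rewrite tE rot_oversize ?rot0// size_word ltnW.
suff -> : t = iter k' (@rot1 m) s by exact: fconnect_iter.
by apply/word_inj; rewrite tE' /word iter_rot1// map_rot.
Qed.

Lemma card_class m (t : m.-tuple 'I_N) :
  #|[pred s : m.-tuple 'I_N | \pi_cword (word s) == \pi_cword (word t)]| = order (@rot1 m) t.
Proof.
by apply: eq_card => s; rewrite !inE [RHS]fconnect_rot1P eq_sym.
Qed.

Lemma order_rot1_le m (t : m.-tuple 'I_N) k : (0 < k)%N -> iter k (@rot1 m) t = t ->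
  (order (@rot1 m) t <= k)%N.
Proof.
move=> k0 kt; rewrite leqNgt; apply/negP => ko.
have := findex_iter ko; rewrite kt findex0 => k0'.
by rewrite -k0' in k0.
Qed.

Lemma iter_modn (S : Type) (f : S -> S) x p k : iter p f x = x -> iter k f x = iter (k %% p) f x.
Proof.
move=> px; rewrite {1}(divn_eq k p) addnC iterD; congr (iter _ _ _).
by elim: (k %/ p)%N => [//|q IH]; rewrite mulSn addnC iterD px IH.
Qed.

(** The m-th iterate is the identity, so the remainder of m modulo the order also fixes [t] and must
    be 0 by minimality. *)
Lemma order_rot1_dvd m (t : m.-tuple 'I_N) : (order (@rot1 m) t %| m)%N.
Proof.
set p := order _ _; rewrite /dvdn; case: posnP => // r0.
have mt : iter m (@rot1 m) t = t.
  by apply: val_inj; rewrite /= iter_rot1// rot_oversize// size_tuple.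
have := iter_modn m (iter_order (@rot1_inj m) t); rewrite mt => /esym/(order_rot1_le r0).
by rewrite leqNgt ltn_pmod// order_gt0.
Qed.

Lemma loop_length_word m (t : m.-tuple 'I_N) : loop_length (\pi_cword (word t)) = m.
Proof.
by have [k] := cyclic_word_repr (word t); rewrite /loop_length => ->; rewrite size_rot size_word.
Qed.

(** Let p be the least rotation period. If l^J represents the class, rotation by |l| = m / J fixes
    it, so p <= |l| and J <= m / p. Conversely the word is the (m / p)-th power of its prefix of
    length p. *)
Lemma multiplicity_word m (t : m.-tuple 'I_N) : (0 < m)%N -> cycle (@adj d) (word t) ->
  multiplicity (\pi_cword (word t)) = (m %/ order (@rot1 m) t)%N.
Proof.
move=> m0 ct.
have [p pdef] : exists p, p = order (@rot1 m) t by exists (order (@rot1 m) t).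
have p0 : (0 < p)%N by rewrite pdef; exact: order_gt0.
have pm : (p %| m)%N by rewrite pdef; exact: order_rot1_dvd.
have pm' : (p <= m)%N by exact: dvdn_leq.
rewrite -pdef; set w := word t.
rewrite /multiplicity loop_length_word; apply/eqP; rewrite eqn_leq; apply/andP; split.
  apply/bigmax_leqP => J /asboolP[l [_ /eqP/cyclic_word_eqP[k wE]]].
  have [->//|J0] := posnP J.
  have sJ : (J * size l = m)%N.
    have := congr1 size wE; rewrite size_rot size_word size_flatten /shape map_nseq sumn_nseq.
    by rewrite mulnC.
  have /wordP[t' t'E] : {subset flatten (nseq J l) <= D}.
    by move=> x; rewrite wE mem_rot; exact: word_in.
  have sfl : size (flatten (nseq J l)) = m by rewrite wE size_rot size_word.
  move: t' t'E; rewrite sfl => t' t'E.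
  have tt' : fconnect (@rot1 m) t t'.
    by rewrite fconnect_rot1P t'E; apply/cyclic_word_eqP; exists k.
  have l0 : (0 < size l)%N by case: (size l) sJ m0 => //; rewrite muln0 => <-.
  have pE : p = order (@rot1 m) t'.
    move: tt'; rewrite fconnect_rot1P => /eqP tt'.
    by rewrite pdef -!card_class; apply: eq_card => s; rewrite !inE tt'.
  rewrite leq_divRL//; apply: leq_trans (eq_leq sJ).
  rewrite leq_mul2l pE order_rot1_le ?orbT//.
  apply: word_inj; rewrite /word iter_rot1; last by rewrite -sJ leq_pmull.
  by rewrite map_rot -/(word t') t'E rot_flatten_nseq.
have rw : rot p w = w.
  by rewrite /w /word -map_rot -(iter_rot1 _ pm') pdef iter_order//; exact: rot1_inj.
have w0 : (0 < size w)%N by rewrite size_word.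
have wE : w = flatten (nseq (m %/ p) (take p w)).
  by have := @rot_fixed_flatten _ w p; rewrite size_word; exact.
have q0 : (0 < m %/ p)%N by rewrite divn_gt0.
have qm : (m %/ p < m.+1)%N by rewrite ltnS leq_div.
apply: (bigop.bigmax_sup (Ordinal qm)) => //=; apply/asboolP; exists (take p w); split.
  apply/andP; split; last by apply: (cycle_flatten_nseq q0); rewrite -wE.
  rewrite size_takel ?size_word// ltn_neqAle p0 andbT.
  (* The prefix must be a genuine rooted loop, of length above 1: a period 1 would make a point
     adjacent to itself. *)
  apply/eqP => p1; move: rw ct; rewrite -p1 -/w.
  case: (w) w0 => [//|x [|y v]] _ /=; first by rewrite andbT adj_irrefl.
  by rewrite rot1_cons => -[<-]; rewrite adj_irrefl.
by rewrite -wE.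
Qed.

Definition class_seq m : seq cword :=
  undup [seq \pi_cword (word t) | t <- enum {: m.-tuple 'I_N} & cycle (@adj d) (word t)].

Lemma class_seqP m L : reflect
  (exists2 t : m.-tuple 'I_N, cycle (@adj d) (word t) & L = \pi_cword (word t))
  (L \in class_seq m).
Proof.
rewrite mem_undup; apply: (iffP mapP) => [[t]|[t ct ->]].
  by rewrite mem_filter => /andP[ct _] ->; exists t.
by exists t => //; rewrite mem_filter ct mem_enum.
Qed.

Lemma cycle_pi_word m (s t : m.-tuple 'I_N) : \pi_cword (word s) = \pi_cword (word t) ->
  cycle (@adj d) (word s) = cycle (@adj d) (word t).
Proof.
by move=> /eqP/cyclic_word_eqP[k ->]; rewrite rot_cycle.
Qed.

(* A class of words of length m and multiplicity J has m / J elements. *)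
Lemma sum_class_seq (R : realType) m (g : cword -> R) : (0 < m)%N ->
  \sum_(L <- class_seq m) g L / (multiplicity L)%:R =
  m%:R^-1 * \sum_(t : m.-tuple 'I_N | cycle (@adj d) (word t)) g (\pi_cword (word t)).
Proof.
move=> m0.
transitivity (\sum_(L <- class_seq m) m%:R^-1 *
  \sum_(t : m.-tuple 'I_N | cycle (@adj d) (word t) && (\pi_cword (word t) == L)) g L).
  rewrite !big_seq; apply: eq_bigr => L /class_seqP[t ct ->].
  rewrite (eq_bigl (mem [pred s : m.-tuple 'I_N | \pi_cword (word s) == \pi_cword (word t)])).
    rewrite sumr_const card_class multiplicity_word// -[g _ *+ _]mulr_natl mulrA mulrC.
    congr (_ * _).
    have := order_rot1_dvd t; have := order_gt0 (@rot1 m) t.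
    move: (order _ _) => p p0 pm.
    rewrite -[in RHS](divnK pm) natrM; field.
    by rewrite !pnatr_eq0 -!lt0n p0 divn_gt0// dvdn_leq.
  move=> s; rewrite !inE andb_idl// => /eqP /cycle_pi_word ->; exact: ct.
rewrite -mulr_sumr; congr (_ * _).
rewrite (exchange_big_dep (fun t : m.-tuple 'I_N => cycle (@adj d) (word t)))/=; last first.
  by move=> L t _ /andP[].
apply: eq_bigr => t ct.
rewrite ct/= big_mkcond (bigD1_seq (\pi_cword (word t)))/= ?undup_uniq//; last first.
  by apply/class_seqP; exists t.
rewrite eqxx big1 ?addr0// => L /negbTE nL; by rewrite eq_sym nL.
Qed.

(** The unrooted loops of lengths 2 to n + 1; length 2 comes first because a rooted loop has more
    than one step. *)
Fixpoint loop_seq n : seq cword :=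
  if n is n'.+1 then loop_seq n' ++ class_seq n'.+2 else [::].

Lemma mem_loop_seq n L : L \in loop_seq n -> unrooted_loops D L /\ (loop_length L < n.+2)%N.
Proof.
elim: n => [//|n IH] /=; rewrite mem_cat => /orP[/IH[uL Ln]|/class_seqP[t ct ->]].
  by split => //; exact: ltnW.
split; last by rewrite loop_length_word.
exists (word t) => //; split; last exact: word_in.
by rewrite /rooted_loop size_word.
Qed.

Lemma class_seq_sub m n : (m < n)%N -> {subset class_seq m.+2 <= loop_seq n}.
Proof.
elim: n => [//|n IH]; rewrite ltnS leq_eqVlt => /orP[/eqP ->|mn] L LF /=.
  by rewrite mem_cat LF orbT.
by rewrite mem_cat (IH mn L LF).
Qed.

Lemma loop_seqP L : unrooted_loops D L ->
  forall n, (loop_length L < n.+2)%N -> L \in loop_seq n.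
Proof.
move=> [l [/andP[sl cl] lD] <-].
have [t tl] := wordP lD; rewrite -tl loop_length_word => n.
rewrite -tl in cl; move: (size l) t {tl} cl sl => [//|[//|m]] t ct _.
rewrite !ltnS => mn; apply: (class_seq_sub mn).
by apply/class_seqP; exists t.
Qed.

Lemma uniq_loop_seq n : uniq (loop_seq n).
Proof.
elim: n => [//|n IH] /=; rewrite cat_uniq IH undup_uniq andbT/=.
apply/hasPn => L /class_seqP[t ct ->]; apply/negP => /mem_loop_seq[_].
by rewrite loop_length_word ltnn.
Qed.

End loop_words.

(** * Traces of powers as sums over closed walks *)

Section closed_walks.
Context (R : comNzRingType) (n : nat) (Q : 'M[R]_n).

Fixpoint walk_weight (i : 'I_n) (s : seq 'I_n) : R :=
  if s is j :: s' then Q i j * walk_weight j s' else 1.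

Lemma sum_tupleS (V : nmodType) m (F : m.+1.-tuple 'I_n -> V) :
  \sum_t F t = \sum_i \sum_(t : m.-tuple 'I_n) F [tuple of i :: t].
Proof.
rewrite pair_big/= (reindex (fun p : 'I_n * m.-tuple 'I_n => [tuple of p.1 :: p.2]))//=.
exists (fun t : m.+1.-tuple 'I_n => (thead t, [tuple of behead t])) => [[i t] _|t _].
  by congr pair; apply: val_inj.
by rewrite /= -tuple_eta.
Qed.

Lemma expmx_walk m i j :
  (Q ^+ m) i j = \sum_(t : m.-tuple 'I_n | last i t == j) walk_weight i t.
Proof.
elim: m i j => [|m IH] i j.
  rewrite expr0 mxE big_mkcond (big_pred1 [tuple])/= => [|t]; first by case: eqP.
  by rewrite [t]tuple0; apply/esym/eqP.
rewrite exprS mxE [RHS]big_mkcond [RHS]sum_tupleS; apply: eq_bigr => k _.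
by rewrite IH mulr_sumr big_mkcond.
Qed.

(** A closed walk is encoded by its successive arrival points, so its starting point is the last
    letter; [x0] is the default of [last] on a word that is never empty. *)
Lemma trace_expmx_walk m (x0 : 'I_n) :
  \tr (Q ^+ m.+1) = \sum_(t : m.+1.-tuple 'I_n) walk_weight (last x0 t) t.
Proof.
rewrite /mxtrace; under eq_bigr do rewrite expmx_walk.
rewrite (exchange_big_dep xpredT)//=; apply: eq_bigr => -[[//|i s] si] _ /=.
by rewrite (big_pred1 (last i s))// => j; rewrite eq_sym.
Qed.

End closed_walks.

Section loop_trace.
Context (R : realType) (d : nat) (D : {fset lattice d}).
Notation N := #|{: D}|.
Notation cword := (cyclic_word (lattice d)).
Variable c : lattice d -> R.

(** The factor [c] is charged at the arrival point of each step, so a closed walk collects it once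
    per letter. *)
Definition tilted_mx : 'M[R]_N := step_mx R D *m diag_mx (\row_j c (site j)).

Lemma tilted_mxE i j : tilted_mx i j = step_mx R D i j * c (site j).
Proof.
rewrite mxE (bigD1 j)//= big1 ?addr0; first by rewrite !mxE eqxx.
by move=> k /negbTE kj; rewrite !mxE kj mulr0.
Qed.

Lemma walk_weight_tilted i s : walk_weight tilted_mx i s =
  (2 * d)%:R ^- size s * \prod_(j <- s) c (site j) *
  (path (@adj d) (site i) (map (@site d D) s))%:R.
Proof.
elim: s i => [|j s IH] i /=; first by rewrite big_nil expr0 invr1 !mulr1.
rewrite IH tilted_mxE big_cons mxE -[2 * d%:R]natrM exprS [in RHS]invfM.
by case: (adj _ _); rewrite /= ?mul0r ?mulr0// mul1r; ring.
Qed.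

Lemma sum_loops_trace m : (0 < m)%N ->
  \sum_(L <- class_seq D m)
    ((2 * d)%:R ^- loop_length L / (multiplicity L)%:R) * \prod_(x <- repr L) c x =
  \tr (tilted_mx ^+ m) / m%:R.
Proof.
move=> m0.
under eq_bigr do rewrite mulrAC.
rewrite sum_class_seq// mulrC; congr (_ / _).
case: m m0 => // m _.
(* The trace formula needs an index as default letter; with no index both sides are empty sums. *)
have [x0 _|noi] := pickP 'I_N; last first.
  rewrite [LHS]big1 ?[RHS]big1//; first by move=> i _; have := noi i.
  by move=> t; have := noi (thead t).
rewrite (trace_expmx_walk _ _ x0) big_mkcond; apply: eq_bigr => t _.
rewrite walk_weight_tilted size_tuple loop_length_word.
rewrite (@cycle_path _ (site x0)) /word last_map.
case: (path _ _ _); rewrite ?mulr0// mulr1; congr (_ * _).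
have [k ->] := cyclic_word_repr (word t).
rewrite (perm_big (word t)) ?perm_rot//= /word big_map.
by [].
Qed.

End loop_trace.

(** * Poisson processes *)

Section one_dimensional_integrals.
Context (R : realType).
Notation leb := (@lebesgue_measure R).

Lemma integral_is_derive (f F : R -> R) (a b : R) : a <= b ->
  (forall x, a <= x <= b -> is_derive x 1 F (f x)) ->
  (forall x, a <= x <= b -> {for x, continuous f}) ->
  (\int[leb]_(x in `[a, b]) (f x)%:E = (F b - F a)%:E)%E.
Proof.
rewrite le_eqVlt => /orP[/eqP <-|ab] dF cf.
  by rewrite subrr set_itv1 integral_set1.
have cF x : a <= x <= b -> {for x, continuous F}.
  by move=> /dF [dFx _]; apply/differentiable_continuous/derivable1_diffP.
rewrite (@continuous_FTC2 _ f F a b)//.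
- apply: continuous_in_subspaceT => x; rewrite inE/= in_itv/=; exact: cf.
- split.
  + move=> x; rewrite in_itv/= => /andP[ax xb]; by have [] := dF x; rewrite ?ltW.
  + by apply/cvg_at_right_filter/cF; rewrite lexx ltW.
  + by apply/cvg_at_left_filter/cF; rewrite lexx ltW.
- move=> x; rewrite in_itv/= => /andP[ax xb].
  by rewrite derive1E; have [] := dF x; rewrite ?ltW.
Qed.

Lemma integral_expR_halfline (r : R) : 0 < r ->
  (\int[leb]_(t in `]0%R, +oo[) (expR (- r * t))%:E = (r^-1)%:E)%E.
Proof.
move=> r0.
rewrite integral_itv_obnd_cbnd; last first.
  apply/measurable_EFinP; apply: measurable_funTS.
  by apply: measurableT_comp => //; exact: measurable_funM.
transitivity (\int[leb]_x ((r^-1)%:E * (exponential_pdf r x)%:E))%E.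
  rewrite integral_mulindic; apply: eq_integral => t _.
  rewrite -!EFinM; congr _%:E; rewrite /exponential_pdf patchE indicE.
  by case: ifP => _; rewrite ?mul0r ?mulr0// mul1r mulKf// gt_eqF.
rewrite ge0_integralZl//.
- by rewrite integral_exponential_pdf// mule1.
- by apply/measurable_EFinP; apply: measurable_exponential_pdf.
- by move=> x _; rewrite lee_fin exponential_pdf_ge0// ltW.
- by rewrite lee_fin invr_ge0 ltW.
Qed.

(* (1 - e^(-k t)) / t is the integral of e^(-s t) for s in [0, k]. *)
Lemma frullani (k : R) : 0 <= k ->
  (\int[leb]_(t in `]0%R, +oo[) ((1 - expR (- (k * t))) * (expR (- t) / t))%:E =
   (ln (1 + k))%:E)%E.
Proof.
move=> k0.
(* The indicators of both domains are put into the integrand, so that Tonelli applies on the whole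
   plane. *)
pose F (p : R * R) : \bar R :=
  ((\1_`]0%R, +oo[%classic p.1 * \1_`[0, k]%classic p.2) * expR (- (1 + p.2) * p.1))%:E.
have mF : measurable_fun setT F.
  apply/measurable_EFinP; apply: measurable_funM.
    by apply: measurable_funM; apply: measurableT_comp => //; exact: measurable_indic.
  apply: measurableT_comp => //; apply: measurable_funM => //.
  apply: measurableT_comp => //; exact: measurable_funD.
have F0 p : (0 <= F p)%E by rewrite lee_fin mulr_ge0 ?expR_ge0// mulr_ge0.
transitivity (\int[leb]_t \int[leb]_u F (t, u))%E.
  rewrite integral_mulindic; apply: eq_integral => t _.
  transitivity ((\1_`]0%R, +oo[%classic t)%:E *
      \int[leb]_(u in `[0%R, k]) (expR (- (1 + u) * t))%:E)%E; last first.
    rewrite [in LHS]integral_mulindic -ge0_integralZl//; last first.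
      apply/measurable_EFinP; apply: measurable_funM; first exact: measurable_indic.
      by apply: measurableT_comp => //; apply: measurable_funM => //;
        apply: measurableT_comp => //; exact: measurable_funD.
    by apply: eq_integral => u _; rewrite /F/= -!EFinM mulrA.
  rewrite indicE; have [/set_mem|_] := boolP (t \in _); last by rewrite !mul0e.
  rewrite !mul1e /= in_itv/= andbT => t0.
  have dF (u : R) : is_derive u 1 (fun u : R => - expR (- (1 + u) * t) / t)
      (expR (- (1 + u) * t)).
    have dexp : is_derive u 1 (expR \o (fun u : R => - (1 + u) * t))
        (expR (- (1 + u) * t) * (- t)).
      apply: is_derive1_comp; apply: is_derive_eq.
      by rewrite /GRing.scale/=; ring.
    rewrite (_ : (fun _ => _) = (fun u => (- t^-1) *: (expR \o (fun u : R => - (1 + u) * t)) u)).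
      by apply: is_derive_eq; rewrite /GRing.scale/=; field; rewrite gt_eqF.
    by apply/funext => v; rewrite /GRing.scale/=; ring.
  have cF (u : R) : {for u, continuous (fun u : R => expR (- (1 + u) * t))}.
    apply: (@continuous_comp _ _ _ (fun u : R => - (1 + u) * t) expR).
      apply: cvgM; [apply: cvgN; apply: cvgD; [exact: cvg_cst|exact: cvg_id]|exact: cvg_cst].
    exact: continuous_expR.
  rewrite (integral_is_derive k0 (fun u _ => dF u) (fun u _ => cF u)).
  congr _%:E; rewrite addr0 (_ : - (1 + k) * t = - (k * t) - t); last ring.
  by rewrite expRD mulN1r; field; rewrite gt_eqF.
rewrite fubini_tonelli//.
transitivity (\int[leb]_(u in `[0%R, k]) ((1 + u)^-1)%:E)%E.
  rewrite [RHS]integral_mulindic; apply: eq_integral => u _.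
  transitivity ((\1_`[0%R, k]%classic u)%:E *
      \int[leb]_(t in `]0%R, +oo[) (expR (- (1 + u) * t))%:E)%E.
    rewrite [in RHS]integral_mulindic -ge0_integralZl//; last first.
      apply/measurable_EFinP; apply: measurable_funM; first exact: measurable_indic.
      by apply: measurableT_comp => //; exact: measurable_funM.
    by apply: eq_integral => t _; rewrite /F/= -!EFinM mulrCA mulrA.
  rewrite indicE; have [/set_mem|_] := boolP (u \in _); last by rewrite !mul0e.
  rewrite /= in_itv/= => /andP[u0 _].
  by rewrite integral_expR_halfline// ltr_pwDl.
have dF (u : R) : 0 <= u <= k -> is_derive u 1 (fun u : R => ln (1 + u)) (1 + u)^-1.
  move=> /andP[u0 _]; have u1 : 0 < 1 + u by rewrite ltr_pwDl.
  have dlin : is_derive u 1 (cst 1 + id : R -> R) 1.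
    by apply: is_derive_eq; rewrite add0r.
  have := is_derive1_comp (is_derive1_ln u1) dlin.
  by rewrite mulr1.
have cF (u : R) : 0 <= u <= k -> {for u, continuous (fun u : R => (1 + u)^-1)}.
  move=> /andP[u0 _]; apply: cvgV; first by rewrite gt_eqF// ltr_pwDl.
  by apply: cvgD; [exact: cvg_cst|exact: cvg_id].
by rewrite (integral_is_derive k0 dF cF) addr0 ln1 subr0.
Qed.

End one_dimensional_integrals.

Section exponential_and_poisson.
Context (R : realType) d (Omega : measurableType d) (P : probability Omega R).

Section exponential.
Variable X : {RV P >-> R}.
Hypothesis hX : forall B : set (measurableTypeR R), measurable B ->
  distribution P X B = exponential_prob 1 B.

(** Multiplying the density of rate 1 by exp (- k x) gives 1/(1+k) times the density of rate 1 + k.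
    The maximum is invisible to the density, which vanishes on negative numbers. *)
Lemma exponential_laplace (k : R) : 0 <= k ->
  (\int[P]_w (expR (- (k * Num.max (X w) 0)))%:E = ((1 + k)^-1)%:E)%E.
Proof.
move=> k0.
pose f (x : measurableTypeR R) := (expR (- (k * Num.max x 0)))%:E.
have mf : measurable_fun setT f.
  apply/measurable_EFinP; apply: measurableT_comp => //; apply: measurableT_comp => //.
  by apply: measurable_funM => //; exact: measurable_maxr.
have k1 : 0 < 1 + k by rewrite ltr_pwDl.
transitivity (\int[P]_w (f (X w) * (cst 1%R w)%:E))%E.
  by apply: eq_integral => w _; rewrite mule1.
rewrite (@eq_weighted_law_integral _ _ _ _ _ R _ P (@lebesgue_measure R)
   (X : Omega -> measurableTypeR R) (@idfun (measurableTypeR R)) _ (exponential_pdf 1))//.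
- transitivity (\int[@lebesgue_measure R]_x (((1 + k)^-1)%:E * (exponential_pdf (1 + k) x)%:E))%E.
    apply: eq_integral => x _; rewrite -!EFinM /exponential_pdf; congr _%:E.
    rewrite !patchE; case: ifPn => [|_]; last by rewrite !mulr0.
    rewrite inE/= in_itv/= andbT => x0; rewrite max_l// mul1r mulKf ?gt_eqF//.
    by rewrite -expRD; congr expR; ring.
  rewrite ge0_integralZl//.
  + by rewrite integral_exponential_pdf// mule1.
  + by apply/measurable_EFinP; apply: measurable_exponential_pdf.
  + by move=> x _; rewrite lee_fin exponential_pdf_ge0// ltW.
  + by rewrite lee_fin invr_ge0 ltW.
- exact: measurable_id.
- exact: measurable_exponential_pdf.
- by move=> x; exact: exponential_pdf_ge0.
- move=> B mB; have mXB : measurable (X @^-1` B) by apply: measurable_funPTI.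
  by rewrite [LHS](integral_cst P mXB 1%E) mul1e; exact: hX.
- by move=> x; rewrite lee_fin expR_ge0.
Qed.

Lemma exponential_ge0 : {ae P, forall w, 0 <= X w}.
Proof.
exists (X @^-1` `]-oo, 0[%classic); split.
- by apply: measurable_funPTI; exact: measurable_itv.
- rewrite -[LHS]/(distribution P X `]-oo, 0[%classic) hX//.
  rewrite /exponential_prob integral0_eq// => x; rewrite /= in_itv/= => x0.
  by rewrite lt0_exponential_pdf.
- by move=> w /= /negP; rewrite -ltNge in_itv.
Qed.

End exponential.

(** Rate 0 is covered too: there the law is the Dirac mass at 0, which the formula gives since 0^0 =
    1. *)
Lemma poisson_prob1 (l : R) k : 0 <= l ->
  poisson_prob l 0 [set k] = (l ^+ k / k`!%:R * expR (- l))%:E.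
Proof.
rewrite /poisson_prob le_eqVlt => /orP[/eqP <-|l0].
  rewrite ltxx diracE oppr0 expR0 mulr1 expr0n; case: k => [|k].
    by rewrite mem_set// fact0 divr1.
  by rewrite memNset// mul0r.
rewrite l0 esum_set1; first by rewrite /poisson_pmf l0.
by rewrite lee_fin poisson_pmf_ge0.
Qed.

Lemma poisson_pgf (l r : R) :
  \sum_(k < B) (r ^+ k * (l ^+ k / k`!%:R * expR (- l))) @[B --> \oo] -->
  expR (- (l * (1 - r))).
Proof.
rewrite (_ : - (l * (1 - r)) = r * l - l); last ring.
rewrite expRD (_ : (fun B => _) = (fun B => series (exp_coeff (r * l)) B * expR (- l))).
  by apply: cvgM; [exact: is_cvg_series_exp_coeff|exact: cvg_cst].
apply/funext => B; rewrite /series/= big_mkord mulr_suml; apply: eq_bigr => k _.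
by rewrite /exp_coeff/= exprMn; ring.
Qed.

Section poisson.
Variables (X : Omega -> \bar R) (l : R).
Hypothesis l0 : 0 <= l.
Hypothesis mX : measurable_fun setT X.
Hypothesis Xnat : forall w, X w = +oo%E \/ exists k : nat, X w = k%:R%:E.
Hypothesis PX : forall k : nat, P [set w | X w = k%:R%:E] = poisson_prob l 0 [set k].

Lemma measurable_eq_cst a : measurable [set w | X w = a].
Proof.
rewrite [X in measurable X](_ : _ = setT `&` X @^-1` [set a]); first exact: mX.
by rewrite setTI.
Qed.

Let A k := [set w | X w = k%:R%:E].

Let cvg_sum (r : R) : ((\sum_(k < B) (r ^+ k)%:E * P (A k)) @[B --> \oo] -->
  (expR (- (l * (1 - r))))%:E)%E.
Proof.
rewrite (_ : (fun B => _) = (fun B : nat => (\sum_(k < B) (r ^+ k * (l ^+ k / k`!%:R * expR (- l))))%:E)).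
  by apply: cvg_EFin; [exact: nearW|exact: poisson_pgf].
by apply/funext => B; rewrite -sumEFin; apply: eq_bigr => k _; rewrite PX poisson_prob1// EFinM.
Qed.

(** The generating function at r = 1 shows that the finite values carry total mass 1. *)
Lemma poisson_ae_fin : {ae P, forall w, exists k : nat, X w = k%:R%:E}.
Proof.
have tA : trivIset setT A.
  apply/trivIsetP => i j _ _ ij; apply/seteqP; split => w //= [].
  rewrite /A/= => -> [] /eqP; rewrite eqr_nat => /eqP h; by rewrite h eqxx in ij.
have mA k : measurable (A k) by exact: measurable_eq_cst.
have PU : P (\bigcup_k A k) = 1%E.
  rewrite measure_bigcup//=; apply/cvg_lim => //.
  rewrite [X in X @ _ --> _](_ : _ = (fun B => \sum_(k < B) (1 ^+ k)%:E * P (A k))%E).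
    by have := @cvg_sum 1; rewrite subrr mulr0 oppr0 expR0.
  apply/funext => B; rewrite big_mkord.
  by apply: eq_big => [k|k _]; rewrite ?in_setT// expr1n mul1e.
exists (~` \bigcup_k A k); split.
- by apply: measurableC; exact: bigcupT_measurable.
- rewrite probability_setC; last exact: bigcupT_measurable.
  by rewrite PU subee.
- by apply: subsetC => w [k _ Aw]; exists k.
Qed.

Lemma poisson_laplace (s : R) : 0 <= s ->
  (\int[P]_w (exp_opp (s%:E * X w))%:E = (expR (- (l * (1 - expR (- s)))))%:E)%E.
Proof.
move=> s0; pose r := expR (- s).
have r01 : 0 <= r <= 1 by rewrite expR_ge0 expR_le1 oppr_le0.
have mA k : measurable (A k) by exact: measurable_eq_cst.
pose h (B : nat) w := (\sum_(k < B) (r ^+ k)%:E * (\1_(A k) w)%:E)%E.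
have mh B : measurable_fun setT (h B).
  apply: emeasurable_sum => k; apply: measurable_funeM.
  exact/measurable_EFinP/measurable_indic.
have hE w k B : X w = k%:R%:E -> h B w = ((r ^+ k * (k < B)%N%:R)%:E).
  move=> Xk.
  have iE j : \1_(A j) w = (j == k)%:R :> R.
    rewrite indicE; congr ((nat_of_bool _)%:R); apply/idP/eqP.
      by rewrite inE /A/= Xk => -[/eqP]; rewrite eqr_nat => /eqP.
    by move=> ->; rewrite inE.
  rewrite /h; under eq_bigr do rewrite iE.
  case: ltnP => kB; last first.
    rewrite mulr0 big1// => j _; rewrite ltn_eqF ?mule0//.
    exact: leq_trans (ltn_ord j) kB.
  rewrite (bigD1 (Ordinal kB))//= eqxx mule1 big1 ?adde0 ?mulr1// => j.
  by rewrite -val_eqE/= => /negbTE ->; rewrite mule0.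
have hoo w B : X w = +oo%E -> h B w = 0%E.
  move=> Xw; rewrite /h big1// => k _; rewrite indicE memNset ?mule0//.
  by rewrite /A/= Xw.
have hle w B : (`|h B w| <= 1)%E.
  case: (Xnat w) => [/hoo ->|[k /hE ->]]; first by rewrite abse0.
  have /andP[r0 r1] := r01.
  rewrite lee_fin ger0_norm ?mulr_ge0 ?exprn_ge0//.
  by rewrite mulr_ile1 ?exprn_ge0 ?exprn_ile1// lern1 leq_b1.
have mexp : measurable_fun setT (fun w => (exp_opp (s%:E * X w))%:E).
  apply/measurable_EFinP; apply: (measurableT_comp (@measurable_exp_opp R)).
  exact: measurable_funeM.
have [|||_ _] := @dominated_convergence _ _ _ P _ measurableT h
  (fun w => (exp_opp (s%:E * X w))%:E) (cst 1%E) mh mexp.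
(* Convergence may fail where [X] is infinite: for s = 0 the limit there would be 1, while the
   partial sums are 0. *)
- apply: filterS poisson_ae_fin => w [k Xk] _.
  under eq_fun do rewrite (hE _ _ _ Xk).
  have -> : (exp_opp (s%:E * X w))%:E = (r ^+ k)%:E by rewrite Xk/= -mulNr expRM_natr.
  apply: cvg_near_cst; near=> B; rewrite (_ : (k < B)%N = true) ?mulr1//.
  by near: B; exists k.+1.
- exact: finite_measure_integrable_cst.
- by apply: aeW => w B _ /=; exact: hle.
move/cvg_lim => <- //; apply/cvg_lim => //.
rewrite [X in X @ _ --> _](_ : _ = (fun B => \sum_(k < B) (r ^+ k)%:E * P (A k))%E).
  exact: cvg_sum.
apply/funext => B /=; rewrite /h ge0_integral_sum//.
- apply: eq_bigr => k _; rewrite ge0_integralZl//; first by rewrite integral_indic ?setIT.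
  + exact/measurable_EFinP/measurable_indic.
  + by rewrite lee_fin exprn_ge0// expR_ge0.
- move=> k; apply: measurable_funeM; exact/measurable_EFinP/measurable_indic.
- by move=> k w _; rewrite mule_ge0// lee_fin ?exprn_ge0 ?expR_ge0.
Unshelve. all: by end_near. Qed.

End poisson.
End exponential_and_poisson.

(** * The exponential formula for the one-point loops *)

Section campbell.
Context (R : realType) d (Omega : measurableType d) (P : probability Omega R).
Notation leb := (@lebesgue_measure R).
Import HBNNSimple.

Lemma exp_opp_sum (I : Type) (s : seq I) (F : I -> \bar R) : (forall i, 0 <= F i)%E ->
  exp_opp (\sum_(i <- s) F i)%E = \prod_(i <- s) exp_opp (F i).
Proof.
move=> F0; elim: s => [|i s IH]; first by rewrite !big_nil /= oppr0 expR0.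
by rewrite !big_cons exp_oppD ?IH// sume_ge0.
Qed.

(** At k = 0 and y = +oo both sides are 1, because [0 ^+ 0] is 1 and 0 times +oo is 0. *)
Lemma exp_oppX (y : \bar R) k : (0 <= y)%E -> exp_opp y ^+ k = exp_opp (k%:R%:E * y).
Proof.
case: k => [|k]; first by rewrite expr0 mul0e /= oppr0 expR0.
case: y => [y| |] //= y0; first by rewrite -mulrN expRM_natl.
by rewrite gt0_muley ?lte_fin// expr0n.
Qed.

Variables (alpha : R) (M : R.-ker Omega ~> measurableTypeR R).
Hypothesis alpha0 : 0 <= alpha.
Hypothesis hM : is_poisson_process P (point_loop_intensity alpha) M.

Let dens (t : R) : R := alpha * (expR (- t) / t).

Let nu := @point_loop_intensity R alpha.

Let dens_ge0 t : 0 < t -> 0 <= dens t.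
Proof. by move=> t0; rewrite mulr_ge0// divr_ge0 ?expR_ge0// ltW. Qed.

Let mdens : measurable_fun (`]0, +oo[%classic : set R) dens.
Proof.
apply: open_continuous_measurable_fun; first exact: interval_open.
move=> x; rewrite inE/= in_itv/= andbT => x0.
apply: cvgM; first exact: cvg_cst.
apply: cvgM; last by apply: cvgV; [rewrite gt_eqF|exact: cvg_id].
apply: (@continuous_comp _ _ _ (fun t : R => - t) expR); first by apply: cvgN; exact: cvg_id.
exact: continuous_expR.
Qed.

(** Away from 0 the singular factor 1/t is at most 1/y, and exp (- t) is integrable. Finiteness is
    what gives access to the Poisson law of the count. *)
Let nu_fin (A : set (measurableTypeR R)) (y : R) : measurable A -> 0 < y -> A `<=` [set t | y <= t] ->
  (nu A < +oo)%E.
Proof.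
move=> mA y0 Ay.
have mA0 : measurable (A `&` `]0%R, +oo[) by exact: measurableI.
apply: (@le_lt_trans _ _ (\int[leb]_(t in `]0%R, +oo[) ((alpha / y)%:E * (expR (- 1 * t))%:E))%E).
  apply: (@le_trans _ _ (\int[leb]_(t in A `&` `]0%R, +oo[) ((alpha / y)%:E * (expR (- 1 * t))%:E))%E).
    apply: ge0_le_integral => //.
    - by move=> t [_]; rewrite /= in_itv/= andbT => t0; rewrite lee_fin dens_ge0.
    - by apply/measurable_EFinP; apply: measurable_funS mdens => //; exact: subIsetr.
    - apply: measurable_funTS; apply: measurable_funeM; apply/measurable_EFinP.
      by apply: measurableT_comp => //; exact: measurable_funM.
    - move=> t [/Ay/= yt]; rewrite /= in_itv/= andbT => t0.
      rewrite -EFinM lee_fin mulN1r -mulrA ler_wpM2l// mulrC ler_wpM2r ?expR_ge0//.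
      by rewrite lef_pV2.
  apply: ge0_subset_integral => //.
  - apply: measurable_funTS; apply: measurable_funeM; apply/measurable_EFinP.
    by apply: measurableT_comp => //; exact: measurable_funM.
  - by move=> t _; rewrite -EFinM lee_fin mulr_ge0 ?expR_ge0// divr_ge0// ltW.
rewrite ge0_integralZl//.
- by rewrite integral_expR_halfline// -EFinM ltry.
- apply: measurable_funTS; apply/measurable_EFinP.
  by apply: measurableT_comp => //; exact: measurable_funM.
- by rewrite lee_fin divr_ge0// ltW.
Qed.

Let nu_ge0 A : (0 <= nu A)%E.
Proof.
apply: integral_ge0 => t [_]; rewrite /= in_itv/= andbT => t0.
by rewrite lee_fin dens_ge0.
Qed.

Let nuE A : nu A = (\int[leb]_(t in `]0%R, +oo[) ((\1_A t)%:E * (dens t)%:E))%E.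
Proof.
rewrite /nu /point_loop_intensity integral_mkcondl epatch_indic.
by apply: eq_integral => t _; rewrite muleC.
Qed.

(** The value y = 0 is separate: its level set may have infinite intensity, but its count is
    multiplied by 0. *)
Let poisson_piece (A : set (measurableTypeR R)) (s y : R) : measurable A ->
  0 <= s -> 0 <= y -> (0 < y -> A `<=` [set t | y <= t]) ->
  (\int[P]_w (exp_opp ((s * y)%:E * M w A))%:E =
   (expR (- (fine (nu A) * (1 - expR (- (s * y))))))%:E)%E.
Proof.
move=> mA s0; rewrite le_eqVlt => /orP[/eqP <- _|y0 Ay].
  rewrite mulr0 oppr0 expR0 subrr mulr0 oppr0 expR0.
  under eq_integral do rewrite mul0e /= oppr0 expR0.
  by rewrite integral_cst// mul1e [LHS](probability_setT P).
have [hM1 hM2 _ _] := hM.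
have nuf : nu A = (fine (nu A))%:E by rewrite fineK// ge0_fin_numE ?nu_ge0// (nu_fin mA y0 (Ay y0)).
apply: poisson_laplace.
- by rewrite fine_ge0// nu_ge0.
- exact: measurable_kernel.
- by move=> w; exact: hM1.
- by move=> k; apply: hM2.
- by rewrite mulr_ge0// ltW.
Qed.

(* The level sets of f at positive values have finite intensity, because f t <= t
   keeps them away from 0. *)
Lemma nnsfun_laplace (f : {nnsfun measurableTypeR R >-> R}) (s : R) : 0 <= s ->
  (forall t, f t <= Num.max t 0) ->
  (\int[P]_w (exp_opp (s%:E * \int[M w]_t (f t)%:E))%:E =
   (expR (- fine (\int[leb]_(t in `]0%R, +oo[) ((1 - expR (- (s * f t))) * dens t)%:E)))%:E)%E.
Proof.
move=> s0 ft.
pose r : seq R := fset_set (range f).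
have rP y : (y \in r) = (y \in range f) by rewrite in_fset_set.
pose n := size r.
pose y (i : 'I_n) := nth 0 r i.
pose A i : set (measurableTypeR R) := f @^-1` [set y i].
have mA i : measurable (A i) by exact: measurable_funPTI.
have y0 i : 0 <= y i.
  have : y i \in r by exact: mem_nth.
  by rewrite rP inE => -[t _ <-].
have ytA i : 0 < y i -> A i `<=` [set t | y i <= t].
  move=> yi0 t; rewrite /A/= => fy; have := ft t; rewrite fy.
  rewrite le_max => /orP[//|yi]; by have := lt_le_trans yi0 yi; rewrite ltxx.
have tA : trivIset setT A.
  apply/trivIsetP => i j _ _ ij; apply/seteqP; split => t //= [].
  rewrite /A/= => -> /eqP; rewrite nth_uniq ?fset_uniq// => /eqP/val_inj ij'.
  by rewrite ij' eqxx in ij.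
have [_ _ _ hM4] := hM.
have intE w : (s%:E * \int[M w]_t (f t)%:E = \sum_i (s * y i)%:E * M w (A i))%E.
  rewrite integralT_nnsfun sintegralE fsbig_finite//= (big_nth 0) big_mkord.
  rewrite ge0_sume_distrr; first by apply: eq_bigr => i _; rewrite EFinM muleA.
  by move=> i _; rewrite mule_ge0// lee_fin y0.
transitivity (\int[P]_w (\prod_(i < n) exp_opp ((s * y i)%:E * M w (A i)))%:E)%E.
  apply: eq_integral => w _; rewrite intE exp_opp_sum// => i.
  by rewrite mule_ge0// lee_fin mulr_ge0.
have mul0 i w : (0 <= (s * y i)%:E * M w (A i))%E by rewrite mule_ge0// lee_fin mulr_ge0.
rewrite (@independent_integral_prod R _ _ P _ (fun i => sigma_rv (M ^~ (A i)))).
- rewrite (eq_bigr (fun i => (expR (- (fine (nu (A i)) * (1 - expR (- (s * y i))))))%:E)); last first.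
    by move=> i _; apply: poisson_piece => //; exact: ytA.
  rewrite prodEFin -expR_sum sumrN; congr (expR (- _))%:E.
  transitivity (fine (\sum_i (nu (A i) * (1 - expR (- (s * y i)))%:E)))%E.
    rewrite (eq_bigr (fun i => (fine (nu (A i)) * (1 - expR (- (s * y i))))%:E)).
      by rewrite sumEFin.
    (* At the value 0 the intensity may be infinite, and its product with 1 - exp 0 = 0 is 0 both in
       [\bar R] and after [fine]. *)
    move=> i _; have := y0 i; rewrite le_eqVlt => /orP[/eqP <-|yi].
      by rewrite mulr0 oppr0 expR0 subrr mulr0 mule0.
    by rewrite EFinM fineK// ge0_fin_numE ?nu_ge0// (nu_fin (mA i) yi (ytA i yi)).
  have e0 i : 0 <= 1 - expR (- (s * y i)).
    by rewrite subr_ge0 expR_le1 oppr_le0 mulr_ge0.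
  congr fine; rewrite (eq_bigr (fun i => \int[leb]_(t in `]0%R, +oo[)
     ((1 - expR (- (s * y i)))%:E * ((\1_(A i) t)%:E * (dens t)%:E)))%E); last first.
    move=> i _; rewrite nuE muleC ge0_integralZl//.
    - apply: emeasurable_funM; last exact/measurable_EFinP.
      by apply: measurable_funTS; exact/measurable_EFinP/measurable_indic.
    - move=> t; rewrite /= in_itv/= andbT => t0.
      by rewrite -EFinM lee_fin mulr_ge0// dens_ge0.
    - by rewrite lee_fin e0.
  pose G i (t : measurableTypeR R) := ((1 - expR (- (s * y i)))%:E * ((\1_(A i) t)%:E * (dens t)%:E))%E.
  have mG i : measurable_fun (`]0, +oo[%classic : set (measurableTypeR R)) (G i).
    apply: emeasurable_funM => //; apply: emeasurable_funM; last exact/measurable_EFinP.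
    by apply: measurable_funTS; exact/measurable_EFinP/measurable_indic.
  have G0 i t : `]0, +oo[%classic t -> (0 <= G i t)%E.
    rewrite /= in_itv/= andbT => t0.
    by rewrite /G -!EFinM lee_fin mulr_ge0 ?e0// mulr_ge0 ?dens_ge0.
  have mpos : measurable (`]0, +oo[%classic : set (measurableTypeR R)) by exact: measurable_itv.
  apply: etrans (esym (ge0_integral_sum leb mpos mG G0 _)) _.
  apply: eq_integral => t _; rewrite /G.
  have [i fi] : exists i : 'I_n, f t = y i.
    have tr : f t \in r by rewrite rP inE; exists t.
    have ti : (index (f t) r < n)%N by rewrite index_mem.
    by exists (Ordinal ti); rewrite /y/= nth_index.
  rewrite (bigD1 i)//= big1 ?adde0.
    by rewrite indicE mem_set// mul1e -EFinM fi.
  move=> j ji; rewrite indicE memNset ?mul0e ?mule0// /A/= fi => /eqP.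
  by rewrite nth_uniq ?fset_uniq// => /eqP/val_inj ij; rewrite ij eqxx in ji.
- exact: hM4.
- by move=> i B [C mC <-]; exact: (measurable_kernel M (A i) (mA i)).
- exact: index_enum_uniq.
- move=> i B _ mB.
  have mg : measurable_fun setT (fun z : \bar R => exp_opp ((s * y i)%:E * z)).
    by apply: (measurableT_comp (@measurable_exp_opp R)); exact: measurable_funeM.
  exists ((fun z : \bar R => exp_opp ((s * y i)%:E * z)) @^-1` B) => //.
    by rewrite -[X in measurable X]setTI; exact: mg.
  by rewrite setTI.
- by move=> i w; exact: exp_opp01.
Qed.

(** Simple functions increase to t. On the probability side dominated convergence uses the
    continuity of [exp_opp], up to +oo; on the intensity side convergence is monotone, and
    Frullani's integral evaluates the limit. *)
Lemma campbell k :
  (\int[P]_w (exp_opp (\int[M w]_(t in `]0%R, +oo[) t%:E) ^+ k)%:E =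
   (expR (- (alpha * ln (1 + k%:R))))%:E)%E.
Proof.
pose g (t : measurableTypeR R) : \bar R := (Num.max t 0)%:E.
have mg : measurable_fun setT g by apply/measurable_EFinP; exact: measurable_maxr.
have g0 t : (0 <= g t)%E by rewrite lee_fin le_max lexx orbT.
pose f n := nnsfun_approx measurableT mg n.
have fg n t : f n t <= Num.max t 0.
  by rewrite -lee_fin /f nnsfun_approxE; exact: le_approx.
have f_nd t : {homo (fun n => f n t) : m n / (m <= n)%N >-> m <= n}.
  by move=> m n mn; exact/lefP/nd_nnsfun_approx.
have cf t : (f n t)%:E @[n --> \oo] --> g t.
  exact: cvg_nnsfun_approx.
have TE w : (\int[M w]_(t in `]0%R, +oo[) t%:E = \int[M w]_t g t)%E.
  rewrite integral_mulindic; apply: eq_integral => t _.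
  rewrite indicE /g; have [/set_mem|/negP] := boolP (t \in _).
    by rewrite /= in_itv/= andbT mul1e => t0; rewrite max_l// ltW.
  rewrite inE/= in_itv/= andbT => /negP; rewrite -leNgt mul0e => t0.
  by rewrite max_r.
have T0 w : (0 <= \int[M w]_t g t)%E by exact: integral_ge0.
have mT : measurable_fun setT (fun w => \int[M w]_t g t)%E.
  by apply: measurable_fun_integral_kernel => // U mU; exact: measurable_kernel.
have cT w : (\int[M w]_t (f n t)%:E)%E @[n --> \oo] --> (\int[M w]_t g t)%E.
  rewrite (_ : (\int[M w]_t g t = \int[M w]_t limn (fun n => (f n t)%:E))%E).
    apply: (@cvg_monotone_convergence _ _ _ (M w) _ measurableT (fun n t => (f n t)%:E)).
    - by move=> n; apply/measurable_EFinP.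
    - by move=> n t _; rewrite lee_fin.
    - by move=> t _ m n mn; rewrite lee_fin; exact: f_nd.
  by apply: eq_integral => t _; apply/esym/cvg_lim => //; exact: cf.
transitivity (\int[P]_w (exp_opp (k%:R%:E * \int[M w]_t g t))%:E)%E.
  by apply: eq_integral => w _; rewrite -TE -exp_oppX// TE.
have k0 : 0 <= k%:R :> R by [].
have cL : (\int[P]_w (exp_opp (k%:R%:E * \int[M w]_t (f n t)%:E))%:E)%E @[n --> \oo] -->
    (\int[P]_w (exp_opp (k%:R%:E * \int[M w]_t g t))%:E)%E.
  have If0 n w : (0 <= \int[M w]_t (f n t)%:E)%E by apply: integral_ge0 => t _; rewrite lee_fin.
  have [|||||_ _] := @dominated_convergence _ _ _ P _ measurableT
    (fun n w => (exp_opp (k%:R%:E * \int[M w]_t (f n t)%:E))%:E)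
    (fun w => (exp_opp (k%:R%:E * \int[M w]_t g t))%:E) (cst 1%E); last exact.
  - move=> n; apply/measurable_EFinP; apply: (measurableT_comp (@measurable_exp_opp R)).
    apply: measurable_funeM; apply: measurable_fun_integral_kernel.
    + by move=> U mU; exact: measurable_kernel.
    + by move=> t; rewrite lee_fin.
    + exact/measurable_EFinP.
  - apply/measurable_EFinP; apply: (measurableT_comp (@measurable_exp_opp R)).
    exact: measurable_funeM.
  - apply: aeW => w _; apply: cvg_EFin; first exact: nearW.
    apply: cvg_exp_opp; first by rewrite mule_ge0// lee_fin.
    by apply: cvgeZl.
  - exact: finite_measure_integrable_cst.
  - apply: aeW => w n _ /=; rewrite lee_fin ger0_norm ?exp_opp_ge0//.
    by rewrite exp_opp_le1// mule_ge0// lee_fin.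
have mpos : measurable (`]0, +oo[%classic : set (measurableTypeR R)) by exact: measurable_itv.
pose G n (t : measurableTypeR R) := ((1 - expR (- (k%:R * f n t))) * dens t)%:E.
have mG n : measurable_fun (`]0, +oo[%classic : set (measurableTypeR R)) (G n).
  apply/measurable_EFinP; apply: measurable_funM => //; apply: measurable_funTS.
  apply: measurable_funB => //; apply: measurableT_comp => //.
  by apply: measurableT_comp => //; exact: measurable_funM.
have G0 n t : `]0, +oo[%classic t -> (0 <= G n t)%E.
  rewrite /= in_itv/= andbT => t0.
  by rewrite lee_fin mulr_ge0 ?dens_ge0// subr_ge0 expR_le1 oppr_le0 mulr_ge0.
have G_nd t : `]0, +oo[%classic t -> {homo (fun n => G n t) : m n / (m <= n)%N >-> (m <= n)%E}.
  rewrite /= in_itv/= andbT => t0 m n mn.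
  rewrite lee_fin ler_wpM2r ?dens_ge0// lerB// ler_expR lerN2 ler_wpM2l//.
  exact: f_nd.
have IE : (\int[leb]_(t in `]0%R, +oo[) limn (fun n => G n t) = (alpha * ln (1 + k%:R))%:E)%E.
  transitivity (\int[leb]_(t in `]0%R, +oo[)
      (alpha%:E * ((1 - expR (- (k%:R * t))) * (expR (- t) / t))%:E))%E.
    apply: eq_integral => t /set_mem; rewrite /= in_itv/= andbT => t0.
    apply/cvg_lim => //; rewrite -EFinM mulrCA -/(dens t).
    apply: cvg_EFin; first exact: nearW.
    apply: cvgM; last exact: cvg_cst.
    apply: cvgB; first exact: cvg_cst.
    apply: (@cvg_comp _ _ _ (fun n => - (k%:R * f n t)) expR _ (nbhs (- (k%:R * t)))).
      apply: cvgN; apply: cvgM; first exact: cvg_cst.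
      by have /fine_cvgP[_] := cf t; rewrite /g max_l// ltW.
    exact: continuous_expR.
  rewrite ge0_integralZl//.
  - by rewrite frullani// EFinM.
  - have mdens1 : measurable_fun (`]0, +oo[%classic : set R) (fun t : R => expR (- t) / t).
      apply: open_continuous_measurable_fun; first exact: interval_open.
      move=> x; rewrite inE/= in_itv/= andbT => x0.
      apply: cvgM; last by apply: cvgV; [rewrite gt_eqF|exact: cvg_id].
      apply: (@continuous_comp _ _ _ (fun t : R => - t) expR); first by apply: cvgN; exact: cvg_id.
      exact: continuous_expR.
    apply/measurable_EFinP; apply: measurable_funM => //; apply: measurable_funTS.
    apply: measurable_funB => //; apply: measurableT_comp => //.
    by apply: measurableT_comp => //; exact: measurable_funM.
  - move=> t; rewrite /= in_itv/= andbT => t0.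
    rewrite lee_fin mulr_ge0 ?divr_ge0 ?expR_ge0 ?(ltW t0)//.
    by rewrite subr_ge0 expR_le1 oppr_le0 mulr_ge0// ltW.
have cR : (expR (- fine (\int[leb]_(t in `]0%R, +oo[) G n t)%E))%:E @[n --> \oo] -->
    (expR (- (alpha * ln (1 + k%:R))))%:E.
  apply: cvg_EFin; first exact: nearW.
  apply: (@cvg_comp _ _ _ (fun n => - fine (\int[leb]_(t in `]0%R, +oo[) G n t)%E) expR _
    (nbhs (- (alpha * ln (1 + k%:R))))); last exact: continuous_expR.
  apply: cvgN.
  have := @cvg_monotone_convergence _ _ _ leb _ mpos G mG G0 G_nd.
  by rewrite IE => /fine_cvgP[].
transitivity (\int[P]_w (exp_opp (k%:R%:E * \int[M w]_t g t))%:E)%E.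
  by apply: eq_integral => w _; rewrite -TE -exp_oppX// TE.
move/cvg_lim : cL => <- //; apply/cvg_lim => //.
rewrite [X in X @ _ --> _](_ : _ = (fun n =>
   (expR (- fine (\int[leb]_(t in `]0%R, +oo[) G n t)%E))%:E))//.
by apply/funext => n; rewrite nnsfun_laplace.
Qed.

End campbell.

(** * The occupation times of the loop soup *)

Section esum_lemmas.
Context (R : realType) (T : choiceType).
Local Open Scope ereal_scope.

(** [esum] is a supremum over finite subsets, and negative terms can be left out of a subset. Hence
    the occupation time is nonnegative and measurable even where some waiting times are negative. *)
Lemma esum_maxe0 (S : set T) (a : T -> \bar R) :
  \esum_(i in S) a i = \esum_(i in S) maxe (a i) 0.
Proof.
apply/eqP; rewrite eq_le; apply/andP; split.
  by apply: le_esum => i _; rewrite le_max lexx.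
apply: ge_ereal_sup => _ [X [finX XS] <-].
pose Y := X `&` [set i | 0 <= a i].
have finY : finite_set Y by exact: finite_setIl.
apply: esum_ge; exists Y; first by split => // i [/XS].
rewrite [leRHS]fsbig_mkcondr [leRHS](_ : _ = \sum_(i \in X) maxe (a i) 0)//.
apply: eq_fsbigr => i _; case: ifPn => [/set_mem|/negP ai].
  by move=> ai; apply/esym/max_idPl.
by apply/esym/max_idPr; rewrite leNgt; apply/negP => /ltW ai'; apply: ai; rewrite inE.
Qed.

(** Replaces a supremum over all finite subsets by a sequential limit, as measurability and
    dominated convergence require. *)
Lemma cvg_esum_exhaust (S : set T) (a : T -> \bar R) (F : nat -> seq T) :
  (forall i, 0 <= a i) -> (forall n, uniq (F n)) ->
  (forall m n, (m <= n)%N -> {subset F m <= F n}) ->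
  (forall n i, i \in F n -> S i) -> (forall i, S i -> exists n, i \in F n) ->
  \sum_(i <- F n) a i @[n --> \oo] --> \esum_(i in S) a i.
Proof.
move=> a0 uF ndF FS SF.
have sumE n : \sum_(i <- F n) a i = \sum_(i \in [set` F n]) a i by rewrite -fsbig_seq.
have -> : \esum_(i in S) a i = ereal_sup (range (fun n => \sum_(i <- F n) a i)).
  apply/eqP; rewrite eq_le; apply/andP; split.
    apply: ge_ereal_sup => _ [X [finX XS] <-].
    have [n Xn] : exists n, X `<=` [set` F n].
      have /finite_seqP[s sX] := finX.
      have {}XS : forall i, i \in s -> S i by move=> i si; apply: XS; rewrite sX.
      rewrite sX; elim: s {sX} XS => [|i s IH] XS; first by exists 0%N.
      have [|n sn] := IH; first by move=> j js; apply: XS; rewrite inE js orbT.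
      have [m im] := SF _ (XS i (mem_head _ _)).
      exists (maxn m n) => j /=; rewrite inE => /predU1P[->|js].
        by apply: ndF im; exact: leq_maxl.
      by apply: (ndF n); [exact: leq_maxr|exact: sn].
    apply: (@le_trans _ _ (\sum_(i <- F n) a i)); last by apply: ereal_sup_ubound; exists n.
    rewrite sumE; apply: lee_fsum_nneg_subset => //.
    by move=> i; rewrite !inE; exact: Xn.
  apply: ge_ereal_sup => _ [n _ <-]; apply: esum_ge.
  exists [set` F n]; last by rewrite sumE.
  by split => // i /=; exact: FS.
apply: ereal_nondecreasing_cvgn => m n mn; rewrite !sumE.
apply: lee_fsum_nneg_subset => //.
by move=> i; rewrite !inE; exact: ndF.
Qed.

End esum_lemmas.

Section occupation_measurability.
Context (R : realType) (d : nat) (D : {fset lattice d}).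
Context d' (Omega : measurableType d') (P : probability Omega R).
Variables (N : R.-ker Omega ~> cyclic_word (lattice d))
  (tau : cyclic_word (lattice d) -> nat -> nat -> {RV P >-> R})
  (M : D -> R.-ker Omega ~> measurableTypeR R).
Local Open Scope ereal_scope.

Lemma measurable_integral_id d1 (O : measurableType d1)
    (K : O -> {measure set (measurableTypeR R) -> \bar R}) :
  (forall A, measurable A -> measurable_fun setT (K ^~ A)) ->
  measurable_fun setT (fun w => \int[K w]_(t in `]0%R, +oo[) t%:E).
Proof.
move=> mK; under eq_fun do rewrite integral_mulindic.
apply: measurable_fun_integral_kernel => //.
- move=> t; rewrite indicE; have [/set_mem|_] := boolP (t \in _); last by rewrite mul0e.
  by rewrite /= in_itv/= andbT mul1e lee_fin => /ltW.
- apply: emeasurable_funM; last exact/measurable_EFinP.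
  exact/measurable_EFinP/measurable_indic.
Qed.

Definition step_time (x : D) (L : cyclic_word (lattice d)) (k : nat) (w : Omega) : R :=
  (\sum_(j < loop_length L | nth 0%R (repr L) j == val x) tau L k j w)%R.

Definition loop_time (x : D) (w : Omega) : \bar R :=
  \esum_(L in unrooted_loops D)
    \esum_(k in [set k : nat | k%:R%:E < N w [set L]]) (step_time x L k w)%:E.

Lemma occupation_timeE x w : occupation_time N tau M x w =
  loop_time x w + \int[M x w]_(t in `]0%R, +oo[) t%:E.
Proof. by []. Qed.

Lemma loop_time_ge0 x w : 0 <= loop_time x w.
Proof.
apply: esum_ge0 => L _; rewrite esum_maxe0; apply: esum_ge0 => k _.
by rewrite le_max lexx orbT.
Qed.

Lemma integral_id_ge0 (K : {measure set (measurableTypeR R) -> \bar R}) :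
  0 <= \int[K]_(t in `]0%R, +oo[) t%:E.
Proof. by apply: integral_ge0 => t; rewrite /= in_itv/= andbT lee_fin => /ltW. Qed.

Lemma cvg_loop_time x w :
  \sum_(L <- loop_seq D n) \esum_(k in [set k : nat | k%:R%:E < N w [set L]])
     (step_time x L k w)%:E @[n --> \oo] --> loop_time x w.
Proof.
apply: cvg_esum_exhaust.
- move=> L; rewrite esum_maxe0; apply: esum_ge0 => k _; by rewrite le_max lexx orbT.
- exact: uniq_loop_seq.
- move=> m n mn L; have [k ->] : exists k, n = (m + k)%N by exists (n - m)%N; rewrite subnKC.
  by elim: k => [|k IH]; rewrite ?addn0// addnS /= mem_cat => /IH ->.
- by move=> n L /mem_loop_seq[].
- move=> L UL; exists (loop_length L); apply: loop_seqP => //; exact: leqnSn.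
Qed.

Lemma measurable_esum_step_time x L : measurable_fun setT
  (fun w => \esum_(k in [set k : nat | k%:R%:E < N w [set L]]) (step_time x L k w)%:E).
Proof.
(* The index set depends on [w]; it is moved into the summand so that the sum runs over all
   integers. *)
pose h k w := if k%:R%:E < N w [set L] then maxe (step_time x L k w)%:E 0 else 0.
have h0 k w : 0 <= h k w by rewrite /h; case: ifP => // _; rewrite le_max lexx orbT.
apply: (emeasurable_fun_cvg (fun n w => \sum_(k <- iota 0 n) h k w)); last first.
  move=> w _; rewrite esum_maxe0 esum_mkcond.
  rewrite (eq_esum (b := h^~ w)); last first.
    by move=> k _; rewrite /h; case: ifPn => [/set_mem/= ->//|/negP]; case: ifP => // kN [];
      rewrite inE.
  apply: cvg_esum_exhaust => //.
  - by move=> m; exact: iota_uniq.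
  - by move=> m p mp k; rewrite !mem_iota !add0n => /andP[_ km]; exact: leq_trans mp.
  - by move=> k _; exists k.+1; rewrite mem_iota/= add0n.
move=> m; apply: emeasurable_sum => k.
apply: measurable_fun_ifT => //.
  apply: measurable_fun_lte => //.
  exact: measurable_kernel.
apply: measurable_maxe => //; apply/measurable_EFinP.
by rewrite /step_time; under eq_fun do rewrite big_mkcond; apply: measurable_sum => j;
  case: (nth 0%R (repr L) j == val x).
Qed.

Lemma measurable_loop_time x : measurable_fun setT (loop_time x).
Proof.
apply: (emeasurable_fun_cvg (fun n w => \sum_(L <- loop_seq D n)
   \esum_(k in [set k : nat | k%:R%:E < N w [set L]]) (step_time x L k w)%:E)); last first.
  by move=> w _; exact: cvg_loop_time.
by move=> n; apply: emeasurable_sum => L; exact: measurable_esum_step_time.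
Qed.

Lemma measurable_occupation_time x : measurable_fun setT (occupation_time N tau M x).
Proof.
apply: emeasurable_funD; first exact: measurable_loop_time.
by apply: measurable_integral_id => A mA; exact: measurable_kernel.
Qed.

Lemma occupation_time_ge0 x w : 0 <= occupation_time N tau M x w.
Proof. by rewrite adde_ge0// ?loop_time_ge0// integral_id_ge0. Qed.

End occupation_measurability.

(** * Expectations for prescribed numbers of copies *)

Section soup_blocks.
Context (R : realType) (d : nat) (D : {fset lattice d}).
Context d' (Omega : measurableType d') (P : probability Omega R).
Variables (N : R.-ker Omega ~> cyclic_word (lattice d))
  (tau : cyclic_word (lattice d) -> nat -> nat -> {RV P >-> R})
  (M : D -> R.-ker Omega ~> measurableTypeR R).
Hypothesis hsoup : is_loop_soup N tau M 2^-1.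
Variable k : D -> nat.
Notation cword := (cyclic_word (lattice d)).

Definition site_cost : lattice d -> R := extend0 (fun x : D => (k x)%:R : R).

Lemma site_cost_ge0 x : 0 <= site_cost x.
Proof. by rewrite /site_cost /extend0; case: insub => //= y; exact: ler0n. Qed.

(* The waiting times are nonnegative only almost surely, whence the maximum. *)
Definition step_factor (L : cword) (kk j : nat) (w : Omega) : R :=
  expR (- (site_cost (nth 0 (repr L) j) * Num.max (tau L kk j w) 0)).

Definition point_factor (x : D) (w : Omega) : R :=
  exp_opp (\int[M x w]_(t in `]0%R, +oo[) t%:E)%E ^+ k x.

Definition mean_factor (L : cword) : R :=
  \prod_(j < loop_length L) (1 + site_cost (nth 0 (repr L) j))^-1.

Definition loop_weight (L : cword) : R :=
  (2 * d)%:R ^- loop_length L / (multiplicity L)%:R.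

Lemma loop_weight_ge0 L : 0 <= loop_weight L.
Proof. by rewrite divr_ge0// invr_ge0 exprn_ge0. Qed.

Lemma step_factor01 L kk j w : 0 <= step_factor L kk j w <= 1.
Proof.
rewrite expR_ge0/= expR_le1 oppr_le0 mulr_ge0 ?site_cost_ge0//.
by rewrite le_max lexx orbT.
Qed.

Lemma point_factor01 x w : 0 <= point_factor x w <= 1.
Proof.
rewrite exprn_ge0 ?exp_opp_ge0//= exprn_ile1 ?exp_opp_ge0 ?exp_opp_le1//.
exact: integral_id_ge0.
Qed.

Lemma integral_step_factor L kk j :
  (\int[P]_w (step_factor L kk j w)%:E = ((1 + site_cost (nth 0%R (repr L) j))^-1)%:E)%E.
Proof.
have [_ htau _ _] := hsoup.
by apply: exponential_laplace; [exact: htau|exact: site_cost_ge0].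
Qed.

Lemma integral_point_factor x :
  (\int[P]_w (point_factor x w)%:E = (expR (- (2^-1 * ln (1 + (k x)%:R))))%:E)%E.
Proof.
have [_ _ hM _] := hsoup.
by apply: campbell; [rewrite invr_ge0|exact: hM].
Qed.

Lemma measurable_count (L : cword) : measurable_fun setT (fun w => N w [set L]).
Proof. by apply: measurable_kernel. Qed.

Lemma count_law L : unrooted_loops D L -> forall m : nat,
  P [set w | N w [set L] = m%:R%:E] = poisson_prob (2^-1 * loop_weight L) 0 [set m].
Proof.
move=> UL m; have [[_ hN _ _] _ _ _] := hsoup; apply: hN => //.
rewrite /loop_measure (_ : [set L] `&` _ = [set L]); last first.
  by apply/seteqP; split => [L' []|L' ->].
by rewrite esum_set1 ?lee_fin ?loop_weight_ge0.
Qed.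

Lemma sub_soup_sigma i B : soup_sigma N tau M i B -> measurable B.
Proof.
have ker dT (T : measurableType dT) (K : R.-ker Omega ~> T) : sigma_kernel K B -> measurable B.
  apply: smallest_sub; first exact: sigma_algebra_measurable.
  by move=> _ [A mA [C mC <-]]; exact: (measurable_kernel K A mA).
case: i => [[_|[[L kk] j]]|x] /=; [exact: ker| |exact: ker].
by move=> [C mC <-]; exact: measurable_funP.
Qed.

Section finite_family.
Variable Ls : seq cword.
Hypothesis uLs : uniq Ls.
Hypothesis ULs : forall L, L \in Ls -> unrooted_loops D L.
Notation sz := (size Ls).
Let Li (i : 'I_sz) : cword := tnth (in_tuple Ls) i.

Let Li_inj : injective Li. Proof. by apply/tuple_uniqP. Qed.

Definition count_event (f : 'I_sz -> nat) : set Omega :=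
  \big[setI/setT]_(i < sz) [set w | N w [set Li i] = (f i)%:R%:E].

Let sigma_count i m : sigma_rv (N ^~ [set Li i]) [set w | N w [set Li i] = m%:R%:E].
Proof. by exists [set m%:R%:E]; [exact: emeasurable_set1|rewrite setTI]. Qed.

Lemma count_event_sigma f : sigma_kernel N (count_event f).
Proof.
pose G : set (set Omega) := \bigcup_(A in measurable) sigma_rv (N ^~ A).
suff : @measurable _ (g_sigma_algebraType G) (count_event f) by [].
rewrite /count_event; elim/big_ind: _ => [|A B mA mB|i _]; first exact: measurableT.
  exact: measurableI.
by apply: sub_sigma_algebra; exists [set Li i].
Qed.

Lemma count_event_prob f : (P (count_event f) =
  \prod_(i < sz) P [set w | N w [set Li i] = (f i)%:R%:E])%E.
Proof.
have [[_ _ _ hN] _ _ _] := hsoup.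
apply: (hN sz (fun i => [set Li i])) => //.
- apply/trivIsetP => i j _ _ ij; apply/seteqP; split => L //= [-> /Li_inj ij'].
  by rewrite ij' eqxx in ij.
- exact: index_enum_uniq.
- by move=> i _; exact: sigma_count.
Qed.

Let steps (f : 'I_sz -> nat) : seq (cword * nat * nat) :=
  [seq (Li q.1, q.2, j) | q <- [seq (i, kk) | i <- enum 'I_sz, kk <- iota 0 (f i)],
                          j <- iota 0 (loop_length (Li q.1))].

Let prod_steps (V : comPzSemiRingType) f (G : cword * nat * nat -> V) :
  \prod_(p <- steps f) G p =
  \prod_(i < sz) \prod_(kk < f i) \prod_(j < loop_length (Li i)) G (Li i, kk : nat, j : nat).
Proof.
rewrite /steps big_allpairs_dep big_allpairs_dep big_enum; apply: eq_bigr => i _ /=.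
have iotaE a : iota 0 a = index_iota 0 a by rewrite /index_iota subn0.
by rewrite iotaE big_mkord; apply: eq_bigr => kk _; rewrite iotaE big_mkord.
Qed.

Let uniq_steps f : uniq (steps f).
Proof.
apply: allpairs_uniq_dep.
- apply: allpairs_uniq_dep; [exact: enum_uniq|by move=> *; exact: iota_uniq|].
  by move=> [i a] [j b] _ _ [-> ->].
- by move=> *; exact: iota_uniq.
- by move=> [[i a] b] [[j a'] b'] _ _ /= [/Li_inj -> -> ->].
Qed.

Let sfac (f : 'I_sz -> nat) (i : unit + cword * nat * nat + D) : Omega -> R :=
  match i with
  | inl (inl _) => \1_(count_event f)
  | inl (inr (L, kk, j)) => step_factor L kk j
  | inr x => point_factor x
  end.

Let sfac_sigma f i B : measurable B -> soup_sigma N tau M i (sfac f i @^-1` B).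
Proof.
case: i => [[_|[[L kk] j]]|x] mB /=.
(* [Omega] is given the smaller sigma-algebra generated by the counts, so that ordinary
   measurability statements express membership in [sigma_kernel N]. *)
- pose G : set (set Omega) := \bigcup_(A in measurable) sigma_rv (N ^~ A).
  have m1 : measurable_fun setT (\1_(count_event f) : g_sigma_algebraType G -> R).
    by apply: measurable_indic; exact: count_event_sigma.
  by have := m1 measurableT B mB; rewrite setTI.
- exists ((fun t : R => expR (- (site_cost (nth 0 (repr L) j) * Num.max t 0))) @^-1` B).
    rewrite -[X in measurable X]setTI.
    suff mf : measurable_fun setT (fun t : R => expR (- (site_cost (nth 0 (repr L) j) * Num.max t 0))) by exact: mf.
    apply: measurableT_comp => //; apply: measurableT_comp => //.
    by apply: measurable_funM => //; exact: measurable_maxr.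
  by rewrite setTI.
- pose G : set (set Omega) := \bigcup_(A in measurable) sigma_rv (M x ^~ A).
  have m1 : measurable_fun setT (point_factor x : g_sigma_algebraType G -> R).
    apply: measurable_funX; apply: (measurableT_comp (@measurable_exp_opp R)).
    apply: (@measurable_integral_id R _ (g_sigma_algebraType G) (M x)) => A mA _ C mC.
    rewrite setTI; apply: sub_sigma_algebra; exists A => //.
    by exists C => //; rewrite setTI.
  by have := m1 measurableT B mB; rewrite setTI.
Qed.

(** Once the counts are fixed, finitely many waiting times occur. The indicator of the counts, these
    times and the point processes are functions of distinct independent blocks. *)
Lemma integral_count_event f :
  (\int[P]_w (\1_(count_event f) w *
     (\prod_(i < sz) \prod_(kk < f i) \prod_(j < loop_length (Li i)) step_factor (Li i) kk j w)
     * \prod_x point_factor x w)%:E =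
   (\prod_(i < sz) (P [set w | N w [set Li i] = (f i)%:R%:E] * (mean_factor (Li i) ^+ f i)%:E))
   * (\prod_x expR (- (2^-1 * ln (1 + (k x)%:R))))%:E)%E.
Proof.
have [_ _ _ hind] := hsoup.
pose s : seq (unit + cword * nat * nat + D) :=
  inl (inl tt) :: [seq inl (inr p) | p <- steps f] ++ [seq inr x | x <- index_enum [the finType of D : Type]].
have us : uniq s.
  rewrite /s /= mem_cat negb_or; apply/andP; split.
  - by apply/andP; split; apply/negP => /mapP[].
  - rewrite cat_uniq; apply/and3P; split.
    + by rewrite map_inj_uniq => [|? ? []]; [exact: uniq_steps|].
    + by apply/hasPn => _ /mapP[x _ ->]; apply/negP => /mapP[].
    + by rewrite map_inj_uniq => [|? ? []]; [exact: index_enum_uniq|].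
have prods (V : comPzSemiRingType) (G : _ -> V) : \prod_(i <- s) G i =
  G (inl (inl tt)) *
  ((\prod_(i < sz) \prod_(kk < f i) \prod_(j < loop_length (Li i)) G (inl (inr (Li i, kk : nat, j : nat))))
   * \prod_x G (inr x)).
  by rewrite /s big_cons big_cat !big_map prod_steps.
pose r (i : unit + cword * nat * nat + D) : R := match i with
  | inl (inl _) => fine (P (count_event f))
  | inl (inr (L, kk, j)) => (1 + site_cost (nth 0 (repr L) j))^-1
  | inr x => expR (- (2^-1 * ln (1 + (k x)%:R)))
  end.
have mc : measurable (count_event f) by exact: (@sub_soup_sigma (inl (inl tt)) _ (count_event_sigma f)).
have := independent_integral_prod hind sub_soup_sigma us (f := sfac f)
  (fun i B _ => @sfac_sigma f i B).
rewrite (eq_bigr (fun i => (r i)%:E)); last first.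
  move=> [[_|[[L kk] j]]|x] _ /=.
  - by rewrite integral_indic// setIT fineK// fin_num_measure.
  - exact: integral_step_factor.
  - exact: integral_point_factor.
have f01 i w : 0 <= sfac f i w <= 1.
  case: i => [[_|[[L kk] j]]|x] /=.
  - by rewrite indicE ler0n lern1 leq_b1.
  - exact: step_factor01.
  - exact: point_factor01.
move=> /(_ f01) E.
rewrite (_ : (\int[P]_w _ = \int[P]_w (\prod_(i <- s) sfac f i w)%:E)%E); last first.
  by apply: eq_integral => w _; rewrite prods mulrA.
rewrite E prodEFin (prods _ r)/= count_event_prob.
rewrite (eq_bigr (fun i => (fine (P [set w | N w [set Li i] = (f i)%:R%:E]))%:E)); last first.
  by move=> i _; rewrite fineK// fin_num_measure//; apply: measurable_eq_cst; exact: measurable_count.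
rewrite prodEFin/= mulrA EFinM; congr (_ * _)%E.
rewrite -big_split -prodEFin; apply: eq_bigr => i _ /=.
rewrite EFinM fineK ?fin_num_measure//; last by apply: measurable_eq_cst; exact: measurable_count.
by rewrite prodr_const card_ord.
Qed.
End finite_family.
End soup_blocks.

(** * The soup restricted to finitely many loops *)

Section soup_limit.
Context (R : realType) (d : nat) (D : {fset lattice d}).
Context d' (Omega : measurableType d') (P : probability Omega R).
Variables (N : R.-ker Omega ~> cyclic_word (lattice d))
  (tau : cyclic_word (lattice d) -> nat -> nat -> {RV P >-> R})
  (M : D -> R.-ker Omega ~> measurableTypeR R).
Hypothesis hsoup : is_loop_soup N tau M 2^-1.
Variable k : D -> nat.
Notation cword := (cyclic_word (lattice d)).

Lemma sum_step_time (L : cword) kk w :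
  \sum_x (k x)%:R * step_time tau x L kk w =
  \sum_(j < loop_length L) site_cost R k (nth 0 (repr L) j) * tau L kk j w.
Proof.
under eq_bigr do rewrite mulr_sumr big_mkcond.
rewrite exchange_big; apply: eq_bigr => j _ /=.
have [xD|xD] := boolP (nth 0 (repr L) j \in D); last first.
  rewrite /site_cost extend0_out// mul0r big1// => x _.
  by case: eqP => // xE; rewrite xE (valP x) in xD.
rewrite (bigD1 [` xD]%fset)//= eqxx big1 ?addr0.
  by rewrite /site_cost -[X in extend0 _ X]/(val [` xD]%fset) extend0_val.
by move=> x /negbTE xE; case: eqP => // xE'; rewrite -(inj_eq val_inj) /= xE' eqxx in xE.
Qed.

Variable Ls : seq cword.
Hypothesis uLs : uniq Ls.
Hypothesis ULs : forall L, L \in Ls -> unrooted_loops D L.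
Notation sz := (size Ls).
Let Li (i : 'I_sz) : cword := tnth (in_tuple Ls) i.

Definition partial_time (x : D) (w : Omega) : \bar R :=
  (\sum_(L <- Ls) \esum_(kk in [set kk : nat | (kk%:R%:E < N w [set L])%E])
     (step_time tau x L kk w)%:E)%E.

Definition partial_factor (w : Omega) : R :=
  (\prod_x exp_opp (partial_time x w) ^+ k x) * \prod_x point_factor M k x w.

Definition count_factor (f : 'I_sz -> nat) (w : Omega) : R :=
  (\prod_(i < sz) \prod_(kk < f i) \prod_(j < loop_length (Li i))
     step_factor tau k (Li i) kk j w) * \prod_x point_factor M k x w.

(** Nonnegative waiting times make each [esum] an ordinary finite sum and remove the maximum in
    [step_factor]; the exponential then splits over the steps. *)
Lemma partial_factorE (f : 'I_sz -> nat) w :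
  (forall i, N w [set Li i] = (f i)%:R%:E) ->
  (forall L, L \in Ls -> forall kk j, 0 <= tau L kk j w) ->
  partial_factor w = count_factor f w.
Proof.
move=> Nf tau0; congr (_ * _).
have Ls_i i : Li i \in Ls by exact: mem_tnth.
have st0 x i kk : 0 <= step_time tau x (Li i) kk w.
  by apply: sumr_ge0 => j _; exact: tau0.
transitivity (\prod_x expR (- (\sum_(i < sz) \sum_(kk < f i) step_time tau x (Li i) kk w)) ^+ k x).
  apply: eq_bigr => x _; congr (_ ^+ _).
  rewrite /partial_time big_tnth (eq_bigr (fun i => (\sum_(kk < f i) step_time tau x (Li i) kk w)%:E)) ?sumEFin//.
  move=> i _; rewrite -/(Li i) Nf.
  rewrite (_ : [set kk | _] = [set` iota 0 (f i)]); last first.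
    by apply/seteqP; split => kk /=; rewrite lte_fin ltr_nat mem_iota.
  rewrite esum_fset; [|exact: finite_seq|by move=> kk _; rewrite lee_fin].
  by rewrite -fsbig_seq ?iota_uniq// sumEFin -{1}[f i]subn0 -/(index_iota 0 (f i)) big_mkord.
transitivity (expR (- \sum_(i < sz) \sum_(kk < f i) \sum_(j < loop_length (Li i))
    site_cost R k (nth 0 (repr (Li i)) j) * tau (Li i) kk j w)).
  under eq_bigr do rewrite -expRM_natr; rewrite -expR_sum; congr expR.
  under eq_bigr do rewrite mulrC mulrN mulr_sumr; rewrite sumrN; congr (- _).
  rewrite exchange_big; apply: eq_bigr => i _ /=.
  under eq_bigr do rewrite mulr_sumr; rewrite exchange_big.
  by apply: eq_bigr => kk _ /=; exact: sum_step_time.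
rewrite -sumrN expR_sum; apply: eq_bigr => i _; rewrite -sumrN expR_sum.
apply: eq_bigr => kk _; rewrite -sumrN expR_sum; apply: eq_bigr => j _.
by rewrite /step_factor max_l// tau0.
Qed.

Lemma prod01 (I : Type) (s : seq I) (Q : pred I) (F : I -> R) :
  (forall i, 0 <= F i <= 1) -> 0 <= \prod_(i <- s | Q i) F i <= 1.
Proof.
move=> F01; elim/big_ind: _ => [|x y /andP[x0 x1] /andP[y0 y1]|//].
  by rewrite ler01 lexx.
by rewrite mulr_ge0// mulr_ile1.
Qed.

Lemma count_factor01 f w : 0 <= count_factor f w <= 1.
Proof.
have /andP[a0 a1] : 0 <= \prod_(i < sz) \prod_(kk < f i) \prod_(j < loop_length (Li i))
     step_factor tau k (Li i) kk j w <= 1.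
  do 3!(apply: prod01 => ?); exact: step_factor01.
have /andP[b0 b1] : 0 <= \prod_x point_factor M k x w <= 1.
  by apply: prod01 => x; exact: point_factor01.
by rewrite mulr_ge0// mulr_ile1.
Qed.

Lemma partial_factor01 w : (forall L, L \in Ls -> forall kk j, 0 <= tau L kk j w) -> 0 <= partial_factor w <= 1.
Proof.
move=> tau0.
have /andP[a0 a1] : 0 <= \prod_x exp_opp (partial_time x w) ^+ k x <= 1.
  apply: prod01 => x; have p0 : (0 <= partial_time x w)%E.
    rewrite /partial_time big_seq; apply: sume_ge0 => L LLs; apply: esum_ge0 => kk _.
    by rewrite lee_fin; apply: sumr_ge0 => j _; exact: tau0.
  by rewrite exprn_ge0 ?exp_opp_ge0//= exprn_ile1 ?exp_opp_ge0 ?exp_opp_le1.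
have /andP[b0 b1] : 0 <= \prod_x point_factor M k x w <= 1.
  by apply: prod01 => x; exact: point_factor01.
by rewrite mulr_ge0// mulr_ile1.
Qed.

Lemma measurable_step_factor L kk j : measurable_fun setT (step_factor tau k L kk j).
Proof.
apply: measurableT_comp => //; apply: measurableT_comp => //.
by apply: measurable_funM => //; exact: measurable_maxr.
Qed.

Lemma measurable_point_factor x : measurable_fun setT (point_factor M k x).
Proof.
apply: measurable_funX; apply: (measurableT_comp (@measurable_exp_opp R)).
by apply: measurable_integral_id => A mA; exact: measurable_kernel.
Qed.

Lemma measurable_partial_factor : measurable_fun setT partial_factor.
Proof.
apply: measurable_funM; apply: measurable_prod => x _; last exact: measurable_point_factor.
apply: measurable_funX; apply: (measurableT_comp (@measurable_exp_opp R)).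
by apply: emeasurable_sum => L; exact: measurable_esum_step_time.
Qed.

Lemma measurable_count_factor f : measurable_fun setT (count_factor f).
Proof.
apply: measurable_funM; last by apply: measurable_prod => x _; exact: measurable_point_factor.
by do 3!(apply: measurable_prod => ? _); exact: measurable_step_factor.
Qed.

(* Truncating the numbers of loops at B turns a product of random length into a
   finite sum over deterministic numbers of loops. *)
Lemma sum_count_event B (f0 : 'I_sz -> nat) w : (forall i, N w [set Li i] = (f0 i)%:R%:E) ->
  \sum_(f : {ffun 'I_sz -> 'I_B}) \1_(count_event N (fun i => f i : nat)) w
     * count_factor (fun i => f i : nat) w =
  if [forall i, f0 i < B]%N then count_factor f0 w else 0.
Proof.
move=> Nf.
have iE (f : 'I_sz -> nat) : \1_(count_event N f) w = ([forall i, f i == f0 i])%:R :> R.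
  rewrite indicE; congr ((nat_of_bool _)%:R); apply/idP/forallP => [|ff0].
    rewrite inE /count_event -bigcap_seq => h i; have := h i (mem_index_enum i).
    by rewrite /= Nf => -[/eqP]; rewrite eqr_nat eq_sym.
  by rewrite inE /count_event -bigcap_seq => i _ /=; rewrite Nf (eqP (ff0 i)).
case: ifPn => [/forallP f0B|/forallPn[i0 f0B]]; last first.
  rewrite big1// => f _; rewrite iE; case: forallP => [/(_ i0)/eqP h|_]; last by rewrite mul0r.
  by rewrite -h ltn_ord in f0B.
pose g : {ffun 'I_sz -> 'I_B} := [ffun i => Ordinal (f0B i)].
have gE : (fun i => g i : nat) = f0 by apply/funext => i; rewrite ffunE.
rewrite (bigD1 g)//= iE gE big1 ?addr0.
  have -> : [forall i, g i == f0 i :> nat] by apply/forallP => i; rewrite ffunE.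
  by rewrite mul1r.
move=> f fg; rewrite iE; case: forallP => [h|_]; last by rewrite mul0r.
case/eqP: fg; apply/ffunP => i; apply: val_inj; rewrite ffunE /=; exact/eqP.
Qed.

(** The counts of distinct loops being independent, the sum over count vectors factors into one
    truncated Poisson generating function per loop. *)
Lemma integral_sum_count_event B :
  (\int[P]_w (\sum_(f : {ffun 'I_sz -> 'I_B}) \1_(count_event N (fun i => f i : nat)) w
     * count_factor (fun i => f i : nat) w)%:E =
  ((\prod_(i < sz) \sum_(m < B) (mean_factor R k (Li i) ^+ m *
      ((2^-1 * loop_weight R (Li i)) ^+ m / m`!%:R * expR (- (2^-1 * loop_weight R (Li i))))))
   * (\prod_x expR (- (2^-1 * ln (1 + (k x)%:R)))))%:E)%E.
Proof.
under eq_integral do rewrite -sumEFin.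
have mf (f : 'I_sz -> nat) : measurable_fun setT (fun w => \1_(count_event N f) w * count_factor f w).
  apply: measurable_funM; last exact: measurable_count_factor.
  apply: measurable_indic.
exact: (@sub_soup_sigma _ _ _ _ _ P N tau M (inl (inl tt)) _ (count_event_sigma f)).
rewrite ge0_integral_sum//; [|by move=> f; apply/measurable_EFinP; exact: mf|]; last first.
  move=> f w _; rewrite lee_fin mulr_ge0//; by have /andP[] := count_factor01 (fun i => f i : nat) w.
rewrite bigA_distr_bigA mulr_suml -sumEFin; apply: eq_bigr => f _.
transitivity ((\prod_(i < sz)
  (P [set w | N w [set Li i] = (f i)%:R%:E] * (mean_factor R k (Li i) ^+ f i)%:E))
   * (\prod_x expR (- (2^-1 * ln (1 + (k x)%:R))))%:E)%E.
  rewrite -(integral_count_event hsoup k uLs).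
  by apply: eq_integral => w _; rewrite mulrA.
rewrite EFinM; congr (_ * _)%E; apply: etrans (prodEFin _ _ _); apply: eq_bigr => i _.
rewrite (count_law hsoup); last by apply: ULs; exact: mem_tnth.
rewrite poisson_prob1 ?mulr_ge0 ?invr_ge0 ?loop_weight_ge0//.
by rewrite -EFinM mulrC.
Qed.
Lemma ae_tau_ge0 L : {ae P, forall w, forall kk j, 0 <= tau L kk j w}.
Proof.
have [_ htau _ _] := hsoup.
apply: filterS (_ : {ae P, forall w kk, forall j, 0 <= tau L kk j w}) => //.
apply: ae_foralln => kk; apply: ae_foralln => j.
by apply: exponential_ge0; exact: htau.
Qed.

Lemma ae_seq (s : seq cword) (Q : cword -> Omega -> Prop) :
  (forall L, L \in s -> {ae P, forall w, Q L w}) ->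
  {ae P, forall w L, L \in s -> Q L w}.
Proof.
elim: s => [_|L s IH Qs]; first exact: aeW.
have QL := Qs _ (mem_head _ _).
have {}IH : {ae P, forall w L, L \in s -> Q L w}.
  by apply: IH => L' L's; apply: Qs; rewrite inE L's orbT.
apply: filterS2 QL IH => w QL IH L'; rewrite inE => /predU1P[->//|]; exact: IH.
Qed.

Lemma ae_count : {ae P, forall w, exists f : 'I_sz -> nat, forall i, N w [set Li i] = (f i)%:R%:E}.
Proof.
apply: filterS (_ : {ae P, forall w L, L \in Ls -> exists m : nat, N w [set L] = m%:R%:E}).
  move=> w h; have {}h i : exists m : nat, N w [set Li i] = m%:R%:E by apply: h; exact: mem_tnth.
  by exists (fun i => sval (cid (h i))) => i; case: cid.
apply: ae_seq => L LLs; apply: (@poisson_ae_fin _ _ _ _ _ (2^-1 * loop_weight R L)).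
- by rewrite mulr_ge0 ?invr_ge0 ?loop_weight_ge0.
- exact: (measurable_count N L).
- by apply: (count_law hsoup); exact: ULs.
Qed.

Lemma cvg_prodr (I : Type) (s : seq I) (u : I -> nat -> R) (l : I -> R) :
  (forall i, u i n @[n --> \oo] --> l i) ->
  \prod_(i <- s) u i n @[n --> \oo] --> \prod_(i <- s) l i.
Proof.
move=> ul; elim: s => [|i s IH].
  by rewrite big_nil; under eq_fun do rewrite big_nil; exact: cvg_cst.
by rewrite big_cons; under eq_fun do rewrite big_cons; apply: cvgM; [exact: ul|exact: IH].
Qed.

(** Almost surely the truncated sum equals the full factor as soon as B exceeds all counts. On the
    other side each truncated series converges to the Poisson generating function at
    [mean_factor]. *)
Lemma integral_partial_factor :
  (\int[P]_w (partial_factor w)%:E =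
   (expR (- (2^-1 * \sum_(L <- Ls) loop_weight R L * (1 - mean_factor R k L)))
    * \prod_x expR (- (2^-1 * ln (1 + (k x)%:R))))%:E)%E.
Proof.
pose h B w := (\sum_(f : {ffun 'I_sz -> 'I_B})
  \1_(count_event N (fun i => f i : nat)) w * count_factor (fun i => f i : nat) w)%:E.
have mh B : measurable_fun setT (h B).
  apply/measurable_EFinP; apply: measurable_sum => f.
  apply: measurable_funM; last exact: measurable_count_factor.
  apply: measurable_indic; exact: (@sub_soup_sigma _ _ _ _ _ P N tau M (inl (inl tt)) _ (count_event_sigma _)).
have good : {ae P, forall w, (forall L, L \in Ls -> forall kk j, 0 <= tau L kk j w) /\
    exists f : 'I_sz -> nat, forall i, N w [set Li i] = (f i)%:R%:E}.
  have ht : {ae P, forall w L, L \in Ls -> forall kk j, 0 <= tau L kk j w}.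
    by apply: ae_seq => L _; exact: ae_tau_ge0.
  by apply: filterS2 ae_count ht => w cw tw; split.
have mpartial : measurable_fun setT (fun w => (partial_factor w)%:E).
  exact/measurable_EFinP/measurable_partial_factor.
have [|||_ _] := @dominated_convergence _ _ _ P _ measurableT h
  (fun w => (partial_factor w)%:E) (cst 1%E) mh mpartial.
- apply: filterS good => w [tw [f fw]] _.
  rewrite (partial_factorE fw tw); apply: cvg_near_cst; near=> B.
  have maxB : (\max_i f i < B)%N by near: B; exact: nbhs_infty_gt.
  rewrite /h (sum_count_event _ fw).
  have -> : [forall i, (f i < B)%N]; last by [].
  by apply/forallP => i; apply: leq_ltn_trans maxB; exact: leq_bigmax.
- exact: finite_measure_integrable_cst.
- apply: filterS good => w [tw [f fw]] B _.
  rewrite /h (sum_count_event _ fw) /=; case: ifP => _; rewrite lee_fin ?normr0//.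
  by have /andP[f0 f1] := count_factor01 f w; rewrite ger0_norm.
move/cvg_lim => <- //; apply/cvg_lim => //.
have cvgp : \prod_(i < sz) \sum_(m < B) (mean_factor R k (Li i) ^+ m *
      ((2^-1 * loop_weight R (Li i)) ^+ m / m`!%:R * expR (- (2^-1 * loop_weight R (Li i)))))
    @[B --> \oo] -->
    \prod_(i < sz) expR (- (2^-1 * loop_weight R (Li i) * (1 - mean_factor R k (Li i)))).
  apply: cvg_prodr => i. exact: (@poisson_pgf R (2^-1 * loop_weight R (Li i)) (mean_factor R k (Li i))).
rewrite mulr_sumr -sumrN expR_sum big_tnth.
under [X in _ --> (X * _)%:E]eq_bigr do rewrite mulrA.
rewrite (_ : (fun B => _) = fun B => ((\prod_(i < sz) \sum_(m < B) (mean_factor R k (Li i) ^+ m *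
      ((2^-1 * loop_weight R (Li i)) ^+ m / m`!%:R * expR (- (2^-1 * loop_weight R (Li i))))))
   * (\prod_x expR (- (2^-1 * ln (1 + (k x)%:R)))))%:E); last first.
  by apply/funext => B; exact: integral_sum_count_event.
apply: cvg_EFin; first exact: nearW.
by apply: cvgM; [exact: cvgp|exact: cvg_cst].
Unshelve. all: by end_near. Qed.

End soup_limit.

(** * The Laplace transforms of the two fields *)

Section gff_moments.
Context (R : realType) (d : nat) (D : {fset lattice d}).
Hypothesis d0 : (0 < d)%N.
Context d' (Omega : measurableType d') (P : probability Omega R).
Variable Gamma : D -> {RV P >-> R}.
Hypothesis hGamma : is_dirichlet_gff Gamma.
Notation N := #|{: D}|.
Notation A := (1%:M - step_mx R D).

Lemma posdef_1B_step_mx : posdef A.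
Proof.
have := @posdef_step_mx R d D d0 0.
rewrite raddf0 addr0; apply => i; by rewrite mxE.
Qed.

(** The 1/2 in Gamma^2 / 2 matches that of the Gaussian exponent, so exp (- k_x Gamma_x^2 / 2) just
    adds k_x to a diagonal entry of the quadratic form. *)
Lemma gff_moments (k : D -> nat) :
  (\int[P]_w (\prod_x exp_opp (Gamma x w ^+ 2 / 2)%:E ^+ k x)%:E =
   (Num.sqrt (\det A) /
    Num.sqrt (\det (A + diag_mx (\row_i (k (enum_val i))%:R))))%:E)%E.
Proof.
have [c c0 hc] := hGamma.
set K := \row_i _.
have [detA intA] := gaussian_integral posdef_1B_step_mx.
have K0 i : 0 <= K ord0 i by rewrite mxE.
have [detK intK] := gaussian_integral (posdef_step_mx d0 K0).
pose X1 : Omega -> fields D R := fun w x => Gamma x w.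
pose X2 : N.-tuple (measurableTypeR R) -> fields D R := @field_of_tuple R d D.
pose G2 (t : N.-tuple (measurableTypeR R)) := c * gff_density (field_of_tuple t).
have G2E t : G2 t = c * expR (- 2^-1 * qform A (tnth t)) by rewrite /G2 gff_density_qform.
have mX1 : measurable_fun setT X1 by exact: measurable_fun_fields.
have mX2 : measurable_fun setT X2.
  by apply: measurable_fun_fields => x; exact: measurable_tnth.
have mG2 : measurable_fun setT G2.
  by rewrite (funext G2E); apply: measurable_funM => //; exact: measurable_gauss.
have G20 t : 0 <= G2 t by rewrite G2E mulr_ge0 ?expR_ge0// ltW.
have law B : measurable B -> (\int[P]_(w in X1 @^-1` B) (cst 1%R w)%:E =
    \int[lebesgue_tuple R N]_(t in X2 @^-1` B) (G2 t)%:E)%E.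
  move=> mB; have mXB : measurable (X1 @^-1` B) by rewrite -[X in measurable X]setTI; exact: mX1.
  by rewrite [LHS](integral_cst P mXB 1%E) mul1e; exact: hc.
have mgA : measurable_fun setT (fun t : N.-tuple (measurableTypeR R) =>
    (expR (- 2^-1 * qform A (tnth t)))%:E).
  by apply/measurable_EFinP; exact: measurable_gauss.
(* The constant [c] is only known to exist; total mass 1 determines it, and the powers of 2 pi
   cancel in the quotient. *)
have norm : c * (Num.sqrt (2 * pi) ^+ N / Num.sqrt (\det A)) = 1.
  apply: EFin_inj; have := law setT measurableT.
  rewrite !preimage_setT [LHS](integral_cst P measurableT 1%E) mul1e.
  rewrite [X in X = _ -> _](probability_setT P) => ->.
  rewrite EFinM -intA -[LHS](ge0_integralZl _ measurableT mgA)//.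
    by apply: eq_integral => t _; rewrite G2E EFinM.
  by rewrite lee_fin ltW.
pose f (g : fields D R) := (\prod_x exp_opp (g x ^+ 2 / 2)%:E ^+ k x)%:E.
have mf : measurable_fun setT f.
  apply/measurable_EFinP; apply: measurable_prod => x _; apply: measurable_funX.
  apply: (measurableT_comp (@measurable_exp_opp R)); apply/measurable_EFinP.
  apply: measurable_funM => //; apply: measurable_funX; exact: measurable_fun_coord.
have f0 g : (0 <= f g)%E.
  by rewrite lee_fin prodr_ge0// => x _; rewrite exprn_ge0// exp_opp_ge0.
transitivity (\int[P]_w (f (X1 w) * (cst 1%R w)%:E))%E.
  by apply: eq_integral => w _; rewrite mule1.
rewrite (eq_weighted_law_integral mX1 mX2 _ mG2 _ G20 law)//.
transitivity (\int[lebesgue_tuple R N]_t (c%:E *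
    (expR (- 2^-1 * qform (A + diag_mx K) (tnth t)))%:E))%E.
  apply: eq_integral => t _; rewrite G2E /f -!EFinM; congr _%:E.
  rewrite mulrCA; congr (_ * _); rewrite qform_addD_diag mulrDr expRD mulrC; congr (_ * _).
  rewrite sum_rank mulr_sumr expR_sum; apply: eq_bigr => x _.
  rewrite mxE enum_rankK /= -expRM_natl; congr expR.
  by rewrite /X2 /field_of_tuple; field.
have mgK : measurable_fun setT (fun t : N.-tuple (measurableTypeR R) =>
    (expR (- 2^-1 * qform (A + diag_mx K) (tnth t)))%:E).
  by apply/measurable_EFinP; exact: measurable_gauss.
rewrite [LHS](ge0_integralZl _ measurableT mgK)//; last by rewrite lee_fin ltW.
rewrite intK -EFinM; congr _%:E.
have ratio (a b p : R) : a != 0 -> c * (p / a) = 1 -> c * (p / b) = a / b.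
  by move=> a0 cpa; rewrite mulrA -[c * p](divfK a0) -[c * p / a]mulrA cpa mul1r.
by apply: ratio norm; rewrite gt_eqF// sqrtr_gt0.
Qed.

End gff_moments.

(** * From sums over loops to determinants *)

Section loop_generating_function.
Context (R : realType) (d : nat) (D : {fset lattice d}).
Hypothesis d0 : (0 < d)%N.
Variable k : D -> nat.
Notation n := #|{: D}|.
Notation S := (step_mx R D).
Notation c := (fun x : lattice d => (1 + site_cost R k x)^-1).
Notation Q := (tilted_mx D c).
Notation K := (\row_(i < n) (k (enum_val i))%:R : 'rV[R]_n).

Let site_costE i : site_cost R k (site i) = (k (enum_val i))%:R.
Proof. by rewrite /site_cost extend0_val. Qed.

Let c01 x : 0 <= c x <= 1.
Proof.
have k0 := site_cost_ge0 R k x.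
by rewrite invr_ge0 addr_ge0//= invf_le1 ?lerDl// ltr_pwDl.
Qed.

Lemma det_tilted : \det (1%:M - S + diag_mx K) = \det (1%:M - Q) * \prod_x (1 + (k x)%:R).
Proof.
have -> : 1%:M - S + diag_mx K = (1%:M - Q) *m diag_mx (\row_i (1 + (k (enum_val i))%:R)).
  have subE (A : 'M[R]_n) i j : (1%:M - A) i j = (i == j)%:R - A i j by rewrite !mxE.
  have QE i j : (1%:M - Q) i j = (i == j)%:R - S i j * c (site j).
    by rewrite subE tilted_mxE.
  have SE i j : (1%:M - S + diag_mx K) i j = (i == j)%:R - S i j + (k (enum_val i))%:R *+ (i == j).
    by rewrite mxE subE; congr (_ + _); rewrite mxE mxE; case: eqP => [->|].
  apply/matrixP => i j; rewrite SE mul_mx_diag [RHS]mxE QE [X in _ * X]mxE site_costE mulrBl.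
  have k1 : 1 + (k (enum_val j))%:R != 0 :> R by rewrite gt_eqF// ltr_pwDl.
  rewrite divfK// mulrDr mulr1.
  by case: eqP => [->|_]; rewrite ?mulr1n ?mulr0n ?mul1r ?mul0r; ring.
rewrite det_mulmx det_diag; congr (_ * _).
rewrite (reindex (@enum_rank {: D}))/=; last exact/onW_bij/enum_rank_bij.
by apply: eq_bigr => x _; rewrite mxE enum_rankK.
Qed.

Let detS : 0 < \det (1%:M - S).
Proof. exact: (gaussian_integral (posdef_1B_step_mx R D d0)).1. Qed.

(** Q need not be symmetric, so positivity is deduced from the factorisation [det_tilted] of a
    positive definite matrix. *)
Let detQ : 0 < \det (1%:M - Q).
Proof.
have K0 i : 0 <= K ord0 i by rewrite mxE.
have := (gaussian_integral (posdef_step_mx d0 K0)).1.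
by rewrite det_tilted pmulr_lgt0// prodr_gt0// => x _; rewrite ltr_pwDl.
Qed.

Let tr (A : 'M[R]_n) M := \sum_(m < M) \tr (A ^+ m.+1) / m.+1%:R.

(** Since c <= 1, the function [g] and the rate [rho] found for S serve for Q as well. *)
Lemma cvg_expR_trace : 
  (expR (tr S M) @[M --> \oo] --> (\det (1%:M - S))^-1) /\
  (expR (tr Q M) @[M --> \oo] --> (\det (1%:M - Q))^-1).
Proof.
have [g [rho [g0 rho01 Sg]]] := step_mx_superharmonic R D d0.
have Q0 i j : 0 <= Q i j.
  by rewrite tilted_mxE mulr_ge0 ?step_mx_ge0//; have /andP[] := c01 (site j).
have Qg i : \sum_j Q i j * g j <= rho * g i.
  apply: le_trans (Sg i); apply: ler_sum => j _; rewrite tilted_mxE.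
  apply: ler_wpM2r; first exact: ltW.
  rewrite ler_piMr ?step_mx_ge0//; by have /andP[] := c01 (site j).
have gen (A : 'M[R]_n) : 0 < \det (1%:M - A) ->
   expR (tr A M) * \det (1%:M - A) @[M --> \oo] --> (1 : R) ->
   expR (tr A M) @[M --> \oo] --> (\det (1%:M - A))^-1.
  move=> a0 cv; rewrite -[X in _ --> X]mul1r.
  rewrite (_ : (fun M => _) = fun M => expR (tr A M) * \det (1%:M - A) / \det (1%:M - A)).
    by apply: cvgM; [exact: cv|exact: cvg_cst].
  by apply/funext => M; rewrite mulfK// gt_eqF.
split; apply: gen => //; apply: (cvg_trace_log_det (h := g) (rho := rho)) => //.
exact: step_mx_ge0.
Qed.

Lemma sum_loop_seq M :
  \sum_(L <- loop_seq D M) loop_weight R L * (1 - mean_factor R k L) = tr S M.+1 - tr Q M.+1.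
Proof.
have mean L : mean_factor R k L = \prod_(x <- repr L) c x.
  by rewrite (big_nth 0) big_mkord.
(* Traces start at length 1 but loops at length 2; the extra term is 0 because no point is adjacent
   to itself. *)
have tr0 (b : lattice d -> R) : \tr (tilted_mx D b) = 0.
  by rewrite /mxtrace big1// => i _; rewrite tilted_mxE mxE adj_irrefl !mul0r.
have SE : S = tilted_mx D (fun=> 1) by apply/matrixP => i j; rewrite tilted_mxE mulr1.
elim: M => [|M IH]; first by rewrite big_nil /tr !big_ord1 !expr1 SE !tr0 !mul0r subrr.
rewrite /= big_cat IH /tr ![\sum_(m < M.+2) _]big_ord_recr/= -/(tr S _) -/(tr Q _).
rewrite (_ : \sum_(L <- class_seq D M.+2) _ = \tr (S ^+ M.+2) / M.+2%:R - \tr (Q ^+ M.+2) / M.+2%:R).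
  by rewrite /tr; ring.
rewrite SE -!sum_loops_trace// -sumrB; apply: eq_bigr => L _.
by rewrite big1// -mean mulrBr.
Qed.

(** The intensity 1/2 turns every exponential into a square root, and [det_tilted] merges the
    one-point factor with det (1 - Q). *)
Lemma cvg_loop_generating :
  expR (- (2^-1 * \sum_(L <- loop_seq D M) loop_weight R L * (1 - mean_factor R k L)))
    * \prod_x expR (- (2^-1 * ln (1 + (k x)%:R))) @[M --> \oo] -->
  Num.sqrt (\det (1%:M - S)) / Num.sqrt (\det (1%:M - S + diag_mx K)).
Proof.
have sqrt_expR (x : R) : expR (2^-1 * x) = Num.sqrt (expR x).
  have : expR (2^-1 * x) ^+ 2 = expR x by rewrite -expRM_natr; congr expR; field.
  by move=> <-; rewrite sqrtr_sqr ger0_norm ?expR_ge0.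
have [cS cQ] := cvg_expR_trace.
have cvgE : expR (- (2^-1 * \sum_(L <- loop_seq D M) loop_weight R L * (1 - mean_factor R k L)))
    @[M --> \oo] --> Num.sqrt (\det (1%:M - S) / \det (1%:M - Q)).
  under eq_fun do rewrite -mulrN sum_loop_seq opprB sqrt_expR.
  apply: continuous_cvg; first exact: sqrt_continuous.
  under eq_fun do rewrite expRB.
  rewrite mulrC; apply: cvgM.
    by move: cQ; rewrite -cvg_shiftS.
  rewrite -[X in _ --> X]invrK; apply: cvgV; first by rewrite invr_eq0 gt_eqF.
  by move: cS; rewrite -cvg_shiftS.
have -> : Num.sqrt (\det (1%:M - S)) / Num.sqrt (\det (1%:M - S + diag_mx K)) =
    Num.sqrt (\det (1%:M - S) / \det (1%:M - Q)) * \prod_x expR (- (2^-1 * ln (1 + (k x)%:R))).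
  have -> : \prod_x expR (- (2^-1 * ln (1 + (k x)%:R : R))) = Num.sqrt ((\prod_x (1 + (k x)%:R))^-1).
    transitivity (expR (2^-1 * - \sum_x ln (1 + (k x)%:R) : R)).
      by rewrite -sumrN mulr_sumr expR_sum; apply: eq_bigr => x _; rewrite mulrN.
    rewrite sqrt_expR expRN expR_sum; congr (Num.sqrt _^-1).
    by apply: eq_bigr => x _; rewrite lnK// posrE ltr_pwDl.
  have p0 : 0 <= \prod_x (1 + (k x)%:R : R) by apply: prodr_ge0 => x _; rewrite addr_ge0.
  have [S0 Q0] := (ltW detS, ltW detQ).
  rewrite det_tilted (sqrtrM _ Q0) (sqrtrM _ S0) (sqrtrV Q0) (sqrtrV p0).
  by rewrite invfM mulrA.
by apply: cvgM; [exact: cvgE|exact: cvg_cst].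
Qed.

End loop_generating_function.

Section soup_moments.
Context (R : realType) (d : nat) (D : {fset lattice d}).
Hypothesis d0 : (0 < d)%N.
Context d' (Omega : measurableType d') (P : probability Omega R).
Variables (N : R.-ker Omega ~> cyclic_word (lattice d))
  (tau : cyclic_word (lattice d) -> nat -> nat -> {RV P >-> R})
  (M : D -> R.-ker Omega ~> measurableTypeR R).
Hypothesis hsoup : is_loop_soup N tau M 2^-1.

Lemma soup_moments (k : D -> nat) :
  (\int[P]_w (\prod_x exp_opp (occupation_time N tau M x w) ^+ k x)%:E =
   (Num.sqrt (\det (1%:M - step_mx R D)) /
    Num.sqrt (\det (1%:M - step_mx R D + diag_mx (\row_i (k (enum_val i))%:R))))%:E)%E.
Proof.
pose h n w := (partial_factor N tau M k (loop_seq D n) w)%:E.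
have mh n : measurable_fun setT (h n).
  apply/measurable_EFinP; exact: measurable_partial_factor.
pose f w := (\prod_x exp_opp (occupation_time N tau M x w) ^+ k x)%:E.
have mf : measurable_fun setT f.
  apply/measurable_EFinP; apply: measurable_prod => x _; apply: measurable_funX.
  apply: (measurableT_comp (@measurable_exp_opp R)); exact: measurable_occupation_time.
have good : {ae P, forall w, forall n L, L \in loop_seq D n -> forall kk j, 0 <= tau L kk j w}.
  by apply: ae_foralln => n; apply: ae_seq => L _; exact: ae_tau_ge0 hsoup _.
have [|||_ _] := @dominated_convergence _ _ _ P _ measurableT h f (cst 1%E) mh mf.
- apply: aeW => w _; rewrite /h /f; apply: cvg_EFin; first exact: nearW.
  under [X in _ --> X]eq_bigr do rewrite occupation_timeE exp_oppD ?loop_time_ge0 ?integral_id_ge0// exprMn.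
  rewrite big_split; apply: cvgM; last exact: cvg_cst.
  apply: cvg_prodr => x.
  have cvx : exp_opp (partial_time N tau (loop_seq D n) x w) @[n --> \oo] -->
      exp_opp (loop_time N tau x w).
    by apply: cvg_exp_opp; [exact: loop_time_ge0|exact: cvg_loop_time].
  exact: cvg_comp cvx (@exprn_continuous R (k x) _).
- exact: finite_measure_integrable_cst.
- apply: filterS good => w tau0 n _.
  have /andP[p0 p1] := @partial_factor01 _ _ _ _ _ P N tau M k _ _ (tau0 n).
  by rewrite lee_fin ger0_norm.
move/cvg_lim => <- //; apply/cvg_lim => //.
rewrite (_ : (fun n => _) = fun n => (expR (- (2^-1 * \sum_(L <- loop_seq D n)
     loop_weight R L * (1 - mean_factor R k L))) *
   \prod_x expR (- (2^-1 * ln (1 + (k x)%:R))))%:E); last first.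
  apply/funext => n; apply: integral_partial_factor => //; first exact: uniq_loop_seq.
  by move=> L /mem_loop_seq[].
by apply: cvg_EFin; [exact: nearW|exact: cvg_loop_generating].
Unshelve. all: by end_near. Qed.

End soup_moments.

Theorem proposition2p39 (R : realType) (d : nat) (hd : (0 < d)%N)
    (D : {fset lattice d}) (hD : D != fset0)
    (d1 : measure_display) (Omega1 : measurableType d1)
    (P1 : probability Omega1 R) (Gamma : D -> {RV P1 >-> R})
    (hGamma : is_dirichlet_gff Gamma)
    (d2 : measure_display) (Omega2 : measurableType d2)
    (P2 : probability Omega2 R)
    (N : R.-ker Omega2 ~> cyclic_word (lattice d))
    (tau : cyclic_word (lattice d) -> nat -> nat -> {RV P2 >-> R})
    (M : D -> R.-ker Omega2 ~> measurableTypeR R)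
    (hsoup : is_loop_soup N tau M 2^-1) :
  same_law P2 P1 (occupation_time N tau M)
    (fun x w => (Gamma x w ^+ 2 / 2)%:E).
Proof.
have mW x : measurable_fun setT (occupation_time N tau M x) by exact: measurable_occupation_time.
have mG x : measurable_fun setT (fun w => (Gamma x w ^+ 2 / 2)%:E).
  by apply/measurable_EFinP; apply: measurable_funM => //; exact: measurable_funX.
split => // B mB; apply: eq_moments_law => //.
- by move=> x w; exact: occupation_time_ge0.
- by move=> x w; rewrite lee_fin divr_ge0// sqr_ge0.
- by move=> k; rewrite (soup_moments hd hsoup) (gff_moments hd hGamma).
Qed.
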